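(* Let $k$ be a field, $r\ge1$ an integer, and $B=k\langle x,y\rangle/(y^{r+1})$ with $\deg x=\deg y=1$. Let $b_n=\dim_kB_n$ and let $S=\varinjlim_n(S_n,\phi_n)$ be the direct limit, in the category of $k$-algebras, of the algebras $S_n=\prod_{i=0}^rM_{b_{n-i-1}}(k)$ ($n\ge r+1$) with maps $\phi_n:S_n\to S_{n+1}$, $$\phi_n(g_0,\ldots,g_r)=\big(\operatorname{diag}(g_0,\ldots,g_r),\,g_0,\,g_1,\ldots,g_{r-1}\big).$$ There is an equivalence of categories $\mathsf{QGr}\,B\equiv\mathsf{Mod}\,S$. Under the equivalence, $\mathcal{O}$ corresponds to $S_S$.
   Context: $\mathsf{QGr}\,B:=\mathsf{Gr}\,B/\mathsf{Fdim}\,B$, where $\mathsf{Gr}\,B$ is the category of $\mathbb{Z}$-graded left $B$-modules (degree-preserving maps) and $\mathsf{Fdim}\,B$ is the Serre subcategory of modules that are unions of their finite dimensional submodules. $\mathcal{O}$ is the image of the left module $B$ in $\mathsf{QGr}\,B$. $\mathsf{Mod}\,S$ is the category of right $S$-modules and $S_S$ is $S$ as a right module over itself. The numbers $b_n$ satisfy $b_n=b_{n-1}+\cdots+b_{n-r-1}$ for $n\ge r+1$, and $\operatorname{diag}(g_0,\ldots,g_r)$ is the block-diagonal $b_n\times b_n$ matrix. *)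

(* Defs.v *)
From HB Require Import structures.
From mathcomp Require Import all_boot all_order all_algebra.
From mathcomp Require Import boolp.
From mathcomp Require Import finmap.
From mathcomp.multinomials Require Import monalg.

Set Implicit Arguments.
Unset Strict Implicit.
Unset Printing Implicit Defensive.

Import Order.TTheory GRing.Theory Num.Theory.
Local Open Scope ring_scope.
Local Open Scope quotient_scope.

Section PrincipalQuotient.
Context (k : fieldType) (A : algType k) (g : A).

Definition in_tsideal (f : A) : Prop :=
  exists s : seq (A * A), f = \sum_(p <- s) p.1 * g * p.2.

Definition tsideal : {pred A} := fun f => `[< in_tsideal f >].

Lemma tsideal_zmod_closed : zmod_closed tsideal.
Proof.
split; first by apply/asboolP; exists [::]; rewrite big_nil.
move=> u v /asboolP[s ->] /asboolP[t ->]; apply/asboolP.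
exists (s ++ [seq (- p.1, p.2) | p <- t]).
rewrite big_cat big_map /= -sumrN; congr (_ + _).
by apply: eq_bigr => p _; rewrite !mulNr.
Qed.

HB.instance Definition _ :=
  GRing.isZmodClosed.Build A tsideal tsideal_zmod_closed.

Lemma tsidealMl a u : u \in tsideal -> a * u \in tsideal.
Proof.
move=> /asboolP[s ->]; apply/asboolP; exists [seq (a * p.1, p.2) | p <- s].
by rewrite big_map mulr_sumr; apply: eq_bigr => p _; rewrite !mulrA.
Qed.

Lemma tsidealMr a u : u \in tsideal -> u * a \in tsideal.
Proof.
move=> /asboolP[s ->]; apply/asboolP; exists [seq (p.1, p.2 * a) | p <- s].
by rewrite big_map mulr_suml; apply: eq_bigr => p _; rewrite !mulrA.
Qed.

Lemma tsidealZ (a : k) u : u \in tsideal -> a *: u \in tsideal.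
Proof. by move=> uI; rewrite -[u]mul1r scalerAl tsidealMl. Qed.

Lemma tsideal_proper (e : {rmorphism A -> k}) : e g = 0 -> 1 \notin tsideal.
Proof.
move=> eg; apply/asboolP => -[s /(congr1 e)].
rewrite rmorph1 rmorph_sum big1 => [/eqP|p _]; first by rewrite oner_eq0.
by rewrite !rmorphM eg mulr0 mul0r.
Qed.

(* The proof argument makes the quotient nonzero, as [algType] demands. *)
Definition quotalg (_ : 1 \notin tsideal) : Type := Quotient.quot tsideal.

Context (g_proper : 1 \notin tsideal).
Local Notation Q := (quotalg g_proper).

HB.instance Definition _ := GRing.Zmodule.on Q.

Definition qpi (f : A) : Q := \pi_(Quotient.quot tsideal) f.
Definition qrepr (u : Q) : A := repr (u : Quotient.quot tsideal).

Lemma qreprK : cancel qrepr qpi. Proof. exact: reprK. Qed.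

Lemma qpi_eq u v : u - v \in tsideal -> qpi u = qpi v.
Proof. by rewrite Quotient.idealrBE => /eqP. Qed.

Lemma qpi_is_zmod_morphism : zmod_morphism qpi.
Proof. by move=> u v; rewrite /qpi raddfB. Qed.

HB.instance Definition _ :=
  GRing.isZmodMorphism.Build A Q qpi qpi_is_zmod_morphism.

Lemma qpi_eq0 u : (qpi u == 0) = (u \in tsideal).
Proof.
rewrite -(raddf0 qpi) -[u in RHS]subr0 Quotient.idealrBE.
by [].
Qed.

Lemma qreprB u : qrepr (qpi u) - u \in tsideal.
Proof. by rewrite -qpi_eq0 raddfB /= qreprK subrr. Qed.

Definition qone : Q := qpi 1.
Definition qmul (u v : Q) : Q := qpi (qrepr u * qrepr v).
Definition qscale (a : k) (u : Q) : Q := qpi (a *: qrepr u).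

Lemma qpiM u v : qpi (u * v) = qmul (qpi u) (qpi v).
Proof.
apply/esym/qpi_eq.
set u' := qrepr (qpi u); set v' := qrepr (qpi v).
have -> : u' * v' - u * v = (u' - u) * v' + u * (v' - v).
  by rewrite mulrBl mulrBr addrA subrK.
by apply: rpredD; [apply/tsidealMr/qreprB | apply/tsidealMl/qreprB].
Qed.

Lemma qpiZ a u : qpi (a *: u) = qscale a (qpi u).
Proof. by apply/esym/qpi_eq; rewrite -scalerBr tsidealZ ?qreprB. Qed.

Lemma qmulA : associative qmul.
Proof.
by move=> u v w; rewrite -[u]qreprK -[v]qreprK -[w]qreprK -!qpiM mulrA.
Qed.

Lemma qmul1 : left_id qone qmul.
Proof. by move=> u; rewrite -[u]qreprK -qpiM mul1r. Qed.

Lemma qmulr1 : right_id qone qmul.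
Proof. by move=> u; rewrite -[u]qreprK -qpiM mulr1. Qed.

Lemma qmulDl : left_distributive qmul +%R.
Proof.
move=> u v w; rewrite -[u]qreprK -[v]qreprK -[w]qreprK -raddfD.
by rewrite -!qpiM -raddfD mulrDl.
Qed.

Lemma qmulDr : right_distributive qmul +%R.
Proof.
move=> u v w; rewrite -[u]qreprK -[v]qreprK -[w]qreprK -raddfD.
by rewrite -!qpiM -raddfD mulrDr.
Qed.

Lemma qone_neq0 : qone != 0.
Proof. by rewrite qpi_eq0 g_proper. Qed.

HB.instance Definition _ := GRing.Zmodule_isNzRing.Build Q
  qmulA qmul1 qmulr1 qmulDl qmulDr qone_neq0.

Lemma qscaleA a b u : qscale a (qscale b u) = qscale (a * b) u.
Proof. by rewrite -[u]qreprK -!qpiZ scalerA. Qed.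

Lemma qscale1 : left_id 1 qscale.
Proof. by move=> u; rewrite -[u]qreprK -qpiZ scale1r. Qed.

Lemma qscaleDr : right_distributive qscale +%R.
Proof.
by move=> a u v; rewrite -[u]qreprK -[v]qreprK -raddfD -!qpiZ -raddfD scalerDr.
Qed.

Lemma qscaleDl u : {morph qscale^~ u : a b / a + b}.
Proof. by move=> a b; rewrite -[u]qreprK -!qpiZ -raddfD scalerDl. Qed.

HB.instance Definition _ := GRing.Zmodule_isLmodule.Build k Q
  qscaleA qscale1 qscaleDr qscaleDl.

Lemma qpi_is_monoid_morphism : monoid_morphism qpi.
Proof. by split=> // u v; apply: qpiM. Qed.

HB.instance Definition _ :=
  GRing.isMonoidMorphism.Build A Q qpi qpi_is_monoid_morphism.

Lemma qpi_is_scalable : scalable qpi.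
Proof. by move=> a u; apply: qpiZ. Qed.

HB.instance Definition _ :=
  GRing.isScalable.Build k A Q *:%R qpi qpi_is_scalable.

Lemma qscalerAl (a : k) (u v : Q) : a *: (u * v) = (a *: u) * v.
Proof.
by rewrite -[u]qreprK -[v]qreprK -rmorphM -!linearZ -rmorphM scalerAl.
Qed.

HB.instance Definition _ := GRing.Lmodule_isLalgebra.Build k Q qscalerAl.

Lemma qscalerAr (a : k) (u v : Q) : a *: (u * v) = u * (a *: v).
Proof.
by rewrite -[u]qreprK -[v]qreprK -rmorphM -!linearZ -rmorphM scalerAr.
Qed.

HB.instance Definition _ := GRing.Lalgebra_isAlgebra.Build k Q qscalerAr.

End PrincipalQuotient.

(* The last two fields say that the algebra is locally finite and that
   A_m A_n = A_(m+n); they are what makes Fdim A a Serre subcategory. *)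
Record gralg (k : fieldType) := GrAlg {
  galg :> algType k;
  gpart : nat -> galg -> Prop;
  gpart_zero : forall n, gpart n 0;
  gpart_lin : forall n (a : k) u v,
    gpart n u -> gpart n v -> gpart n (a *: u + v);
  gpart_one : gpart 0 1;
  gpart_mul : forall m n u v,
    gpart m u -> gpart n v -> gpart (m + n) (u * v);
  gpart_sum : forall u, exists N (c : nat -> galg),
    (forall i, gpart i (c i)) /\ u = \sum_(i < N) c i;
  gpart_direct : forall N (c : nat -> galg), (forall i, gpart i (c i)) ->
    \sum_(i < N) c i = 0 -> forall i, (i < N)%N -> c i = 0;
  gpart_fin : forall n, exists s : seq galg, (forall u, u \in s -> gpart n u) /\
    forall u, gpart n u ->
      exists c : nat -> k, u = \sum_(i < size s) c i *: s`_i;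
  gpart_gen : forall m n u, gpart (m + n) u ->
    exists s : seq (galg * galg),
      (forall p, p \in s -> gpart m p.1 /\ gpart n p.2) /\
      u = \sum_(p <- s) p.1 * p.2 }.

Record grmod (k : fieldType) (B : gralg k) := GrMod {
  gmod :> lmodType B;
  gr : int -> gmod -> Prop;
  gr_zero : forall i, gr i 0;
  gr_sub : forall i u v, gr i u -> gr i v -> gr i (u - v);
  gr_act : forall n i b u, gpart n b -> gr i u -> gr (n%:Z + i) (b *: u);
  gr_sum : forall u, exists (s : seq int) (c : int -> gmod),
    [/\ uniq s, forall i, gr i (c i) & u = \sum_(i <- s) c i];
  gr_direct : forall (s : seq int) (c : int -> gmod),
    uniq s -> (forall i, gr i (c i)) -> \sum_(i <- s) c i = 0 ->
    forall i, i \in s -> c i = 0 }.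

Lemma sum_support (V : zmodType) (s t : seq int) (c : int -> V) :
  uniq s -> uniq t -> {subset s <= t} -> (forall i, i \notin s -> c i = 0) ->
  \sum_(i <- s) c i = \sum_(i <- t) c i.
Proof.
move=> us ut st c0; rewrite [RHS](bigID (mem s)) /= [X in _ + X]big1 ?addr0.
  rewrite -[RHS]big_filter; apply: perm_big; apply: uniq_perm => //.
    exact: filter_uniq.
  by move=> i; rewrite mem_filter; have [/st ->|] := boolP (i \in s).
by move=> i /c0.
Qed.

Section GradedModule.
Context (k : fieldType) (B : gralg k).

Section Components.
Context (M : grmod B).
Implicit Types (u v : M) (i j : int).

Definition is_decomp u (c : int -> M) : Prop :=
  (forall i, gr i (c i)) /\
  exists s : seq int, [/\ uniq s, forall i, i \notin s -> c i = 0
                        & u = \sum_(i <- s) c i].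

Lemma decomp_exists u : exists c, is_decomp u c.
Proof.
have [s [c [us cg ->]]] := gr_sum u.
exists (fun i => if i \in s then c i else 0); split=> [i|].
  by case: ifP => _ //; apply: gr_zero.
exists s; split=> // [i /negPf -> //|].
by rewrite big_seq [RHS]big_seq; apply: eq_bigr => i ->.
Qed.

(* The homogeneous component of degree i. *)
Definition gcomp i u : M := sval (cid (decomp_exists u)) i.

Lemma gcompP u : is_decomp u (gcomp^~ u).
Proof. exact: (svalP (cid (decomp_exists u))). Qed.

Lemma gcomp_gr i u : gr i (gcomp i u).
Proof. by have [] := gcompP u. Qed.

Lemma decomp_unique u c d : is_decomp u c -> is_decomp u d -> c =1 d.
Proof.
move=> [cg [s [us cs us']]] [dg [t [ut dt ut']]] i.
pose w := undup (s ++ t).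
have uw : uniq w by apply: undup_uniq.
have e : \sum_(j <- w) (c j - d j) = 0.
  rewrite sumrB -(sum_support us uw) -?(sum_support ut uw) -?us' -?ut' ?subrr //.
    by move=> j; rewrite mem_undup mem_cat orbC => ->.
  by move=> j; rewrite mem_undup mem_cat => ->.
have [iw|] := boolP (i \in w).
  apply/eqP; rewrite -subr_eq0; apply/eqP.
  by apply: (gr_direct uw _ e iw) => j; apply: gr_sub.
by rewrite mem_undup mem_cat negb_or => /andP[/cs -> /dt ->].
Qed.

Lemma gcompE u c i : is_decomp u c -> gcomp i u = c i.
Proof. by move=> h; apply: (decomp_unique (gcompP u) h). Qed.

Lemma gcompB i u v : gcomp i (u - v) = gcomp i u - gcomp i v.
Proof.
apply: (@gcompE _ (fun i => gcomp i u - gcomp i v)).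
split=> [j|]; first by apply: gr_sub; apply: gcomp_gr.
have [_ [s [us us0 eu]]] := gcompP u; have [_ [t [ut ut0 ev]]] := gcompP v.
exists (undup (s ++ t)); split; first exact: undup_uniq.
  by move=> j; rewrite mem_undup mem_cat negb_or => /andP[/us0 -> /ut0 ->];
     rewrite subr0.
rewrite sumrB {1}eu {1}ev; congr (_ - _); apply: sum_support; rewrite ?undup_uniq //.
  by move=> j; rewrite mem_undup mem_cat => ->.
by move=> j; rewrite mem_undup mem_cat orbC => ->.
Qed.

HB.instance Definition _ i := GRing.isZmodMorphism.Build M M (gcomp i) (gcompB i).

Lemma gcomp_hom i j u : gr j u -> gcomp i u = if i == j then u else 0.
Proof.
move=> ju; apply: (@gcompE _ (fun i => if i == j then u else 0)).
split=> [l|]; first by case: eqP => [->|_] //; apply: gr_zero.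
exists [:: j]; split=> // [l|]; last by rewrite big_seq1 eqxx.
by rewrite inE => /negPf ->.
Qed.

Lemma gcomp_act n b i u : gpart n b -> gcomp (n%:Z + i) (b *: u) = b *: gcomp i u.
Proof.
move=> bn; rewrite (@gcompE _ (fun j => b *: gcomp (j - n%:Z) u)).
  by rewrite [n%:Z + i]addrC addrK.
have [ug [s [us us0 eu]]] := gcompP u.
split=> [j|]; first by rewrite -[j in gr j](subrK n%:Z) addrC; apply: gr_act.
exists [seq n%:Z + i | i <- s]; split.
- by rewrite map_inj_uniq //; apply: addrI.
- move=> j jn; rewrite us0 ?scaler0 //; apply: contra jn => jn.
  by apply/mapP; exists (j - n%:Z) => //; rewrite addrC subrK.
- rewrite big_map {1}eu scaler_sumr; apply: eq_bigr => j _.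
  by rewrite addrAC subrr add0r.
Qed.

Lemma gcomp_sum u : exists s, u = \sum_(i <- s) gcomp i u.
Proof. by have [_ [s [_ _ e]]] := gcompP u; exists s. Qed.

Lemma gcomp_bound u : exists N : int, forall i, N < i -> gcomp i u = 0.
Proof.
have [_ [s [_ s0 _]]] := gcompP u.
have [N sN] : exists N : int, forall i, i \in s -> i <= N.
  elim: s {s0} => [|j s [N sN]]; first by exists 0.
  exists (Num.max j N) => i; rewrite inE => /orP[/eqP ->|/sN iN].
    by rewrite le_max lexx.
  by rewrite le_max iN orbT.
by exists N => i Ni; apply: s0; apply/negP => /sN; rewrite leNgt Ni.
Qed.

End Components.

Lemma gpart_alg (a : k) : gpart 0 (a%:A : B).
Proof.
rewrite -[_%:A]addr0; apply: gpart_lin; [exact: gpart_one|exact: gpart_zero].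
Qed.

Lemma gpartD n (u v : B) : gpart n u -> gpart n v -> gpart n (u + v).
Proof. by move=> un vn; rewrite -[u]scale1r; apply: gpart_lin. Qed.

Lemma gpartZ n (a : k) (u : B) : gpart n u -> gpart n (a *: u).
Proof. by move=> un; rewrite -[_ *: _]addr0; apply/gpart_lin/gpart_zero. Qed.

Definition is_grsub (M : grmod B) (P : M -> Prop) : Prop :=
  [/\ P 0,
      forall (b : B) u v, P u -> P v -> P (b *: u + v)
    & forall i u, P u -> P (gcomp i u)].

(* P / A has finite dimension over k. *)
Definition fin_codim (M : grmod B) (P A : M -> Prop) : Prop :=
  exists s : seq M, (forall u, u \in s -> P u) /\
    forall u, P u -> exists c : nat -> k,
      A (u - \sum_(i < size s) (c i)%:A *: s`_i).

(* For graded submodules A of L, the module L / A belongs to Fdim, i.e. it is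
   the union of its finite dimensional submodules P / A. *)
Definition in_Fdim (M : grmod B) (L A : M -> Prop) : Prop :=
  forall u, L u -> exists P : M -> Prop,
    [/\ is_grsub P, forall v, A v -> P v, forall v, P v -> L v,
        fin_codim P A & P u].

Section Torsion.
Context (M : grmod B).
Implicit Types (A L P : M -> Prop) (u v : M).

Definition torsion L A : Prop :=
  forall u, L u ->
    exists n, forall d b, (n <= d)%N -> gpart d b -> A (b *: u).

Section Sub.
Context (P : M -> Prop) (hP : is_grsub P).

Lemma grsub0 : P 0. Proof. by case: hP. Qed.
Lemma grsubZ b u : P u -> P (b *: u).
Proof. by case: hP => p0 pl _ pu; rewrite -[_ *: _]addr0; apply: pl. Qed.
Lemma grsubD u v : P u -> P v -> P (u + v).
Proof. by case: hP => p0 pl _ pu pv; rewrite -[u]scale1r; apply: pl. Qed.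
Lemma grsubN u : P u -> P (- u).
Proof. by move=> pu; rewrite -scaleN1r; apply: grsubZ. Qed.
Lemma grsubB u v : P u -> P v -> P (u - v).
Proof. by move=> pu pv; apply/grsubD/grsubN. Qed.
Lemma grsub_sum I (s : seq I) (Q : pred I) (F : I -> M) :
  (forall i, Q i -> P (F i)) -> P (\sum_(i <- s | Q i) F i).
Proof. by move=> h; apply: big_ind => //; [exact: grsub0|exact: grsubD]. Qed.
Lemma grsub_comp i u : P u -> P (gcomp i u). Proof. by case: hP => _ _; apply. Qed.
End Sub.

Lemma torsion_unif (I : eqType) A (s : seq I) (F : I -> M) :
  (forall i, i \in s ->
     exists n, forall d b, (n <= d)%N -> gpart d b -> A (b *: F i)) ->
  exists n, forall i, i \in s ->
    forall d b, (n <= d)%N -> gpart d b -> A (b *: F i).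
Proof.
elim: s => [|j s IH] h; first by exists 0%N.
have [n hn] := IH (fun i si => h i (mem_behead (s := j :: s) si)).
have [m hm] := h j (mem_head _ _).
exists (maxn m n) => i; rewrite inE => /orP[/eqP -> d b|si d b];
  rewrite geq_max => /andP[md nd]; [exact: hm | exact: hn].
Qed.

Lemma fin_codim_bound P A : is_grsub A -> is_grsub P -> fin_codim P A ->
  exists N : int, forall i u, N < i -> gr i u -> P u -> A u.
Proof.
move=> hA hP [s [sP sspan]].
have [N hN] : exists N : int, forall v i, v \in s -> N < i -> gcomp i v = 0.
  elim: s {sP sspan} => [|v s [N hN]]; first by exists 0.
  have [N' hN'] := gcomp_bound v.
  exists (Num.max N N') => w i; rewrite inE gt_max => /orP[/eqP ->|ws] /andP[Ni N'i].
    exact: hN'.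
  exact: hN.
exists N => i u Ni iu /sspan[c cA].
have := grsub_comp hA i cA; rewrite raddfB raddf_sum /= (gcomp_hom i iu) eqxx.
rewrite big1 ?subr0 // => j _.
by rewrite -[i]add0r (gcomp_act _ _ (gpart_alg _)) hN ?scaler0 ?mem_nth.
Qed.

Lemma in_Fdim_torsion L A : is_grsub A -> in_Fdim L A -> torsion L A.
Proof.
move=> hA hF u /hF[P [hP AP PL fP Pu]].
have [N hN] := fin_codim_bound hA hP fP.
have [t ut] := gcomp_sum u.
have [n hn] : exists n : nat, forall i, i \in t -> N < n%:Z + i.
  elim: t {ut} => [|j t [n hn]]; first by exists 0%N.
  exists (n + `|N - j|.+1)%N => i; rewrite inE => /orP[/eqP -> |/hn ti].
    rewrite -ltrBlDr PoszD -addn1 PoszD -[ltLHS]add0r; apply: ler_ltD => //.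
    by rewrite ltzD1 abszE ler_norm.
  by apply: lt_le_trans ti _; rewrite lerD2r lez_nat leq_addr.
exists n => d b nd bd; rewrite ut scaler_sumr big_seq; apply: grsub_sum => // i it.
apply: (hN (d%:Z + i)).
- by apply: lt_le_trans (hn i it) _; rewrite lerD2r lez_nat.
- exact/gr_act/gcomp_gr.
- by apply: (grsubZ hP); apply: (grsub_comp hP).
Qed.

Definition kspan (s : seq M) u : Prop :=
  exists c : nat -> k, u = \sum_(i < size s) (c i)%:A *: s`_i.

Lemma kspan0 s : kspan s 0.
Proof.
by exists (fun=> 0); rewrite big1 // => i _; rewrite scale0r scale0r.
Qed.

Lemma kspanD s u v : kspan s u -> kspan s v -> kspan s (u + v).
Proof.
move=> [c ->] [d ->]; exists (fun i => c i + d i).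
by rewrite -big_split; apply: eq_bigr => i _; rewrite !scalerDl.
Qed.

Lemma kspanZ s (a : k) u : kspan s u -> kspan s (a%:A *: u).
Proof.
move=> [c ->]; exists (fun i => a * c i).
rewrite scaler_sumr; apply: eq_bigr => i _.
by rewrite scalerA -scalerAl mul1r scalerA.
Qed.

Lemma kspan_mem s u : u \in s -> kspan s u.
Proof.
move=> us; exists (fun i => (i == index u s)%:R).
have iu : (index u s < size s)%N by rewrite index_mem.
rewrite (bigD1 (Ordinal iu)) //= eqxx !scale1r nth_index // big1 ?addr0 //.
by move=> j; rewrite -val_eqE /= => /negPf ->; rewrite !scale0r.
Qed.

Lemma torsion_in_Fdim L A : is_grsub A -> is_grsub L ->
  (forall v, A v -> L v) -> torsion L A -> in_Fdim L A.
Proof.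
move=> hA hL AL tor u Lu.
have [t ut] := gcomp_sum u.
have [N hN] : exists n, forall i, i \in t ->
    forall d b, (n <= d)%N -> gpart d b -> A (b *: gcomp i u).
  by apply: torsion_unif => i _; apply: tor; apply: grsub_comp.
have [bas basP] := choice (@gpart_fin _ B).
pose P v := exists w : int -> B, A (v - \sum_(i <- t) w i *: gcomp i u).
have compW b i j : exists b' : B, gcomp j (b *: gcomp i u) = b' *: gcomp i u.
  have [D [c [cg ->]]] := gpart_sum b.
  exists (\sum_(d < D | d%:Z + i == j) c d).
  rewrite scaler_suml raddf_sum scaler_suml [RHS]big_mkcond.
  apply: eq_bigr => d _ /=.
  by rewrite (gcomp_hom _ (gr_act (cg d) (gcomp_gr i u))) eq_sym.
have Pu : P u.
  exists (fun=> 1); rewrite (eq_bigr (fun i => gcomp i u)) -?ut ?subrr.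
    exact: grsub0.
  by move=> i _; rewrite scale1r.
have hP : is_grsub P; first split.
- exists (fun=> 0); rewrite big1 ?subr0; first exact: grsub0.
  by move=> i _; rewrite scale0r.
- move=> b v v' [w wA] [w' wA']; exists (fun i => b * w i + w' i).
  have := grsubD hA (grsubZ hA b wA) wA'.
  rewrite scalerBr addrACA -opprD scaler_sumr -big_split /=.
  by under eq_bigr do rewrite scalerA -scalerDl.
- move=> j v [w wA].
  have [w' w'E] := choice (fun i => compW (w i) i j).
  exists w'; have := grsub_comp hA j wA; rewrite raddfB raddf_sum /=.
  by under eq_bigr do rewrite w'E.
exists P; split=> //.
- move=> v Av; exists (fun=> 0); rewrite big1 ?subr0 // => i _.
  by rewrite scale0r.
- move=> v [w wA]; rewrite -[v](subrK (\sum_(i <- t) w i *: gcomp i u)).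
  apply: (grsubD hL (AL _ wA)); apply: (grsub_sum hL) => i _.
  exact/(grsubZ hL)/(grsub_comp hL).
pose S := flatten [seq flatten [seq [seq b *: gcomp i u | b <- bas d]
                                   | d <- iota 0 N] | i <- t].
have memS i d b : i \in t -> (d < N)%N -> b \in bas d -> b *: gcomp i u \in S.
  move=> it dN bd; apply/flatten_mapP; exists i => //.
  by apply/flatten_mapP; exists d; rewrite ?mem_iota //; apply: map_f.
have spanS b i : i \in t -> exists2 z, kspan S z & A (b *: gcomp i u - z).
  move=> it; have [D [c [cg ->]]] := gpart_sum b; rewrite scaler_suml.
  elim/big_ind: _ => [|v v' [z Sz Az] [z' Sz' Az']|d _].
  - by exists 0; [exact: kspan0 | rewrite subr0; exact: grsub0].
  - exists (z + z'); first exact: kspanD.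
    by rewrite opprD addrACA; apply: grsubD.
  - have [Nd|dN] := leqP N d.
      exists 0; first exact: kspan0.
      by rewrite subr0; apply: hN (cg d).
    exists (c d *: gcomp i u); last by rewrite subrr; apply: grsub0.
    have [_ /(_ _ (cg d))[e ->]] := basP d; rewrite scaler_suml.
    elim/big_ind: _ => [||j _]; [exact: kspan0 | exact: kspanD |].
    rewrite (_ : e j *: _ = (e j)%:A * (bas d)`_j) -?scalerA; last first.
      by rewrite -scalerAl mul1r.
    by apply/kspanZ/kspan_mem; apply: (memS i d) => //; apply: mem_nth.
exists S; split=> [v|v [w wA]].
  move=> /flatten_mapP[i _ /flatten_mapP[d _ /mapP[b _ ->]]].
  exact/(grsubZ hP)/(grsub_comp hP).
have [z [c ->] Az] : exists2 z, kspan S z &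
    A (\sum_(i <- t) w i *: gcomp i u - z).
  rewrite big_seq; elim/big_ind: _ => [|x x' [z Sz Az] [z' Sz' Az']|i it].
  - by exists 0; [exact: kspan0 | rewrite subr0; exact: grsub0].
  - exists (z + z'); first exact: kspanD.
    by rewrite opprD addrACA; apply: grsubD.
  - exact: spanS.
by exists c; have := grsubD hA wA Az; rewrite addrA subrK.
Qed.

Lemma torsion_trans L A' A : is_grsub A -> torsion L A' -> torsion A' A ->
  torsion L A.
Proof.
move=> hA tL tA u /tL[n hn].
have [s [sn sspan]] := @gpart_fin _ B n.
have [N hN] : exists m, forall b, b \in s ->
    forall d b', (m <= d)%N -> gpart d b' -> A (b' *: (b *: u)).
  apply: (torsion_unif (F := fun b => b *: u)) => b bs.
  exact/tA/(hn n)/sn.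
exists (N + n)%N => d b Nnd bd.
have nd : (n <= d)%N by apply: leq_trans Nnd; rewrite leq_addl.
move: bd; rewrite -(subnK nd) => /gpart_gen[t [tP ->]].
rewrite scaler_suml big_seq; apply: (grsub_sum hA) => p /tP[p1 p2].
have [c ->] := sspan _ p2.
rewrite mulr_sumr scaler_suml; apply: (grsub_sum hA) => i _.
rewrite -scalerAr scalerAl -scalerA; apply: (hN _ _ (d - n)%N).
- exact: mem_nth.
- by rewrite leq_subRL // addnC.
- exact: gpartZ.
Qed.

Definition tors_elt u : Prop :=
  exists n, forall d b, (n <= d)%N -> gpart d b -> b *: u = 0.

Lemma grsub_zero : is_grsub (fun u : M => u = 0).
Proof.
split=> // [b u v -> ->|i u ->]; first by rewrite scaler0 addr0.
exact: raddf0.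
Qed.

Lemma tors_elt_sub : is_grsub tors_elt.
Proof.
split.
- by exists 0%N => d b _ _; rewrite scaler0.
- move=> b u v [n hn] [m hm].
  have [D [c [cg ->]]] := gpart_sum b.
  exists (maxn n m) => d b'; rewrite geq_max => /andP[nd md] b'd.
  rewrite scalerDr (hm d) // addr0 scaler_suml scaler_sumr big1 // => i _.
  rewrite scalerA; apply: (hn (d + i)%N); last exact: gpart_mul.
  exact: leq_trans (leq_addr _ _).
- move=> i u [n hn]; exists n => d b nd bd.
  by rewrite -(gcomp_act _ _ bd) (hn d) ?raddf0.
Qed.

Lemma tors_eltE : torsion tors_elt (fun u => u = 0).
Proof. by []. Qed.

Lemma tors_elt_ext u n :
  (forall d b, (n <= d)%N -> gpart d b -> tors_elt (b *: u)) -> tors_elt u.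
Proof.
move=> h; have := @torsion_trans (fun v => v = u) tors_elt _ grsub_zero.
by apply=> //; move=> v ->; exists n.
Qed.

Lemma grsub_setT : is_grsub (fun _ : M => True).
Proof. by split. Qed.

Lemma grsubI P L : is_grsub P -> is_grsub L -> is_grsub (fun u => P u /\ L u).
Proof.
move=> [p0 pl pc] [l0 ll lc]; split=> // [b u v [pu lu] [pv lv]|i u [pu lu]].
  by split; [exact: pl | exact: ll].
by split; [exact: pc | exact: lc].
Qed.

End Torsion.

(* A morphism M -> N of the quotient category is represented by a degree
   preserving homomorphism f : M' -> N / N', where M' is a graded submodule of
   M with M / M' in Fdim and N' is a graded submodule of N in Fdim.  Such an f
   is encoded by the graded submodule {(u, v) | u \in M', v \in f u} of
   M (+) N, from which M' is recovered as the domain and N' as the set of v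
   related to 0. *)
Record qhom (M N : grmod B) := QHom {
  qrel : M -> N -> Prop;
  qrel0 : qrel 0 0;
  qrel_lin : forall (b : B) u u' v v',
    qrel u v -> qrel u' v' -> qrel (b *: u + u') (b *: v + v');
  qrel_comp : forall i u v, qrel u v -> qrel (gcomp i u) (gcomp i v);
  qrel_dom : in_Fdim (fun _ => True) (fun u => exists v, qrel u v);
  qrel_ind : in_Fdim (qrel 0) (fun v => v = 0) }.

Definition qdom (M N : grmod B) (f : qhom M N) (u : M) : Prop :=
  exists v, qrel f u v.
Definition qind (M N : grmod B) (f : qhom M N) (v : N) : Prop := qrel f 0 v.

(* Equality in colim Hom(M', N / N'): f and g agree as maps M' -> N / N' for
   some M' contained in both domains and some N' containing both qind's. *)
Definition qeq (M N : grmod B) (f g : qhom M N) : Prop :=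
  exists (M' : M -> Prop) (N' : N -> Prop),
    [/\ is_grsub M', is_grsub N', in_Fdim (fun _ => True) M',
        in_Fdim N' (fun v => v = 0)
      & [/\ forall u, M' u -> qdom f u /\ qdom g u,
            forall v, qind f v \/ qind g v -> N' v
          & forall u v v', M' u -> qrel f u v -> qrel g u v' -> N' (v - v')]].

Section QHomTheory.

Lemma qrelB (M N : grmod B) (f : qhom M N) u u' v v' :
  qrel f u v -> qrel f u' v' -> qrel f (u - u') (v - v').
Proof.
move=> uv uv'; rewrite addrC -scaleN1r [v - v']addrC -[- v']scaleN1r.
exact: qrel_lin.
Qed.

Lemma qrelZ (M N : grmod B) (f : qhom M N) b u v :
  qrel f u v -> qrel f (b *: u) (b *: v).
Proof.
move=> uv; rewrite -[b *: u]addr0 -[b *: v]addr0.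
exact/qrel_lin/qrel0.
Qed.

Lemma qdom_sub (M N : grmod B) (f : qhom M N) : is_grsub (qdom f).
Proof.
split; first by exists 0; apply: qrel0.
- by move=> b u u' [v uv] [v' uv']; exists (b *: v + v'); apply: qrel_lin.
- by move=> i u [v uv]; exists (gcomp i v); apply: qrel_comp.
Qed.

Lemma qind_sub (M N : grmod B) (f : qhom M N) : is_grsub (qind f).
Proof.
split; first exact: qrel0.
- move=> b v v' h h'; have := qrel_lin b h h'.
  by rewrite scaler0 addr0.
- by move=> i v /(qrel_comp i); rewrite raddf0.
Qed.

Lemma qdom_torsion (M N : grmod B) (f : qhom M N) :
  torsion (fun _ => True) (qdom f).
Proof. by apply: in_Fdim_torsion; [exact: qdom_sub | exact: qrel_dom]. Qed.

Lemma qind_tors (M N : grmod B) (f : qhom M N) v : qind f v -> tors_elt v.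
Proof.
exact: (in_Fdim_torsion (@grsub_zero N) (@qrel_ind _ _ f)).
Qed.

Lemma qeqP (M N : grmod B) (f g : qhom M N) :
  qeq f g <->
  forall u v v', qrel f u v -> qrel g u v' -> tors_elt (v - v').
Proof.
split=> [[M' [N' [sM' sN' FM' FN' [hM' hN' h]]]] u v v' uv uv'|h].
  have [n hn] := in_Fdim_torsion sM' FM' (u := u) I.
  apply: (@tors_elt_ext _ _ n) => d b nd bd.
  apply: (in_Fdim_torsion (@grsub_zero N) FN').
  rewrite scalerBr; apply: (h (b *: u)); [exact: hn bd | exact: qrelZ..].
exists (fun u => qdom f u /\ qdom g u), (@tors_elt N).
have sI := grsubI (qdom_sub f) (qdom_sub g).
split=> //.
- exact: tors_elt_sub.
- apply: torsion_in_Fdim => //.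
  apply: (torsion_trans (A' := qdom f)) => //; first exact: qdom_torsion.
  move=> u fu; have [n hn] := @qdom_torsion _ _ g u I.
  exists n => d b nd bd; split; last exact: hn bd.
  exact/(grsubZ (qdom_sub f)).
- apply: torsion_in_Fdim => //; [exact: grsub_zero|exact: tors_elt_sub|].
  by move=> v ->; apply: (grsub0 (@tors_elt_sub N)).
- split=> [u //|v [] /qind_tors //|u v v' _].
  exact: h.
Qed.

Lemma qeq_refl (M N : grmod B) (f : qhom M N) : qeq f f.
Proof.
apply/qeqP => u v v' uv uv'; apply: (@qind_tors _ _ f).
by rewrite /qind -(subrr u); apply: qrelB.
Qed.

Lemma qeq_sym (M N : grmod B) (f g : qhom M N) : qeq f g -> qeq g f.
Proof.
move=> /qeqP h; apply/qeqP => u v v' uv uv'.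
by rewrite -opprB; apply: (grsubN (@tors_elt_sub N)); apply: h uv' uv.
Qed.

Lemma qeq_trans (M N : grmod B) (f g h : qhom M N) :
  qeq f g -> qeq g h -> qeq f h.
Proof.
move=> /qeqP fg /qeqP gh; apply/qeqP => u v v' uv uv'.
have [n hn] := @qdom_torsion _ _ g u I.
apply: (@tors_elt_ext _ _ n) => d b nd bd; have [w uw] := hn d b nd bd.
rewrite scalerBr -[b *: v](subrK w) -addrA.
apply: (grsubD (@tors_elt_sub N)).
- exact: fg (qrelZ b uv) uw.
- exact: gh uw (qrelZ b uv').
Qed.

Section Identity.
Context (M : grmod B).

Lemma qid_comp i (u v : M) : u = v -> gcomp i u = gcomp i v.
Proof. by move=> ->. Qed.

Lemma qid_lin (b : B) (u u' v v' : M) :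
  u = v -> u' = v' -> b *: u + u' = b *: v + v'.
Proof. by move=> -> ->. Qed.

Lemma qid_dom : in_Fdim (fun _ : M => True) (fun u => exists v, u = v).
Proof.
apply: torsion_in_Fdim => //; first by split=> *; eexists.
by move=> u _; exists 0%N => d b _ _; exists (b *: u).
Qed.

Lemma qid_ind : in_Fdim (fun v : M => 0 = v) (fun v => v = 0).
Proof.
apply: torsion_in_Fdim => //; first exact: grsub_zero.
  split=> // [b u v <- <-|i u <-]; first by rewrite scaler0 addr0.
  by rewrite raddf0.
by move=> u <-; exists 0%N => d b _ _; rewrite scaler0.
Qed.

Definition qid : qhom M M :=
  @QHom M M (fun u v => u = v) erefl qid_lin qid_comp qid_dom qid_ind.
End Identity.

Section Composition.
Context (M N P : grmod B) (g : qhom N P) (f : qhom M N).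

(* For f : M' -> N / N' and g : N'' -> P / P', this is the map from
   f^-1((N' + N'') / N') to P / (P' + g(N' /\ N'')) induced by f and g. *)
Definition qcomp_rel (u : M) (w : P) : Prop :=
  exists2 v, qrel f u v & qrel g v w.

Lemma qcomp0 : qcomp_rel 0 0.
Proof. by exists 0; apply: qrel0. Qed.

Lemma qcomp_lin (b : B) u u' w w' :
  qcomp_rel u w -> qcomp_rel u' w' -> qcomp_rel (b *: u + u') (b *: w + w').
Proof.
by move=> [v uv vw] [v' uv' vw']; exists (b *: v + v'); apply: qrel_lin.
Qed.

Lemma qcomp_comp i u w : qcomp_rel u w -> qcomp_rel (gcomp i u) (gcomp i w).
Proof. by move=> [v uv vw]; exists (gcomp i v); apply: qrel_comp. Qed.

Lemma qcomp_dom : in_Fdim (fun _ => True) (fun u => exists w, qcomp_rel u w).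
Proof.
have s : is_grsub (fun u => exists w, qcomp_rel u w).
  split; first by exists 0; apply: qcomp0.
  - by move=> b u u' [w h] [w' h']; exists (b *: w + w'); apply: qcomp_lin.
  - by move=> i u [w h]; exists (gcomp i w); apply: qcomp_comp.
apply: torsion_in_Fdim => //; apply: (torsion_trans s (@qdom_torsion _ _ f)).
move=> u [v uv]; have [n hn] := @qdom_torsion _ _ g v I.
exists n => d b nd bd; have [w vw] := hn d b nd bd.
by exists w, (b *: v) => //; apply: qrelZ.
Qed.

Lemma qcomp_ind : in_Fdim (qcomp_rel 0) (fun w => w = 0).
Proof.
apply: torsion_in_Fdim; first exact: grsub_zero.
- split; first exact: qcomp0.
  + by move=> b w w' h h'; have := qcomp_lin b h h'; rewrite scaler0 addr0.
  + by move=> i w /(qcomp_comp i); rewrite raddf0.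
- by move=> w ->; apply: qcomp0.
apply: (@torsion_trans _ _ (qind g)); first exact: grsub_zero.
  move=> w [v /qind_tors[n hn] vw]; exists n => d b nd bd.
  by rewrite /qind -(hn d b nd bd); apply: qrelZ.
by move=> w /qind_tors.
Qed.

Definition qcomp : qhom M P :=
  QHom qcomp0 qcomp_lin qcomp_comp qcomp_dom qcomp_ind.
End Composition.

Lemma qcomp_congr (M N P : grmod B) (g g' : qhom N P) (f f' : qhom M N) :
  qeq g g' -> qeq f f' -> qeq (qcomp g f) (qcomp g' f').
Proof.
move=> /qeqP gg /qeqP ff; apply/qeqP => u w w' [v uv vw] [v' uv' vw'].
have [n hn] := ff _ _ _ uv uv'.
apply: (@tors_elt_ext _ _ n) => d b nd bd; rewrite scalerBr.
apply: (gg (b *: v)); first exact: qrelZ.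
have /eqP := hn d b nd bd; rewrite scalerBr subr_eq0 => /eqP ->.
exact: qrelZ.
Qed.

Lemma qrel_qeq (M N : grmod B) (f g : qhom M N) :
  (forall u v, qrel f u v <-> qrel g u v) -> qeq f g.
Proof.
move=> fg; apply/qeqP => u v v' /fg uv uv'; apply: (@qind_tors _ _ g).
by rewrite /qind -(subrr u); apply: qrelB.
Qed.

Lemma qcomp1l (M N : grmod B) (f : qhom M N) : qeq (qcomp (qid N) f) f.
Proof.
by apply: qrel_qeq => u v; split=> [[w uw <-]|uv] //; exists v.
Qed.

Lemma qcomp1r (M N : grmod B) (f : qhom M N) : qeq (qcomp f (qid M)) f.
Proof.
by apply: qrel_qeq => u v; split=> [[w <-]|uv] //; exists u.
Qed.

Lemma qcompA (M N P Q : grmod B) (h : qhom P Q) (g : qhom N P) (f : qhom M N) :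
  qeq (qcomp h (qcomp g f)) (qcomp (qcomp h g) f).
Proof.
apply: qrel_qeq => u v; split=> [[x [w uw wx] xv]|[w uw [x wx xv]]].
  by exists w => //; exists x.
by exists x => //; exists w.
Qed.

End QHomTheory.

End GradedModule.

(* Equality of morphisms is the relation [heq], so that QGr needs no quotient
   types: its morphisms are representatives compared by [qeq]. *)
Record category := Category {
  obj :> Type;
  hom : obj -> obj -> Type;
  heq : forall X Y, hom X Y -> hom X Y -> Prop;
  idm : forall X, hom X X;
  cmp : forall X Y Z, hom Y Z -> hom X Y -> hom X Z;
  heq_refl : forall X Y (f : hom X Y), heq f f;
  heq_sym : forall X Y (f g : hom X Y), heq f g -> heq g f;
  heq_trans : forall X Y (f g h : hom X Y), heq f g -> heq g h -> heq f h;
  cmp_congr : forall X Y Z (g g' : hom Y Z) (f f' : hom X Y),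
    heq g g' -> heq f f' -> heq (cmp g f) (cmp g' f');
  cmp1l : forall X Y (f : hom X Y), heq (cmp (idm Y) f) f;
  cmp1r : forall X Y (f : hom X Y), heq (cmp f (idm X)) f;
  cmpA : forall X Y Z T (h : hom Z T) (g : hom Y Z) (f : hom X Y),
    heq (cmp h (cmp g f)) (cmp (cmp h g) f) }.

Arguments hom {c}.
Arguments heq {c X Y}.
Arguments idm {c}.
Arguments cmp {c X Y Z}.

Definition isomorphic (C : category) (X Y : C) : Prop :=
  exists (f : hom X Y) (g : hom Y X),
    heq (cmp g f) (idm X) /\ heq (cmp f g) (idm Y).

Record functor (C D : category) := Functor {
  fobj :> C -> D;
  fmap : forall X Y, hom X Y -> hom (fobj X) (fobj Y);
  fmap_congr : forall X Y (f g : hom X Y), heq f g -> heq (fmap f) (fmap g);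
  fmap_id : forall X, heq (fmap (idm X)) (idm (fobj X));
  fmap_cmp : forall X Y Z (g : hom Y Z) (f : hom X Y),
    heq (fmap (cmp g f)) (cmp (fmap g) (fmap f)) }.

Arguments fmap {C D} _ {X Y}.

Definition idF (C : category) : functor C C :=
  @Functor C C (fun X => X) (fun X Y f => f) (fun X Y f g fg => fg)
    (fun X => heq_refl (idm X)) (fun X Y Z g f => heq_refl (cmp g f)).

Definition compF (C D E : category) (G : functor D E) (F : functor C D) :
    functor C E :=
  @Functor C E (fun X => G (F X)) (fun X Y f => fmap G (fmap F f))
    (fun X Y f g fg => fmap_congr G (fmap_congr F fg))
    (fun X => heq_trans (fmap_congr G (fmap_id F X)) (fmap_id G (F X)))
    (fun X Y Z g f => heq_trans (fmap_congr G (fmap_cmp F g f))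
                        (fmap_cmp G (fmap F g) (fmap F f))).

Definition nat_iso (C D : category) (F G : functor C D) : Prop :=
  exists (eta : forall X, hom (F X) (G X)) (eps : forall X, hom (G X) (F X)),
    [/\ forall X Y (f : hom X Y),
          heq (cmp (eta Y) (fmap F f)) (cmp (fmap G f) (eta X)),
        forall X, heq (cmp (eps X) (eta X)) (idm (F X))
      & forall X, heq (cmp (eta X) (eps X)) (idm (G X))].

Definition is_equivalence (C D : category) (F : functor C D) : Prop :=
  exists G : functor D C,
    nat_iso (compF G F) (idF C) /\ nat_iso (compF F G) (idF D).

Section Gr.
Context (k : fieldType) (B : gralg k).

Record ghom (M N : grmod B) := GHom {
  gfun :> {linear M -> N};
  gfun_gr : forall i u, gr i u -> gr i (gfun u) }.

Definition gid (M : grmod B) : ghom M M := @GHom M M idfun (fun i u iu => iu).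

Lemma gcmp_gr (M N P : grmod B) (g : ghom N P) (f : ghom M N) i u :
  gr i u -> gr i ((g \o f) u).
Proof. by move=> iu; do 2!apply: gfun_gr. Qed.

Definition gcmp (M N P : grmod B) (g : ghom N P) (f : ghom M N) : ghom M P :=
  GHom (gcmp_gr g f).

Definition Gr : category :=
  @Category (grmod B) ghom (fun M N f g => f =1 g) gid gcmp
    (fun M N f u => erefl) (fun M N f g fg u => esym (fg u))
    (fun M N f g h fg gh u => etrans (fg u) (gh u))
    (fun M N P g g' f f' gg ff u => etrans (gg (f u)) (congr1 g' (ff u)))
    (fun M N f u => erefl) (fun M N f u => erefl)
    (fun M N P Q h g f u => erefl).

Definition QGr : category :=
  Category (@qeq_refl k B) (@qeq_sym k B) (@qeq_trans k B) (@qcomp_congr k B)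
    (@qcomp1l k B) (@qcomp1r k B) (@qcompA k B).

Section Graph.
Context (M N : grmod B) (f : ghom M N).

Lemma graph_lin (b : B) u u' v v' :
  f u = v -> f u' = v' -> f (b *: u + u') = b *: v + v'.
Proof. by move=> <- <-; rewrite linearP. Qed.

Lemma graph_comp i u v : f u = v -> f (gcomp i u) = gcomp i v.
Proof.
move=> <-; apply/esym; apply: (gcompE (c := fun i => f (gcomp i u))).
have [ug [s [us us0 eu]]] := gcompP u.
split=> [j|]; first exact: gfun_gr.
exists s; split=> // [j /us0 ->|]; first exact: raddf0.
by rewrite {1}eu raddf_sum.
Qed.

Lemma graph_dom : in_Fdim (fun _ : M => True) (fun u => exists v, f u = v).
Proof.
apply: torsion_in_Fdim => //; first by split=> *; eexists.
by move=> u _; exists 0%N => d b _ _; eexists.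
Qed.

Lemma graph_ind : in_Fdim (fun v : N => f 0 = v) (fun v => v = 0).
Proof.
apply: torsion_in_Fdim; first exact: grsub_zero.
- split=> [|b u v <- <-|i u <-]; first exact: raddf0.
    by rewrite raddf0 scaler0 addr0.
  by rewrite !raddf0.
- by move=> v ->; apply: raddf0.
by move=> v <-; exists 0%N => d b _ _; rewrite raddf0 scaler0.
Qed.

Definition graph : qhom M N :=
  @QHom _ _ M N (fun u v => f u = v) (raddf0 f) graph_lin graph_comp
    graph_dom graph_ind.
End Graph.

Lemma graph_congr (M N : grmod B) (f g : ghom M N) :
  f =1 g -> qeq (graph f) (graph g).
Proof. by move=> fg; apply: qrel_qeq => u v /=; rewrite fg. Qed.

Lemma graph_id (M : grmod B) : qeq (graph (gid M)) (qid M).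
Proof. exact: qrel_qeq. Qed.

Lemma graph_cmp (M N P : grmod B) (g : ghom N P) (f : ghom M N) :
  qeq (graph (gcmp g f)) (qcomp (graph g) (graph f)).
Proof.
apply: qrel_qeq => u w; split=> [<-|[v <- <-]] //.
by exists (f u).
Qed.

Definition quotF : functor Gr QGr :=
  @Functor Gr QGr (fun M => M) graph graph_congr graph_id graph_cmp.

End Gr.

(* Right S-modules are left modules over the opposite ring. *)
Definition ModR (S : nzRingType) : category :=
  @Category (lmodType S^c) (fun M N => {linear M -> N})
    (fun M N f g => f =1 g) (fun M => idfun) (fun M N P g f => g \o f)
    (fun M N f u => erefl) (fun M N f g fg u => esym (fg u))
    (fun M N f g h fg gh u => etrans (fg u) (gh u))
    (fun M N P g g' f f' gg ff u => etrans (gg (f u)) (congr1 g' (ff u)))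
    (fun M N f u => erefl) (fun M N f u => erefl)
    (fun M N P Q h g f u => erefl).

Definition regular_right (S : nzRingType) : ModR S := (S^c)^o.

Lemma malg_scalerAr (R : comNzRingType) (K : monomType) (a : R)
    (u v : {malg R[K]}) : a *: (u * v) = u * (a *: v).
Proof.
apply/malgP => m; rewrite mcoeffZ [X in _ * X]mcoeffMl.
rewrite [RHS](mcoeffMlw m (fsubset_refl (msupp u)) (msuppZ_le a v)).
rewrite mulr_sumr; apply: eq_bigr => i _; rewrite mulr_sumr.
by apply: eq_bigr => j _; rewrite mcoeffZ mulrnAr mulrCA.
Qed.

(* The free algebra, with letters x = false and y = true. *)
Definition free2 (k : fieldType) : Type := {malg k[{fmonom bool}]}.
HB.instance Definition _ (k : fieldType) := GRing.Lalgebra.on (free2 k).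
HB.instance Definition _ (k : fieldType) :=
  GRing.Lalgebra_isAlgebra.Build k (free2 k) (@malg_scalerAr k _).

Lemma malgZU (R : nzRingType) (K : choiceType) (c : R) (w : K) :
  << c *g w >> = c *: << w >>.
Proof. by apply/malgP => v; rewrite mcoeffZ !mcoeffU mulr_natr. Qed.

Lemma mulr_sum3 (R : nzRingType) (I J : Type) (s : seq I) (t : seq J)
    (U : I -> R) (y : R) (V : J -> R) :
  (\sum_(i <- s) U i) * y * (\sum_(j <- t) V j) =
  \sum_(i <- s) \sum_(j <- t) U i * y * V j.
Proof.
by rewrite !mulr_suml; apply: eq_bigr => i _; rewrite mulr_sumr.
Qed.

Section QuotientOfFree.
Context (k : fieldType) (r : nat).

Definition free_y : free2 k := << fmu true >>.

Lemma relation_proper : 1 \notin tsideal (free_y ^+ r.+1).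
Proof.
pose ev : {rmorphism free2 k -> k} := @mcoeff {fmonom bool} k mone.
apply: (tsideal_proper (e := ev)); rewrite rmorphXn.
by rewrite (_ : ev free_y = 0) ?expr0n //= /free_y mcoeffU1 fm1_eq1.
Qed.

Definition Balg : algType k := quotalg relation_proper.

Definition Bpi : {lrmorphism free2 k -> Balg} := @qpi _ _ _ relation_proper.

(* deg x = deg y = 1: the words of length n span degree n. *)
Definition free_part (n : nat) (f : free2 k) : Prop :=
  forall w : {fmonom bool}, w \in msupp f -> fdeg w = n.

Definition Bpart (n : nat) (u : Balg) : Prop :=
  exists2 f : free2 k, free_part n f & u = Bpi f.

Lemma free_part0 n : free_part n 0.
Proof. by move=> w; rewrite msupp0 inE. Qed.

Lemma free_part_lin n (a : k) f g :
  free_part n f -> free_part n g -> free_part n (a *: f + g).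
Proof.
move=> fn gn w /(fsubsetP (msuppD_le _ _)); rewrite inE => /orP[|/gn //].
by move=> /(fsubsetP (msuppZ_le _ _)) /fn.
Qed.

Lemma free_partU n (c : k) (w : {fmonom bool}) :
  fdeg w = n -> free_part n << c *g w >>.
Proof. by move=> wn v /(fsubsetP msuppU_le); rewrite inE => /eqP ->. Qed.

Lemma free_partM m n f g :
  free_part m f -> free_part n g -> free_part (m + n) (f * g).
Proof. by move=> fm gn w /msuppM_le[u [v [/fm <- /gn <- ->]]]; rewrite fdegM. Qed.

Lemma free_part_y j : free_part j (free_y ^+ j).
Proof.
elim: j => [|j IH]; first by rewrite expr0; apply: free_partU; rewrite fdeg1.
by rewrite exprS -add1n; apply: free_partM => //; apply: free_partU; rewrite fdegU.
Qed.

Definition hcomp n (f : free2 k) : free2 k :=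
  \sum_(w <- msupp f | fdeg w == n) << f@_w *g w >>.

Lemma hcompE n f w : (hcomp n f)@_w = if fdeg w == n then f@_w else 0.
Proof.
rewrite /hcomp raddf_sum /=.
under eq_bigr => v _ do rewrite mcoeffU.
have [wf|wf] := boolP (w \in msupp f); last first.
  rewrite mcoeff_outdom // if_same big1_seq // => v /andP[_ vf].
  by case: eqP vf wf => [-> ->|].
case: ifP => wn; last first.
  by rewrite big1 // => v vn; case: eqP => // vw; rewrite -vw vn in wn.
rewrite big_mkcond (bigD1_seq w) ?fset_uniq //= wn eqxx mulr1n big1 ?addr0 //.
by move=> v /negPf ->; rewrite mulr0n if_same.
Qed.

Lemma hcomp_is_zmod_morphism n : zmod_morphism (hcomp n).
Proof.
move=> f g; apply/malgP => w; apply: (etrans _ (esym (mcoeffB w _ _))).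
apply: (etrans (hcompE n (f - g) w)).
apply: (etrans _ (esym (congr2 (fun x y => x - y) (hcompE n f w) (hcompE n g w)))).
case: eqP => _; last by rewrite subr0.
exact: mcoeffB.
Qed.

HB.instance Definition _ n := GRing.isZmodMorphism.Build (free2 k) (free2 k)
  (hcomp n) (hcomp_is_zmod_morphism n).

Lemma hcomp_part n f : free_part n (hcomp n f).
Proof.
by move=> w; rewrite -mcoeff_neq0 hcompE; case: (fdeg w =P n); rewrite // eqxx.
Qed.

Lemma hcomp_hom n m f : free_part m f -> hcomp n f = if n == m then f else 0.
Proof.
move=> fm; apply/malgP => w; rewrite hcompE.
have [wf|wf] := boolP (w \in msupp f).
  by rewrite (fm _ wf) eq_sym; case: eqP; rewrite // mcoeff0.
by rewrite [f@_w]mcoeff_outdom // if_same; case: ifP; rewrite ?mcoeff0 ?mcoeff_outdom.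
Qed.

Lemma hcomp_sum f : exists N, f = \sum_(n < N) hcomp n f.
Proof.
exists (\max_(w <- msupp f) fdeg w).+1; apply/malgP => w; rewrite raddf_sum /=.
under eq_bigr do rewrite hcompE.
have [wf|wf] := boolP (w \in msupp f); last first.
  by rewrite mcoeff_outdom // big1 // => n _; rewrite if_same.
have wN : (fdeg w < (\max_(w <- msupp f) fdeg w).+1)%N.
  by rewrite ltnS (big_rem w) //= leq_maxl.
rewrite (bigD1 (Ordinal wN)) //= eqxx big1 ?addr0 // => n.
by rewrite -val_eqE /= eq_sym => /negPf ->.
Qed.

Local Notation I := (tsideal (free_y ^+ r.+1)).

Lemma hcomp_ideal n f : f \in I -> hcomp n f \in I.
Proof.
have memI a b : a * free_y ^+ r.+1 * b \in I.
  by apply/asboolP; exists [:: (a, b)]; rewrite big_seq1.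
move=> /asboolP[s ->]; rewrite raddf_sum; apply: rpred_sum => p _ /=.
move: (@free_part_y r.+1) memI; move: (free_y ^+ _) => y yr yI.
pose U w := << p.1@_w *g w >> : free2 k; pose V w := << p.2@_w *g w >> : free2 k.
have -> : p.1 * y * p.2 =
    \sum_(v <- msupp p.1) \sum_(w <- msupp p.2) U v * y * V w.
  have e1 : p.1 = \sum_(w <- msupp p.1) U w := monalgE p.1.
  have e2 : p.2 = \sum_(w <- msupp p.2) V w := monalgE p.2.
  by apply: (etrans _ (mulr_sum3 (msupp p.1) (msupp p.2) U y V)); rewrite -e1 -e2.
rewrite raddf_sum; apply: rpred_sum => v _.
rewrite raddf_sum; apply: rpred_sum => w _ /=.
have tP : free_part (fdeg v + r.+1 + fdeg w) (U v * y * V w).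
  by do 2?apply: free_partM => //; apply: free_partU.
rewrite (hcomp_hom n tP).
by case: ifP => // _; apply: rpred0.
Qed.

Lemma Bpi_eq0 f : (Bpi f == 0) = (f \in I).
Proof. exact: qpi_eq0. Qed.

Lemma Bpi_surj u : exists f, u = Bpi f.
Proof. by exists (qrepr u); rewrite /Bpi /= qreprK. Qed.

Lemma Bpart0 n : Bpart n 0.
Proof. by exists 0; rewrite ?raddf0 //; apply: free_part0. Qed.

Lemma Bpart_lin n (a : k) u v : Bpart n u -> Bpart n v -> Bpart n (a *: u + v).
Proof.
move=> [f fn ->] [g gn ->]; exists (a *: f + g); first exact: free_part_lin.
by rewrite linearP.
Qed.

Lemma Bpart1 : Bpart 0 1.
Proof.
by exists 1; rewrite ?rmorph1 //; apply: (@free_part_y 0).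
Qed.

Lemma Bpart_mul m n u v : Bpart m u -> Bpart n v -> Bpart (m + n) (u * v).
Proof.
move=> [f fm ->] [g gn ->]; exists (f * g); first exact: free_partM.
by rewrite rmorphM.
Qed.

Lemma Bpart_sum u : exists N (c : nat -> Balg),
  (forall i, Bpart i (c i)) /\ u = \sum_(i < N) c i.
Proof.
have [f ->] := Bpi_surj u; have [N fN] := hcomp_sum f.
exists N, (fun i => Bpi (hcomp i f)); split=> [i|].
  by exists (hcomp i f) => //; apply: hcomp_part.
by rewrite {1}fN raddf_sum.
Qed.

Lemma Bpart_direct N (c : nat -> Balg) : (forall i, Bpart i (c i)) ->
  \sum_(i < N) c i = 0 -> forall i, (i < N)%N -> c i = 0.
Proof.
move=> cB s0 i iN.
have /choice[f fP] j : exists f, free_part j f /\ c j = Bpi f.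
  by have [f fj ->] := cB j; exists f.
have [fi ->] := fP i.
have /(hcomp_ideal i) : \sum_(j < N) f j \in I.
  rewrite -Bpi_eq0 raddf_sum -[X in _ == X]s0; apply/eqP.
  by apply: eq_bigr => j _; have [_ ->] := fP j.
rewrite raddf_sum (bigD1 (Ordinal iN)) //= (hcomp_hom _ fi) eqxx.
rewrite big1 ?addr0 => [|j]; first by rewrite -Bpi_eq0 => /eqP.
by have [fj _] := fP j; rewrite (hcomp_hom _ fj) -val_eqE /= eq_sym => /negPf ->.
Qed.

Lemma Bpart_fin n : exists s : seq Balg, (forall u, u \in s -> Bpart n u) /\
  forall u, Bpart n u -> exists c : nat -> k, u = \sum_(i < size s) c i *: s`_i.
Proof.
pose D := [fset FMonom (val t) | t in [set: n.-tuple bool]]%fset.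
exists [seq Bpi << w >> | w <- D]; split=> [u /mapP[w /imfsetP[t _ ->] ->]|u].
  by exists << FMonom (val t) >> => //; apply/free_partU/size_tuple.
move=> [f fn ->]; exists (fun i => f@_(nth mone D i)).
have /monalgEw {1}-> : (msupp f `<=` D)%fset.
  apply/fsubsetP => w /fn wn; apply/imfsetP.
  have wn' : size w == n by apply/eqP.
  by exists (Tuple wn'); rewrite ?inE //= fmK.
rewrite raddf_sum (big_nth mone) big_mkord size_map; apply: eq_bigr => i _.
rewrite (nth_map mone) //; move: (nth mone D i) => w.
by rewrite malgZU; apply: (linearZ_LR Bpi).
Qed.

Lemma Bpart_gen m n u : Bpart (m + n) u ->
  exists s : seq (Balg * Balg),
    (forall p, p \in s -> Bpart m p.1 /\ Bpart n p.2) /\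
    u = \sum_(p <- s) p.1 * p.2.
Proof.
move=> [f fmn ->].
exists [seq (Bpi << f@_w *g FMonom (take m w) >>, Bpi << FMonom (drop m w) >>)
       | w : {fmonom bool} <- msupp f]; split=> [p /mapP[w /fmn wmn ->] /=|].
  split; [exists << f@_w *g FMonom (take m w) >> | exists << FMonom (drop m w) >>];
    rewrite //; apply: free_partU; rewrite fdegE /= ?size_drop -?fdegE.
    by rewrite size_takel // -fdegE wmn leq_addr.
  by rewrite wmn addKn.
rewrite big_map {1}[f]monalgE raddf_sum; apply: eq_bigr => w _ /=.
rewrite -rmorphM /= malgM_def fgmulUU mulr1.
congr (Bpi << _ *g _ >>); apply/eqP.
by rewrite fmP fmM /= cat_take_drop.
Qed.

Definition Btrunc : gralg k := GrAlg Bpart0 Bpart_lin Bpart1 Bpart_mul Bpart_sum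
  Bpart_direct Bpart_fin Bpart_gen.

End QuotientOfFree.

Section Regular.
Context (k : fieldType) (B : gralg k).

Definition regular_part (i : int) (b : B^o) : Prop :=
  match i with Posz n => gpart n b | Negz _ => b = 0 end.

Lemma regular_zero i : regular_part i 0.
Proof. by case: i => n //=; apply: gpart_zero. Qed.

Lemma regular_sub i u v :
  regular_part i u -> regular_part i v -> regular_part i (u - v).
Proof.
case: i => n /= => [un vn|-> ->]; last by rewrite subr0.
by have := gpart_lin (-1) vn un; rewrite scaleN1r addrC.
Qed.

Lemma regular_act n i (b : B) u :
  gpart n b -> regular_part i u -> regular_part (n%:Z + i) (b *: u).
Proof.
case: i => m bn /= => [um|->]; first exact: gpart_mul.
by rewrite scaler0; apply: regular_zero.
Qed.

Lemma regular_sum u : exists (s : seq int) (c : int -> B^o),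
  [/\ uniq s, forall i, regular_part i (c i) & u = \sum_(i <- s) c i].
Proof.
have [N [c [cP ->]]] := gpart_sum u.
exists [seq Posz i | i <- iota 0 N], (fun i => if i is Posz n then c n else 0).
split=> [|[n|n]|] //=; first by rewrite map_inj_uniq ?iota_uniq // => i j [].
by rewrite big_map -[in LHS](big_mkord xpredT c) /index_iota subn0.
Qed.

Lemma regular_direct (s : seq int) (c : int -> B^o) :
  uniq s -> (forall i, regular_part i (c i)) -> \sum_(i <- s) c i = 0 ->
  forall i, i \in s -> c i = 0.
Proof.
move=> us cP s0 [n|n] is_; last exact: cP (Negz n).
pose d i := if i \in s then c i else 0.
have dP i : regular_part i (d i).
  by rewrite /d; case: ifP => // _; apply: regular_zero.
have [N sN] : exists N, forall n, Posz n \in s -> (n < N)%N.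
  elim: s {us s0 is_ d dP} => [|j s [N sN]]; first by exists 0%N.
  exists (maxn `|j|.+1 N) => m; rewrite inE leq_max => /orP[/eqP <-|/sN ->].
    by rewrite ltnSn.
  by rewrite orbT.
pose t := [seq Posz i | i <- iota 0 N].
have ut : uniq t by rewrite map_inj_uniq ?iota_uniq // => i j [].
have nd i : i \notin s -> d i = 0 by rewrite /d => /negPf ->.
have ndt i : i \notin t -> d i = 0.
  case: i => m; last by move=> _; apply: dP (Negz m).
  move=> mt; apply: nd; apply: contra mt => /sN mN.
  by apply/mapP; exists m; rewrite ?mem_iota.
have := @gpart_direct _ B N (fun n => d (Posz n)) (fun n => dP (Posz n)) _ n (sN n is_).
rewrite /d is_; apply.
rewrite -[LHS](big_mkord xpredT (fun n => d (Posz n))) /index_iota subn0.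
rewrite -[LHS](big_map Posz xpredT d) -/t.
have uw : uniq (undup (s ++ t)) by apply: undup_uniq.
rewrite (sum_support ut uw) // => [|j]; last first.
  by rewrite mem_undup mem_cat orbC => ->.
rewrite -(sum_support us uw) // => [|j]; last by rewrite mem_undup mem_cat => ->.
by rewrite -[RHS]s0 big_seq [RHS]big_seq; apply: eq_bigr => i; rewrite /d => ->.
Qed.

Definition regular_left : Gr B :=
  GrMod regular_zero regular_sub regular_act regular_sum regular_direct.

Definition OO : QGr B := quotF B regular_left.

End Regular.

Definition has_dim (k : fieldType) (V : lmodType k) (P : V -> Prop) (d : nat) :
    Prop :=
  exists e : 'I_d -> V,
    [/\ forall i, P (e i),
        forall v, P v -> exists c : 'I_d -> k, v = \sum_i c i *: e i
      & forall c : 'I_d -> k, \sum_i c i *: e i = 0 -> forall i, c i = 0].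

Section LimitAlgebra.
Context (k : fieldType) (r : nat) (b : nat -> nat).

Definition Sn (n : nat) : Type := forall i : 'I_r.+1, 'M[k]_(b (n - i - 1)).

(* When b satisfies b_n = b_(n-1) + ... + b_(n-r-1) the sizes match and
   [conform_mx] is the identity up to the type of the matrix. *)
Definition phi (n : nat) (g : Sn n) : Sn n.+1 :=
  fun i => if i == ord0
           then conform_mx 0 (\mxdiag_(j < r.+1) g j)
           else conform_mx 0 (g (inord i.-1)).

(* Homomorphisms of unital k-algebras; the operations of the product algebra
   S_n are written out entrywise, as an [algType] cannot be the zero ring. *)
Definition is_Sn_hom (n : nat) (T : algType k) (f : Sn n -> T) : Prop :=
  [/\ forall (a : k) g h, f (fun i => a *: g i + h i) = a *: f g + f h,
      forall g h, f (fun i => g i *m h i) = f g * f h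
    & f (fun i => 1%:M) = 1].

Definition is_cocone (T : algType k) (f : forall n, Sn n -> T) : Prop :=
  forall n, (r < n)%N ->
    is_Sn_hom (@f n) /\ forall g : Sn n, f n.+1 (phi g) = f n g.

(* Only the S_n with n >= r + 1 belong to the direct system.  Testing the
   universal property on nonzero algebras T loses nothing: there is exactly one
   map from S to the zero algebra. *)
Definition is_direct_limit (S : algType k) (iota : forall n, Sn n -> S) : Prop :=
  is_cocone iota /\
  forall (T : algType k) (f : forall n, Sn n -> T), is_cocone f ->
    exists h : {lrmorphism S -> T},
      (forall n, (r < n)%N -> forall g, h (iota n g) = f n g) /\
      forall h' : {lrmorphism S -> T},
        (forall n, (r < n)%N -> forall g, h' (iota n g) = f n g) -> h' =1 h.

End LimitAlgebra.

(* Main.v *)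
Require Import Defs.
From HB Require Import structures.
From mathcomp Require Import all_boot all_order all_algebra zify.
From mathcomp Require Import boolp functions finmap.
From mathcomp.multinomials Require Import monalg.

Set Implicit Arguments.
Unset Strict Implicit.
Unset Printing Implicit Defensive.

Import Order.TTheory GRing.Theory Num.Theory.
Local Open Scope ring_scope.
Local Open Scope quotient_scope.

(** Write B_n for the degree n part of B = k<x,y>/(y^(r+1)). In the quotient
    category, a morphism from O to a graded module M is a germ at infinity: a
    degree preserving family of maps B_d -> M_d that is left B-linear for
    large d, up to equality for large d. The functor of the equivalence is
    Hom(O, -), with its right action of End(O).

    Everything rests on one feature of B. A nonzero word of length greater
    than r starts with y^i x for a unique i <= r, and hence B_d is the direct
    sum of the y^i x B_(d-i-1), each summand being a copy of B_(d-i-1). A germ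
    is therefore determined by its values in r + 1 consecutive degrees, and
    these values can be prescribed arbitrarily: every k-linear family given in
    r + 1 consecutive degrees extends uniquely by the recursion
    phi(y^i x w) = y^i x phi(w), and the extension is left linear
    ([ext_linear], [recursive_rel]).

    This computes End(O). An element (g_0, ..., g_r) of S_n is the same thing
    as endomorphisms of B_(n-1), ..., B_(n-r-1), hence gives a germ. Extending
    by one degree produces diag(g_0, ..., g_r) on B_n, provided that the bases
    of the B_n are chosen compatibly with the decomposition, and so the
    transition maps do not change the germ. Every germ arises in this way, and
    two elements with the same germ become equal at a higher level; thus End(O)
    has the universal property of the limit and is isomorphic to S
    ([limit_iso]). The same extension property shows that germs can be lifted
    along any morphism of the quotient category ([lift_exists]), which makes
    Hom(O, -) a functor defined on representatives.

    For the inverse functor, division by x^n on the right is a left linear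
    retraction of B_(>=n) onto B x^n, a copy of B(-n). So O(-n) is the image
    of an idempotent e_n of End(O), and Hom(O(-n), M) = Hom(O, M) e_n. A right
    module N yields the graded module with components N e_n for n >= 0, on
    which an element of B acts as right multiplication O(-n-j) -> O(-n). For
    N = Hom(O, M), the map that sends m in M_n to the morphism O(-n) -> M with
    value m on the generator has torsion kernel and cokernel, because a germ
    is an actual morphism in large degrees ([gammas_sections]). For general
    N, the map from N = N e_0 to the germs into its graded module is bijective
    because O is a direct summand of a finite sum of copies of O(-d), for each
    d ([partition_of_unity], [sections_gammas]). *)

(** * Fox derivatives on the free algebra *)

Section LinearExtension.
Context (R : nzRingType) (K : choiceType) (V : lmodType R) (h : K -> V).

Definition linext (f : {malg R[K]}) : V := \sum_(w <- msupp f) f@_w *: h w.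

Lemma linextE (d : {fset K}) (f : {malg R[K]}) : (msupp f `<=` d)%fset ->
  linext f = \sum_(w <- d) f@_w *: h w.
Proof.
move=> le; rewrite /linext (big_fset_incl _ le) // => w _ /mcoeff_outdom ->.
by rewrite scale0r.
Qed.

Lemma linext_is_linear : linear linext.
Proof.
move=> a f g; pose d := (msupp f `|` msupp g `|` msupp (a *: f + g))%fset.
rewrite !(@linextE d) ?fsubsetUr //; last first.
- by rewrite /d -fsetUA fsubsetUl.
- by rewrite /d [(msupp f `|` _)%fset]fsetUC -fsetUA fsubsetUl.
rewrite scaler_sumr -big_split /=; apply: eq_bigr => w _.
by rewrite mcoeffD mcoeffZ scalerDl scalerA.
Qed.
HB.instance Definition _ :=
  GRing.isLinear.Build R {malg R[K]} V *:%R linext linext_is_linear.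

Lemma linextU (c : R) w : linext << c *g w >> = c *: h w.
Proof. by rewrite (@linextE [fset w]%fset) ?msuppU_le // big_seq_fset1 mcoeffUU. Qed.
End LinearExtension.

Section TwistedDerivation.
Context (k : fieldType) (A : algType k) (W : A -> Prop).
Hypothesis W_span : forall P : A -> Prop, P 0 ->
  (forall (c : k) f g, W f -> P g -> P (c *: f + g)) -> forall f, P f.

(** Both sides are bilinear, so that the twisted Leibniz rules only have to be
    checked on a spanning set. *)
Lemma derivation_lM (d : {linear A -> A}) (e : {linear A -> k^o}) :
  (forall v w, W v -> W w -> d (v * w) = d v * w + (e v : k) *: d w) ->
  forall f g, d (f * g) = d f * g + (e f : k) *: d g.
Proof.
move=> dW; elim/W_span => [g|c v f Wv IH g].
  by rewrite !raddf0 mul0r raddf0 scale0r addr0.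
rewrite mulrDl !linearD /= IH -scalerAl !linearZ /= scalerDl.
rewrite mulrDl addrACA -scalerAl -scalerA -scalerDr; congr (_ *: _ + _).
elim/W_span: g => [|{}c w g Ww IHg].
  by rewrite !mulr0 !raddf0 ?scaler0 ?mulr0 addr0.
rewrite mulrDr -scalerAr !linearP /= IHg dW // mulrDr -scalerAr.
by rewrite !scalerDr addrACA !scalerA ?[_ * c]mulrC.
Qed.

Lemma derivation_rM (d : {linear A -> A}) (e : {linear A -> k^o}) :
  (forall v w, W v -> W w -> d (v * w) = v * d w + (e w : k) *: d v) ->
  forall f g, d (f * g) = f * d g + (e g : k) *: d f.
Proof.
move=> dW f; elim/W_span => [|c w g Ww IH].
  by rewrite !mulr0 !raddf0 ?mulr0 scale0r addr0.
rewrite mulrDr -scalerAr !linearP /= IH scalerDl mulrDr -scalerAr addrACA.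
rewrite -scalerA -scalerDr; congr (_ *: _ + _).
elim/W_span: f {IH} => [|{}c v f Wv IHf].
  by rewrite !mul0r !raddf0 ?mul0r ?scaler0 addr0.
rewrite mulrDl -scalerAl !linearP /= IHf dW // mulrDl -scalerAl.
by rewrite !scalerDr addrACA !scalerA ?[_ * c]mulrC.
Qed.

Lemma character_M (e : {linear A -> k^o}) :
  (forall v w, W v -> W w -> e (v * w) = (e v : k) * (e w : k)) ->
  forall f g, e (f * g) = (e f : k) * (e g : k).
Proof.
move=> eW f; elim/W_span => [|c w g Ww IH].
  by rewrite mulr0 !raddf0 mulr0.
rewrite mulrDr -scalerAr !linearP /= IH mulrDr; congr (_ + _).
elim/W_span: f {IH} => [|{}d v f Wv IHf].
  by rewrite mul0r !raddf0 ?scaler0 mul0r.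
rewrite mulrDl -scalerAl !linearP /= IHf eW // mulrDl; congr (_ + _).
by rewrite /GRing.scale /= -mulrA; congr (d * _); rewrite mulrCA.
Qed.

Lemma split_ext (e : {linear A -> k^o}) (d d' : {linear A -> A}) (x y : A) :
  (forall w, W w -> w = (e w : k)%:A + x * d w + y * d' w) ->
  forall f, f = (e f : k)%:A + x * d f + y * d' f.
Proof.
move=> sW; elim/W_span => [|c w f Ww IH].
  by rewrite !raddf0 scale0r !mulr0 !addr0.
rewrite !linearP /= {1}IH {1}(sW w Ww) scalerDl !mulrDr !scalerDr -!scalerAr.
by rewrite -scalerA addrACA [_ + (e f)%:A + _]addrACA.
Qed.
End TwistedDerivation.

Section FoxDerivatives.
Context (k : fieldType).
Local Notation A := (free2 k).
Implicit Types (v w : {fmonom bool}) (a b : bool).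

Definition letter a : A := << fmu a >>.
Definition word w : A := << w >>.

Definition strip_first a w : A :=
  if fmonom_val w is b :: s then (if b == a then word (FMonom s) else 0) else 0.
Definition strip_last a w : A :=
  if rev w is b :: s then (if b == a then word (FMonom (rev s)) else 0) else 0.

(** The Fox derivatives of the free algebra, on the left and on the right. *)
Definition foxl a : {linear A -> A} := @linext k {fmonom bool} A (strip_first a).
Definition foxr a : {linear A -> A} := @linext k {fmonom bool} A (strip_last a).
Definition aug : {linear A -> k^o} :=
  @linext k {fmonom bool} k^o (fun w => (nilp w)%:R).

Lemma word_span (P : A -> Prop) : P 0 ->
  (forall (c : k) f g, (exists w, f = word w) -> P g -> P (c *: f + g)) -> forall f, P f.
Proof.
move=> P0 PD f; rewrite [f]monalgE.
elim: (enum_fset _) => [|w s IH]; first by rewrite big_nil.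
by rewrite big_cons malgZU; apply: PD IH; exists w.
Qed.

Lemma foxl_word a w : foxl a (word w) = strip_first a w.
Proof. by rewrite /foxl /= linextU scale1r. Qed.
Lemma foxr_word a w : foxr a (word w) = strip_last a w.
Proof. by rewrite /foxr /= linextU scale1r. Qed.
Lemma aug_word w : aug (word w) = (nilp w)%:R.
Proof. by rewrite /aug /= linextU scale1r. Qed.

Lemma wordM v w : word v * word w = word (mmul v w).
Proof. by rewrite /word malgM_def fgmulUU mulr1. Qed.

Lemma wordE v w : fmonom_val v = fmonom_val w -> word v = word w.
Proof. by move=> e; congr word; apply/eqP; rewrite fmP e. Qed.

(** For two words the second term is present only if the first word is empty,
    in which case the derivative reaches the second word. *)
Lemma foxlM a f g : foxl a (f * g) = foxl a f * g + (aug f : k) *: foxl a g.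
Proof.
apply: (@derivation_lM k A _ word_span) => _ _ [v ->] [w ->].
rewrite wordM !foxl_word aug_word /strip_first fmM.
case: v => -[|x v] /=; first by rewrite mul0r add0r scale1r.
rewrite scale0r addr0; case: ifP => _; last by rewrite mul0r.
by rewrite wordM; apply: wordE; rewrite fmM.
Qed.

Lemma foxrM a f g : foxr a (f * g) = f * foxr a g + (aug g : k) *: foxr a f.
Proof.
apply: (@derivation_rM k A _ word_span) => _ _ [v ->] [w ->].
rewrite wordM !foxr_word aug_word /strip_last fmM rev_cat.
rewrite /nilp -size_rev; case E: (rev w) => [|x s] /=.
  by rewrite mulr0 add0r scale1r.
rewrite scale0r addr0; case: ifP => _; last by rewrite mulr0.
by rewrite wordM; apply: wordE; rewrite fmM /= rev_cat revK.
Qed.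

Lemma augM f g : aug (f * g) = (aug f : k) * (aug g : k).
Proof.
apply: (@character_M k A _ word_span) => _ _ [v ->] [w ->].
by rewrite wordM !aug_word /nilp fmM size_cat addn_eq0 -natrM mulnb.
Qed.

Lemma letterM_word a w : letter a * word w = word (FMonom (a :: w)).
Proof. by rewrite (wordM (fmu a)); apply: wordE; rewrite fmM fmU. Qed.

Lemma fox_split f :
  f = (aug f : k)%:A + letter false * foxl false f + letter true * foxl true f.
Proof.
move: f; apply: (@split_ext k A _ word_span) => _ [w ->].
rewrite aug_word !foxl_word /strip_first; case: w => -[|[] s] /=.
- by rewrite !mulr0 !addr0 scale1r; apply: wordE; rewrite fm1.
- by rewrite scale0r mulr0 !add0r letterM_word.
- by rewrite scale0r mulr0 addr0 add0r letterM_word.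
Qed.

Lemma aug_letter a : aug (letter a) = 0.
Proof. by rewrite /letter -/(word _) aug_word /nilp fmU. Qed.

Lemma foxl_letter a b : foxl a (letter b) = (b == a)%:R.
Proof.
rewrite /letter -/(word _) foxl_word /strip_first fmU.
by case: eqP => // _; apply: wordE; rewrite fm1.
Qed.

Lemma foxr_letter a b : foxr a (letter b) = (b == a)%:R.
Proof.
rewrite /letter -/(word _) foxr_word /strip_last fmU /=.
by case: eqP => // _; apply: wordE; rewrite fm1.
Qed.

Lemma linext_part h n m (f : A) : free_part m f ->
  (forall w, fdeg w = m -> free_part n (h w)) -> free_part n (@linext k _ A h f).
Proof.
move=> fm hn; rewrite /linext big_seq; apply: big_ind => [|g g' gn g'n|w wf].
- exact: free_part0.
- by rewrite -[g]scale1r; apply: free_part_lin.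
- by rewrite -[_ *: _]addr0; apply: free_part_lin; [apply/hn/fm|apply: free_part0].
Qed.

Lemma foxl_part a n f : free_part n.+1 f -> free_part n (foxl a f).
Proof.
move=> /linext_part; apply => w; rewrite fdegE /strip_first.
case: w => -[//|b s] /= [sn]; case: ifP => _; last exact: free_part0.
exact: free_partU.
Qed.

Lemma foxr_part a n f : free_part n.+1 f -> free_part n (foxr a f).
Proof.
move=> /linext_part; apply => w; rewrite fdegE /strip_last -size_rev.
case: (rev w) => [//|b s] /= [sn]; case: ifP => _; last exact: free_part0.
by apply: free_partU; rewrite fdegE size_rev.
Qed.

Lemma aug_part n f : free_part n.+1 f -> aug f = 0.
Proof.
move=> fn; rewrite /aug /= /linext big1_seq // => w /andP[_ /fn].
by rewrite fdegE /nilp => ->; rewrite scaler0.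
Qed.

Lemma foxl_part0 a f : free_part 0 f -> foxl a f = 0.
Proof.
move=> f0; rewrite /foxl /= /linext big1_seq // => w /andP[_ /f0].
by rewrite fdegE /strip_first; case: w => -[] //= _; rewrite scaler0.
Qed.

Lemma free_part0_scalar f : free_part 0 f -> exists a : k, f = a%:A.
Proof.
by move=> f0; exists (aug f); rewrite {1}[f]fox_split !foxl_part0 // !mulr0 !addr0.
Qed.
End FoxDerivatives.

(** * Left and right division in the truncated algebra *)

(** The properties of k<x,y>/(y^(r+1)) on which the proof rests. A word of
    length greater than r without the factor y^(r+1) is y^i x w for a unique i
    <= r; [ldiv i] removes the prefix y^i x from such words. The map [rdiv]
    removes a final x; it is left linear in positive degrees because a final x
    takes no part in the relation. *)
Record division (k : fieldType) (B : gralg k) (r : nat) := Division {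
  dx : B;
  dy : B;
  ldiv : nat -> {linear B -> B};
  rdiv : {linear B -> B};
  dx_part : gpart 1 dx;
  dy_part : gpart 1 dy;
  dy_nil : dy ^+ r.+1 = 0;
  part0_scalar : forall u : B, gpart 0 u -> exists a : k, u = a%:A;
  partS_split : forall n (u : B), gpart n.+1 u ->
    exists v w, [/\ gpart n v, gpart n w & u = dx * v + dy * w];
  ldiv_part : forall i n u, (i <= r)%N -> gpart (i.+1 + n) u -> gpart n (ldiv i u);
  ldiv_sum : forall n u, (r < n)%N -> gpart n u ->
    u = \sum_(i < r.+1) dy ^+ i * dx * ldiv i u;
  ldivK : forall i j u, (i <= r)%N -> (j <= r)%N ->
    ldiv j (dy ^+ i * dx * u) = if i == j then u else 0;
  rdiv_part : forall n u, gpart n.+1 u -> gpart n (rdiv u);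
  rdivK : forall u, rdiv (u * dx) = u;
  rdivM : forall n u v, gpart n.+1 v -> rdiv (u * v) = u * rdiv v }.

Section FoxIdeal.
Context (k : fieldType) (A : algType k) (aug : {linear A -> k^o}).
Context (fl : bool -> {linear A -> A}) (fr : {linear A -> A}) (letter : bool -> A).
Hypothesis flM : forall a f g, fl a (f * g) = fl a f * g + (aug f : k) *: fl a g.
Hypothesis frM : forall f g, fr (f * g) = f * fr g + (aug g : k) *: fr f.
Hypothesis aug_letter : forall a, aug (letter a) = 0.
Hypothesis fl_letter : forall a b, fl a (letter b) = (b == a)%:R.
Hypothesis fr_letter : forall b, fr (letter b) = (b == false)%:R.
Hypothesis augM : forall f g, aug (f * g) = (aug f : k) * (aug g : k).
Context (r : nat).
Local Notation x := (letter false).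
Local Notation y := (letter true).
Local Notation I := (tsideal (y ^+ r.+1)).

Lemma fl_letterM a b f : fl a (letter b * f) = if b == a then f else 0.
Proof.
rewrite flM aug_letter scale0r addr0 fl_letter.
by case: eqP; rewrite ?mul1r ?mul0r.
Qed.

Definition ldivf i f := fl false (iter i (fl true) f).

Lemma ldivf_is_linear i : linear (ldivf i).
Proof.
move=> a f g; rewrite /ldivf -linearP; congr (fl _ _).
by elim: i => //= i ->; rewrite linearP.
Qed.
HB.instance Definition _ i := GRing.isLinear.Build k A A *:%R (ldivf i) (ldivf_is_linear i).

Lemma ideal_mem (a c : A) : a * y ^+ r.+1 * c \in I.
Proof. by apply/asboolP; exists [:: (a, c)]; rewrite big_seq1. Qed.

Lemma ideal_memr (c : A) : y ^+ r.+1 * c \in I.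
Proof. by have := ideal_mem 1 c; rewrite mul1r. Qed.

Lemma ideal_ind (e : {linear A -> A}) :
  (forall a c, e (a * y ^+ r.+1 * c) \in I) -> forall f, f \in I -> e f \in I.
Proof.
move=> eI f /asboolP[s ->]; rewrite raddf_sum; apply: rpred_sum => p _.
exact: eI.
Qed.

(** Dividing a y^m c by y repeatedly consumes the words of a; a word that is
    exhausted after fewer than i steps leaves a multiple of some y^(m-l) c. *)
Lemma iter_fl_y m i (a c : A) : (i <= m)%N -> exists s : nat -> k,
  iter i (fl true) (a * (y ^+ m * c)) =
  iter i (fl true) a * (y ^+ m * c) +
  \sum_(l < i) s l *: (y ^+ (m - l.+1) * c).
Proof.
elim: i => [|i IH] im; first by exists (fun=> 0); rewrite big_ord0 addr0.
have [s es] := IH (ltnW im).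
exists (fun l => if l is l'.+1 then s l' else aug (iter i (fl true) a)).
rewrite !iterS es linearD flM -addrA; congr (_ + _).
rewrite big_ord_recl /=; congr (_ + _).
  congr (_ *: _); rewrite subn1; case: m im {IH es} => // m _.
  by rewrite exprS -mulrA fl_letterM.
rewrite raddf_sum; apply: eq_bigr => l _ /=; rewrite linearZ /=; congr (_ *: _).
have lm : (l.+1 < m)%N by apply: leq_ltn_trans im; apply: ltn_ord.
by rewrite -(subnSK lm) exprS -mulrA fl_letterM.
Qed.

(** In the terms where the divisions by y reach the block y^(r+1), at least one
    y is left in front since i <= r, and the final division by x kills them. In
    the other terms the block is untouched. *)
Lemma ldivf_ideal i : (i <= r)%N -> forall f, f \in I -> ldivf i f \in I.
Proof.
move=> ir; apply: ideal_ind => a c; rewrite /= /ldivf -mulrA.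
have [s ->] := iter_fl_y a c (leqW ir).
rewrite linearD flM raddf_sum /= exprS -mulrA fl_letterM scaler0 addr0.
rewrite big1 ?addr0 => [|l _]; last first.
  rewrite linearZ /= (_ : r.+1 - l.+1 = (r - l.+1).+1)%N; last first.
    by rewrite subSS -subSn ?subSS // (leq_trans (ltn_ord l)).
  by rewrite exprS -mulrA fl_letterM scaler0.
by rewrite !mulrA -[_ * y * _]mulrA -exprS ideal_mem.
Qed.

(** A division by x on the right cannot reach into the block y^(r+1), whose
    last letter is y. *)
Lemma fr_ideal f : f \in I -> fr f \in I.
Proof.
move: f; apply: ideal_ind => a c; rewrite frM [fr (a * _)]frM.
have e0 : fr (y ^+ r.+1) = 0.
  elim: r => [|m IH]; first by rewrite expr1 fr_letter.
  by rewrite exprS frM IH mulr0 add0r fr_letter scaler0.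
have a0 : aug (y ^+ r.+1) = 0 by rewrite exprS augM aug_letter mul0r.
by rewrite e0 a0 scale0r addr0 mulr0 scaler0 addr0 ideal_mem.
Qed.

Context (B : algType k) (pi : {lrmorphism A -> B}).
Hypothesis pi_eq0 : forall f, (pi f == 0) = (f \in I).
Hypothesis pi_surj : forall u, exists f, u = pi f.

Definition lift u : A := sval (cid (pi_surj u)).
Lemma liftK u : pi (lift u) = u.
Proof. exact/esym/(svalP (cid (pi_surj u))). Qed.

Section Descent.
Context (e : {linear A -> A}).

(** The invariance of the ideal is an argument of the induced map, so that
    linearity can be attached to it. *)
Definition descend of (forall f, f \in I -> e f \in I) :=
  fun u : B => pi (e (lift u)).

Context (eI : forall f, f \in I -> e f \in I).

Lemma descendE f : descend eI (pi f) = pi (e f).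
Proof.
apply/eqP; rewrite -subr_eq0 -!raddfB /= pi_eq0; apply: eI.
by rewrite -pi_eq0 raddfB /= liftK subrr.
Qed.

Lemma descend_is_linear : linear (descend eI).
Proof.
move=> a u v; rewrite -[u]liftK -[v]liftK -linearP !descendE.
by rewrite !linearP.
Qed.
HB.instance Definition _ :=
  GRing.isLinear.Build k B B *:%R (descend eI) descend_is_linear.
End Descent.

Lemma ldivf_letterM i j f : (i <= r)%N -> (j <= r)%N ->
  ldivf j (y ^+ i * x * f) = if i == j then f else 0.
Proof.
rewrite /ldivf -mulrA => ir jr.
have e m n g : iter m (fl true) (y ^+ (m + n) * g) = y ^+ n * g.
  elim: m n => // m IH n; rewrite addSnnS iterS IH.
  by rewrite exprS -mulrA fl_letterM.
have z m : iter m (fl true) 0 = 0 by elim: m => //= m ->; rewrite raddf0.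
case: (ltngtP i j) => ij.
- rewrite -(subnK ij) iterD -[i.+1]addn1 addnC iterD.
  have := e i 0%N (x * f); rewrite addn0 mul1r => ->.
  by rewrite /= fl_letterM z raddf0.
- rewrite -(subnKC (ltnW ij)) e -subnSK // exprS -mulrA.
  by rewrite fl_letterM.
- by have := e j 0%N (x * f); rewrite ij addn0 mul1r => ->; rewrite fl_letterM.
Qed.

Hypothesis split : forall f, f = (aug f : k)%:A + x * fl false f + y * fl true f.
Context (P : nat -> A -> Prop).
Hypothesis P_fl : forall a n f, P n.+1 f -> P n (fl a f).
Hypothesis P_aug : forall n f, P n.+1 f -> aug f = 0.

Lemma P_iter m n f : P (m + n) f -> P n (iter m (fl true) f).
Proof.
by elim: m n => //= m IH n; rewrite addSnnS => /IH; apply: P_fl.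
Qed.

Lemma P_ldivf i n f : P (i.+1 + n) f -> P n (ldivf i f).
Proof. by rewrite addSnnS => /P_iter; apply: P_fl. Qed.

(** The decomposition f = x f_x + y f_y of elements of positive degree,
    iterated on its second summand. *)
Lemma iterated_split m n f : (m <= n)%N -> P n f ->
  f = \sum_(i < m) y ^+ i * x * ldivf i f + y ^+ m * iter m (fl true) f.
Proof.
elim: m => [|m IH] mn Pf; first by rewrite big_ord0 add0r mul1r.
rewrite big_ord_recr /= {1}IH ?(ltnW mn) //; rewrite -addrA; congr (_ + _).
have : P (n - m) (iter m (fl true) f) by apply: P_iter; rewrite subnKC // ltnW.
rewrite -subnSK // => /P_aug a0.
by rewrite {1}[iter m _ f]split a0 scale0r add0r mulrDr /ldivf !mulrA -exprSr.
Qed.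

Definition ldivB i : {linear B -> B} :=
  if (i <= r)%N =P true is ReflectT ir then descend (ldivf_ideal ir) else \0.

Lemma ldivB_pi i f : (i <= r)%N -> ldivB i (pi f) = pi (ldivf i f).
Proof. by rewrite /ldivB => ir; case: eqP => // ir'; apply: descendE. Qed.

Definition rdivB : {linear B -> B} := descend fr_ideal.

Lemma rdivB_pi f : rdivB (pi f) = pi (fr f).
Proof. exact: descendE. Qed.

Lemma ldivB_sum n f : (r < n)%N -> P n f ->
  pi f = \sum_(i < r.+1) pi y ^+ i * pi x * ldivB i (pi f).
Proof.
move=> rn /(iterated_split rn) {1}->; rewrite linearD /= raddf_sum.
have /eqP -> : pi (y ^+ r.+1 * iter r.+1 (fl true) f) == 0.
  by rewrite pi_eq0 ideal_memr.
rewrite addr0; apply: eq_bigr => i _.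
by rewrite ldivB_pi ?leq_ord //= !rmorphM rmorphXn.
Qed.

Lemma ldivB_letterM i j u : (i <= r)%N -> (j <= r)%N ->
  ldivB j (pi y ^+ i * pi x * u) = if i == j then u else 0.
Proof.
move=> ir jr; have [f ->] := pi_surj u.
rewrite -rmorphXn -!rmorphM ldivB_pi // ldivf_letterM //.
by case: ifP; rewrite ?raddf0.
Qed.

Lemma rdivB_mulx u : rdivB (u * pi x) = u.
Proof.
have [f ->] := pi_surj u; rewrite -rmorphM rdivB_pi frM fr_letter aug_letter.
by rewrite scale0r addr0 mulr1.
Qed.

Lemma rdivB_mul n u f : P n.+1 f -> rdivB (u * pi f) = u * rdivB (pi f).
Proof.
move=> /P_aug a0; have [g ->] := pi_surj u.
by rewrite -rmorphM !rdivB_pi frM a0 scale0r addr0 rmorphM.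
Qed.

Lemma pi_split n f : P n.+1 f ->
  pi f = pi x * pi (fl false f) + pi y * pi (fl true f).
Proof.
by move=> /P_aug a0; rewrite {1}[f]split a0 scale0r add0r raddfD /= !rmorphM.
Qed.

Lemma pi_y_nilp : pi y ^+ r.+1 = 0.
Proof.
apply/eqP; rewrite -rmorphXn pi_eq0; have := ideal_memr 1; by rewrite mulr1.
Qed.

End FoxIdeal.

Section Concrete.
Context (k : fieldType) (r : nat).
Local Notation A := (free2 k).
Local Notation B := (Btrunc k r).
Local Notation pi := (Bpi k r).

Lemma pi_ideal f : (pi f == 0) = (f \in tsideal (letter k true ^+ r.+1)).
Proof. exact: Bpi_eq0. Qed.

Let foxr0_letter b : foxr k false (letter k b) = (b == false)%:R.
Proof. exact: foxr_letter. Qed.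

Definition Bldiv := @ldivB k A (aug k) (foxl k) (letter k) (@foxlM k)
  (@aug_letter k) (@foxl_letter k) r (Balg k r) pi pi_ideal (@Bpi_surj k r).

Definition Brdiv := @rdivB k A (aug k) (foxr k false) (letter k)
  (@foxrM k false) (@aug_letter k) foxr0_letter (@augM k) r (Balg k r) pi pi_ideal
  (@Bpi_surj k r).

Lemma Btrunc_division : division B r.
Proof.
apply: (@Division k B r (pi (letter k false)) (pi (letter k true)) Bldiv Brdiv).
- by exists (letter k false) => //; apply: free_partU; rewrite fdegU.
- by exists (letter k true) => //; apply: free_partU; rewrite fdegU.
- exact: (pi_y_nilp pi_ideal).
- move=> u [f f0 ->]; have [a ->] := free_part0_scalar f0; exists a.
  by rewrite linearZ /= rmorph1.
- move=> n u [f fn ->].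
  exists (pi (foxl k false f)), (pi (foxl k true f)); split.
  + by exists (foxl k false f) => //; apply: foxl_part.
  + by exists (foxl k true f) => //; apply: foxl_part.
  exact: (pi_split pi (@fox_split k) (@aug_part k) fn).
- move=> i n u ir [f fn ->]; exists (ldivf (foxl k) i f).
    exact: (P_ldivf (@foxl_part k) fn).
  exact: ldivB_pi.
- move=> n u rn [f fn ->].
  exact: (ldivB_sum _ _ _ _ _ (@fox_split k) (@foxl_part k) (@aug_part k) rn fn).
- move=> i j u; exact: ldivB_letterM.
- move=> n u [f fn ->]; exists (foxr k false f); first exact: foxr_part.
  exact: rdivB_pi.
- by move=> u; exact: rdivB_mulx.
- move=> n u v [f fn ->]; exact: (rdivB_mul _ _ _ _ _ _ (@aug_part k) u fn).
Qed.
End Concrete.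

(** * Germs at infinity *)

Section GradedModules.
Context (k : fieldType) (B : gralg k).

Lemma gpart_sumr (I : Type) (l : seq I) (F : I -> B) n :
  (forall i, gpart n (F i)) -> gpart n (\sum_(i <- l) F i).
Proof. by move=> h; apply: big_ind => // *; [apply: gpart_zero|apply: gpartD]. Qed.

Lemma homogeneous_ind (P : B -> Prop) : P 0 -> (forall b c, P b -> P c -> P (b + c)) ->
  (forall j b, gpart j b -> P b) -> forall b, P b.
Proof.
move=> P0 PD Ph b; have [D [c [cg ->]]] := gpart_sum b.
by apply: big_ind => // i _; apply: (Ph i).
Qed.

Lemma gr_add (M : grmod B) i (u v : M) : gr i u -> gr i v -> gr i (u + v).
Proof.
move=> iu iv; rewrite -[v]opprK; apply: gr_sub => //.
by rewrite -[- v]sub0r; apply: gr_sub => //; apply: gr_zero.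
Qed.

Lemma gcomp_id (M : grmod B) i (m : M) : gr i m -> gcomp i m = m.
Proof. by move=> im; rewrite (gcomp_hom _ im) eqxx. Qed.

Lemma gcomp_comp (M : grmod B) i j (m : M) :
  gcomp i (gcomp j m) = if i == j then gcomp j m else 0.
Proof. exact: (gcomp_hom i (gcomp_gr j m)). Qed.

Lemma gcomp_lower (M : grmod B) (m : M) :
  exists d : nat, forall i : int, i < - d%:Z -> gcomp i m = 0.
Proof.
have [_ [s [us s0 _]]] := gcompP m.
suff [d hd] : exists d : nat, forall i, i \in s -> - d%:Z <= i.
  by exists d => i id; apply: s0; apply/negP => /hd; rewrite leNgt id.
elim: s {us s0} => [|j s [d hd]]; first by exists 0%N.
exists (d + absz j)%N => i; rewrite inE => /orP[/eqP ->|/hd]; lia.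
Qed.

End GradedModules.

Section Germs.
Context (k : fieldType) (B : gralg k).

(** Truth on all homogeneous elements of large degree. Families of maps that
    agree there have the same class in the colimit of the Hom(B_(>=n), M). *)
Definition evt (P : nat -> B -> Prop) : Prop :=
  exists n, forall d u, (n <= d)%N -> gpart d u -> P d u.

Lemma evtT (P : nat -> B -> Prop) : (forall d u, gpart d u -> P d u) -> evt P.
Proof. by move=> h; exists 0%N => d u _; apply: h. Qed.

Lemma evt1 (P Q : nat -> B -> Prop) :
  (forall d u, gpart d u -> P d u -> Q d u) -> evt P -> evt Q.
Proof. by move=> h [n hn]; exists n => d u nd ud; apply/h/hn. Qed.

Lemma evt2 (P Q R : nat -> B -> Prop) :
  (forall d u, gpart d u -> P d u -> Q d u -> R d u) -> evt P -> evt Q -> evt R.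
Proof.
move=> h [n hn] [m hm]; exists (maxn n m) => d u; rewrite geq_max => /andP[nd md] ud.
by apply: h => //; [apply: hn|apply: hm].
Qed.

Section OneModule.
Context (M : grmod B).
Implicit Types (phi psi : nat -> B -> M).

(** Such a family restricts to a morphism of graded modules from B_(>=n) to M.
    Linearity over k is part of the last clause, scalars being of degree 0. *)
Definition linear_from (n : nat) phi : Prop := forall d, (n <= d)%N ->
  [/\ forall u v, gpart d u -> gpart d v -> phi d (u + v) = phi d u + phi d v,
      forall u, gpart d u -> gr d%:Z (phi d u)
    & forall j c u, gpart j c -> gpart d u -> phi (j + d)%N (c * u) = c *: phi d u].

Lemma linear_fromW n m phi : (n <= m)%N -> linear_from n phi -> linear_from m phi.
Proof. by move=> nm h d md; apply/h/(leq_trans nm). Qed.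

Lemma linear_from_sum n phi d (I : Type) (l : seq I)
    (F : I -> B) : linear_from n phi -> (n <= d)%N -> (forall i, gpart d (F i)) ->
  phi d (\sum_(i <- l) F i) = \sum_(i <- l) phi d (F i).
Proof.
move=> h nd hF; have [hD _ hM] := h d nd; elim: l => [|i l IH].
  rewrite !big_nil; have := hM 0%N 0 0 (gpart_zero _ _) (gpart_zero _ _).
  by rewrite mul0r scale0r.
by rewrite !big_cons hD ?IH //; apply: gpart_sumr.
Qed.

Lemma linear_fromZ n phi d (a : k) u :
  linear_from n phi -> (n <= d)%N -> gpart d u -> phi d (a *: u) = a%:A *: phi d u.
Proof.
move=> h nd ud; have [_ _ hM] := h d nd.
by have := hM 0%N _ _ (gpart_alg B a) ud; rewrite add0n -scalerAl mul1r.
Qed.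

Definition evlin : {pred nat -> B -> M} := fun phi => `[< exists n, linear_from n phi >].

Lemma evlin_zmod_closed : zmod_closed evlin.
Proof.
split.
  apply/asboolP; exists 0%N => d _; split=> [u v _ _|u _|j c u _ _].
  - by rewrite addr0.
  - exact: gr_zero.
  - by rewrite scaler0.
move=> phi psi /asboolP[n hn] /asboolP[m hm]; apply/asboolP.
exists (maxn n m) => d; rewrite geq_max => /andP[/hn[n1 n2 n3] /hm[m1 m2 m3]].
split=> [u v ud vd|u ud|j c u cj ud]; rewrite /= ?fctE.
- by rewrite n1 // m1 // opprD addrACA.
- by apply: gr_sub; [apply: n2|apply: m2].
- by rewrite n3 // m3 // scalerBr.
Qed.
HB.instance Definition _ :=
  GRing.isZmodClosed.Build (nat -> B -> M) evlin evlin_zmod_closed.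

Record pregerm := PreGerm { pgfun :> nat -> B -> M; _ : pgfun \in evlin }.
HB.instance Definition _ := [isSub for pgfun].
HB.instance Definition _ := [Choice of pregerm by <:].
HB.instance Definition _ := [SubChoice_isSubZmodule of pregerm by <:].

Definition mkpg phi (h : exists n, linear_from n phi) : pregerm :=
  @PreGerm phi (asboolT h).

Lemma pgP (phi : pregerm) : exists n, linear_from n phi.
Proof. by case: phi => phi /= /asboolP. Qed.

Lemma pg_sum I (s : seq I) (p : I -> pregerm) d u :
  (\sum_(j <- s) p j) d u = \sum_(j <- s) p j d u.
Proof.
by elim: s => [|j s IH]; rewrite ?big_nil // !big_cons -IH.
Qed.

Definition evzero : {pred pregerm} := fun phi : pregerm => `[< evt (fun d u => phi d u = 0) >].

Lemma evzero_zmod_closed : zmod_closed evzero.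
Proof.
split; first by apply/asboolP/evtT.
move=> phi psi /asboolP h /asboolP h'; apply/asboolP.
apply: evt2 h h' => d u _ e e'.
by rewrite /= !fctE e e' subr0.
Qed.
HB.instance Definition _ := GRing.isZmodClosed.Build pregerm evzero evzero_zmod_closed.

(** The colimit of the Hom(B_(>=n), M), that is Hom(O, M) in the quotient
    category. *)
Definition germ : Type := Quotient.quot evzero.
HB.instance Definition _ := GRing.Zmodule.on germ.

Definition germ_of (phi : pregerm) : germ := \pi_(Quotient.quot evzero) phi.
Definition rep (p : germ) : pregerm := repr (p : Quotient.quot evzero).

Lemma repK : cancel rep germ_of. Proof. exact: reprK. Qed.

Lemma germ_of_is_zmod_morphism : zmod_morphism germ_of.
Proof. by move=> u v; rewrite /germ_of raddfB. Qed.
HB.instance Definition _ :=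
  GRing.isZmodMorphism.Build pregerm germ germ_of germ_of_is_zmod_morphism.

Lemma germ_of_eq (phi psi : pregerm) :
  germ_of phi = germ_of psi <-> evt (fun d u => phi d u = psi d u).
Proof.
split=> [/eqP|h].
  rewrite -[_ == _]/(_ == _ :> Quotient.quot evzero) -Quotient.idealrBE => /asboolP.
  by apply: evt1 => d u _ /eqP; rewrite subr_eq0 => /eqP.
apply/eqP; rewrite -[_ == _]/(_ == _ :> Quotient.quot evzero) -Quotient.idealrBE.
by apply/asboolP; apply: evt1 h => d u _ e; rewrite /= !fctE e subrr.
Qed.

Lemma rep_germ_of (phi : pregerm) : evt (fun d u => rep (germ_of phi) d u = phi d u).
Proof. by apply/germ_of_eq; rewrite repK. Qed.

Lemma germ_ind (P : germ -> Prop) : (forall phi : pregerm, P (germ_of phi)) -> forall p, P p.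
Proof. by move=> h p; rewrite -[p]repK. Qed.
End OneModule.

Local Notation R := (regular_left B).

Section Composition.
Context (M : grmod B).
Implicit Types (phi psi : pregerm M) (s t : pregerm R).

Lemma evt_pg (P : nat -> B -> Prop) t : evt P -> evt (fun d u => P d (t d u)).
Proof.
move=> [n hn]; have [m hm] := pgP t.
exists (maxn n m) => d u; rewrite geq_max => /andP[nd md] ud.
by apply: hn => //; have [_ h _] := hm d md; apply: h.
Qed.

Lemma pgcomp_subproof phi t : exists n, linear_from n (fun d u => phi d (t d u)).
Proof.
have [n hn] := pgP phi; have [m hm] := pgP t.
exists (maxn n m) => d; rewrite geq_max => /andP[/hn[n1 n2 n3] /hm[m1 m2 m3]].
split=> [u v ud vd|u ud|j c u cj ud].
- by rewrite m1 // n1 //; apply: m2.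
- exact/n2/m2.
- by rewrite m3 // n3 //; apply: m2.
Qed.
Definition pgcomp phi t : pregerm M := mkpg (pgcomp_subproof phi t).

(** Composition with an endomorphism of O, by which the germs into M become a
    right module over the germs into B. *)
Definition gact (p : germ M) (q : germ R) : germ M := germ_of (pgcomp (rep p) (rep q)).

Lemma gactE phi t : gact (germ_of phi) (germ_of t) = germ_of (pgcomp phi t).
Proof.
apply/germ_of_eq.
apply: evt2 (evt_pg (rep (germ_of t)) (rep_germ_of phi)) (rep_germ_of t).
by move=> d u _ /= -> ->.
Qed.

Lemma gactDl p q (w : germ R) : gact (p + q) w = gact p w + gact q w.
Proof.
rewrite -[p]repK -[q]repK -[w]repK -raddfD !gactE -raddfD.
by apply/germ_of_eq/evtT.
Qed.

Lemma gactDr p (q w : germ R) : gact p (q + w) = gact p q + gact p w.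
Proof.
rewrite -[p]repK -[q]repK -[w]repK -raddfD !gactE -raddfD; apply/germ_of_eq.
have [n hn] := pgP (rep p); have [a ha] := pgP (rep q); have [b hb] := pgP (rep w).
exists (maxn n (maxn a b)) => d u.
rewrite !geq_max => /andP[/hn[h _ _] /andP[/ha[_ ga _] /hb[_ gb _]]] ud.
by rewrite /= !fctE; apply: h; [apply: ga|apply: gb].
Qed.
End Composition.

Lemma gactA (M : grmod B) (p : germ M) (q w : germ R) :
  gact p (gact q w) = gact (gact p q) w.
Proof.
rewrite -[p]repK -[q]repK -[w]repK !gactE.
by apply/germ_of_eq/evtT.
Qed.

Lemma gid_subproof : exists n, @linear_from R n (fun d u => u).
Proof. by exists 0%N. Qed.
Definition idpg : pregerm R := mkpg gid_subproof.
Definition idgerm : germ R := germ_of idpg.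

Lemma gact1 (M : grmod B) (p : germ M) : gact p idgerm = p.
Proof. by rewrite -[p]repK gactE; apply/germ_of_eq/evtT. Qed.

Lemma gact1l (p : germ R) : gact idgerm p = p.
Proof. by rewrite -[p]repK gactE; apply/germ_of_eq/evtT. Qed.

Lemma scale_subproof (a : k) (t : pregerm R) :
  exists n, @linear_from R n (fun d u => (a *: (t d u : B))).
Proof.
have [n hn] := pgP t; exists n => d /hn[h1 h2 h3]; split=> [u v ud vd|u ud|j c u cj ud].
- by rewrite h1 // scalerDr.
- exact/gpartZ/h2.
- by rewrite h3 // scalerAr.
Qed.
Definition scalepg (a : k) (t : pregerm R) : pregerm R := mkpg (scale_subproof a t).
Definition gscale (a : k) (p : germ R) : germ R := germ_of (scalepg a (rep p)).

Lemma gscaleE a t : gscale a (germ_of t) = germ_of (scalepg a t).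
Proof. by apply/germ_of_eq; apply: evt1 (rep_germ_of t) => d u _ /= ->. Qed.

Section Ring.
Context (r : nat) (dv : division B r).

Lemma dxX_part n : gpart n (dx dv ^+ n).
Proof.
elim: n => [|n IH]; first exact: gpart_one.
by rewrite exprS -add1n; apply/gpart_mul/IH/dx_part.
Qed.

Lemma rdivX n u : iter n (rdiv dv) (u * dx dv ^+ n) = u.
Proof.
by elim: n u => [|n IH] u; rewrite ?mulr1 // exprS mulrA iterS IH rdivK.
Qed.

Lemma idgerm_neq0 : idgerm != 0.
Proof.
apply/eqP; rewrite -(raddf0 (@germ_of R)) => /germ_of_eq[n /(_ n _ (leqnn n) (dxX_part n))].
move=> /= e; have := rdivX n 1; rewrite mul1r e.
have -> : iter n (rdiv dv) 0 = 0 by elim: n {e} => //= n ->; rewrite raddf0.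
by move=> /esym/eqP; rewrite oner_eq0.
Qed.

(** The endomorphism algebra of O. It depends on the division because the
    latter shows that x^n is never zero, hence that the algebra is nonzero. *)
Definition endgerm of division B r : Type := germ R.
Local Notation T := (endgerm dv).
HB.instance Definition _ := GRing.Zmodule.on T.

HB.instance Definition _ := GRing.Zmodule_isNzRing.Build T (@gactA R) gact1l
  (@gact1 R) (@gactDl R) (@gactDr R) idgerm_neq0.

Lemma gscaleA a b (u : T) : gscale a (gscale b u) = gscale (a * b) u.
Proof.
rewrite -[u]repK !gscaleE; apply/germ_of_eq/evtT => d v _ /=.
by rewrite scalerA.
Qed.

Lemma gscale1 : left_id 1 (gscale : k -> T -> T).
Proof.
move=> u; rewrite -[u]repK gscaleE; apply/germ_of_eq/evtT => d v _ /=.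
by rewrite scale1r.
Qed.

Lemma gscaleDr : right_distributive (gscale : k -> T -> T) +%R.
Proof.
move=> a u v; rewrite -[u]repK -[v]repK -raddfD !gscaleE -raddfD.
by apply/germ_of_eq/evtT => d w _ /=; rewrite !fctE scalerDr.
Qed.

Lemma gscaleDl (u : T) : {morph (gscale^~ u : k -> T) : a b / a + b}.
Proof.
move=> a b; rewrite -[u]repK !gscaleE -raddfD.
by apply/germ_of_eq/evtT => d w _ /=; rewrite !fctE scalerDl.
Qed.

HB.instance Definition _ := GRing.Zmodule_isLmodule.Build k T
  gscaleA gscale1 gscaleDr gscaleDl.

Lemma gscalerAl (a : k) (u v : T) : a *: (u * v) = (a *: u) * v.
Proof.
rewrite -[u]repK -[v]repK /GRing.scale /GRing.mul /= gactE !gscaleE gactE.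
by apply/germ_of_eq/evtT.
Qed.
HB.instance Definition _ := GRing.Lmodule_isLalgebra.Build k T gscalerAl.

Lemma gscalerAr (a : k) (u v : T) : a *: (u * v) = u * (a *: v).
Proof.
rewrite -[u]repK -[v]repK /GRing.scale /GRing.mul /= gactE !gscaleE gactE.
apply/germ_of_eq; have [n hn] := pgP (rep u); have [m hm] := pgP (rep v).
exists (maxn n m) => d w; rewrite geq_max => /andP[/hn[_ _ h] /hm[_ h' _]] wd /=.
have := h 0%N a%:A (rep v d w) (gpart_alg _ a) (h' _ wd).
by rewrite add0n -scalerAl mul1r => ->; rewrite /GRing.scale /= -scalerAl mul1r.
Qed.
HB.instance Definition _ := GRing.Lalgebra_isAlgebra.Build k T gscalerAr.
End Ring.
End Germs.

(** * Extending linear maps from r + 1 consecutive degrees *)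

Section Recursion.
Context (k : fieldType) (B : gralg k) (r : nat) (dv : division B r).
Local Notation x := (dx dv).
Local Notation y := (dy dv).
Local Notation D := (ldiv dv).

(** B_d is the direct sum of the y^i x B_(d-i-1), so that left linearity
    expresses the values in degree d through those in the r + 1 preceding
    degrees. *)
Definition recursive_from (M : grmod B) n (phi : nat -> B -> M) : Prop :=
  forall d u, (n <= d)%N -> gpart d u ->
    phi d u = \sum_(i < r.+1) (y ^+ i * x) *: phi (d - i.+1)%N (D i u).

Definition graded_at (M : grmod B) (phi : nat -> B -> M) d : Prop :=
  [/\ forall u v, gpart d u -> gpart d v -> phi d (u + v) = phi d u + phi d v,
      forall u, gpart d u -> gr d%:Z (phi d u)
    & forall (a : k) u, gpart d u -> phi d (a *: u) = a%:A *: phi d u].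

Lemma ldiv_sub_part d i u : (r < d)%N -> (i <= r)%N -> gpart d u ->
  gpart (d - i.+1) (D i u).
Proof. by move=> rd ir ud; apply: ldiv_part => //; rewrite subnKC //; lia. Qed.

Lemma yx_part i : gpart i.+1 (y ^+ i * x).
Proof.
rewrite -addn1; apply: gpart_mul (dx_part _).
elim: i => [|i IH]; first exact: gpart_one.
by rewrite exprS -add1n; apply/gpart_mul/IH/dy_part.
Qed.

Lemma ldiv_x i u : (i <= r)%N -> D i (x * u) = if i == 0%N then u else 0.
Proof.
by move=> ir; have := @ldivK _ _ _ dv 0 i u isT ir; rewrite mul1r eq_sym.
Qed.

(** Multiplication by y carries the summand y^i x B to the next one and kills
    the last one, because y^(r+1) = 0. *)
Lemma ldiv_y d i u : (r < d)%N -> (i <= r)%N -> gpart d u ->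
  D i (y * u) = if i is i'.+1 then D i' u else 0.
Proof.
move=> rd ir ud; rewrite {1}(ldiv_sum dv rd ud) mulr_sumr raddf_sum /=.
transitivity (\sum_(j < r.+1) if (j.+1 == i)%N then D j u else 0).
  apply: eq_bigr => j _; rewrite !mulrA -exprS.
  have [jr|] := boolP (j < r)%N; first by rewrite ldivK.
  have := leq_ord j; case: ltngtP => // jr _ _.
  by rewrite jr dy_nil !mul0r raddf0; case: eqP => // h; lia.
case: i ir => [|i] ir; first by rewrite big1.
rewrite (bigD1 (Ordinal (ltnW ir : i < r.+1)%N)) //= eqxx big1 ?addr0 // => j.
by rewrite -val_eqE /= eqSS => /negPf ->.
Qed.

Lemma linear_recursive (M : grmod B) n (phi : nat -> B -> M) :
  linear_from n phi -> recursive_from (n + r.+1) phi.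
Proof.
move=> h d u nd ud; have rd : (r < d)%N by lia.
rewrite {1}(ldiv_sum dv rd ud) (linear_from_sum _ h).
- apply: eq_bigr => i _; have ir := leq_ord i.
  have [_ _ hM] := h (d - i.+1)%N ltac:(lia).
  have := hM _ _ _ (yx_part i) (ldiv_sub_part rd ir ud).
  by rewrite subnKC //; lia.
- by lia.
move=> i; rewrite -[d](@subnKC i.+1); last by have := leq_ord i; lia.
exact/gpart_mul/(ldiv_sub_part rd (leq_ord i))/ud/yx_part.
Qed.

Lemma graded_linear (M : grmod B) n (phi : nat -> B -> M) :
  (forall d, (n <= d)%N -> graded_at phi d) ->
  (forall d u, (n <= d)%N -> gpart d u -> phi d.+1 (x * u) = x *: phi d u) ->
  (forall d u, (n <= d)%N -> gpart d u -> phi d.+1 (y * u) = y *: phi d u) ->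
  linear_from n phi.
Proof.
move=> hg hx hy d nd; have [hD hgr hZ] := hg d nd; split=> // j c u cj ud.
elim: j c cj => [|j IH] c cj.
  have [a ->] := part0_scalar dv cj.
  by rewrite -scalerAl mul1r hZ.
have [v [w [vj wj ->]]] := partS_split dv cj.
have njd : (n <= j + d)%N by lia.
have [hD' _ _] := hg (j + d).+1 ltac:(lia).
rewrite addSn mulrDl hD' -?mulrA; try by rewrite -add1n; apply: gpart_mul;
  [exact: dx_part || exact: dy_part|apply: gpart_mul].
rewrite hx ?hy ?IH //; try exact: gpart_mul.
by rewrite !scalerA -scalerDl.
Qed.

(** The recursion conversely implies left linearity. Multiplication by x meets
    the summand i = 0 only; multiplication by y shifts the summands in the same
    way before and after applying the family, and the summand that drops out is
    killed on both sides. *)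
Lemma recursive_linear (M : grmod B) n (phi : nat -> B -> M) : (r < n)%N ->
  (forall d, (n - r.+1 <= d < n)%N -> graded_at phi d) ->
  recursive_from n phi -> linear_from n phi.
Proof.
move=> rn h0 rec.
have hg d : (n - r.+1 <= d)%N -> graded_at phi d.
  elim/ltn_ind: d => d IH nd; have [dn|nd'] := ltnP d n; first by apply: h0; rewrite nd.
  have rd : (r < d)%N by lia.
  have sub (i : 'I_r.+1) : graded_at phi (d - i.+1).
    by apply: IH; have := leq_ord i; lia.
  split=> [u v ud vd|u ud|a u ud]; rewrite ?rec //; try by [exact: gpartD|exact: gpartZ].
  - rewrite -big_split; apply: eq_bigr => i _ /=; have [hD _ _] := sub i.
    by rewrite raddfD hD ?scalerDr //; apply: ldiv_sub_part => //; apply: leq_ord.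
  - apply: big_ind => [||i _]; [exact: gr_zero|by move=> *; apply: gr_add|].
    have -> : d%:Z = (i.+1)%:Z + (d - i.+1)%N%:Z by have := leq_ord i; lia.
    apply: gr_act; first exact: yx_part.
    by have [_ hgr _] := sub i; apply/hgr/ldiv_sub_part/ud => //; apply: leq_ord.
  - rewrite scaler_sumr; apply: eq_bigr => i _ /=; have [_ _ hZ] := sub i.
    rewrite linearZ /= hZ; last by apply: ldiv_sub_part => //; apply: leq_ord.
    by rewrite !scalerA -scalerAl mul1r -scalerAr mulr1.
have h0z d : (n - r.+1 <= d)%N -> phi d 0 = 0.
  move=> /hg[_ _ /(_ 0 0 (gpart_zero _ _))].
  by rewrite scaler0 !scale0r.
apply: graded_linear => [d nd|d u nd ud|d u nd ud]; first by apply: hg; lia.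
- rewrite rec; [|lia|by rewrite -add1n; apply/gpart_mul/ud/dx_part].
  rewrite big_ord_recl /= ldiv_x // subn1 /= mul1r big1 ?addr0 // => i _.
  by rewrite ldiv_x ?lift0 //= h0z ?scaler0 // /bump; have := ltn_ord i; lia.
- rewrite rec; [|lia|by rewrite -add1n; apply/gpart_mul/ud/dy_part].
  have rd : (r < d)%N by lia.
  rewrite (rec d) // scaler_sumr big_ord_recl /= big_ord_recr /=.
  rewrite (ldiv_y rd) // h0z ?scaler0 ?add0r; last lia.
  rewrite scalerA mulrA -exprS dy_nil mul0r scale0r addr0.
  apply: eq_bigr => i _; rewrite scalerA mulrA -exprS (ldiv_y rd) //.
Qed.

Section Extension.
Context (M : grmod B) (n : nat) (phi : nat -> B -> M).

(** The argument N bounds the depth of the recursion on the degree. *)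
Fixpoint ext_fuel (N d : nat) (u : B) : M :=
  if N is N'.+1 then
    if (d < n)%N then phi d u
    else \sum_(i < r.+1) (y ^+ i * x) *: ext_fuel N' (d - i.+1) (D i u)
  else 0.

Definition ext d u : M := ext_fuel d.+1 d u.

Lemma ext_init d u : (d < n)%N -> ext d u = phi d u.
Proof. by rewrite /ext /= => ->. Qed.

Hypothesis rn : (r < n)%N.

Lemma ext_fuelE N N' d u : (d < N)%N -> (d < N')%N -> ext_fuel N d u = ext_fuel N' d u.
Proof.
elim: N N' d u => // N IH [|N'] // d u dN dN'; rewrite /=; case: ltnP => // nd.
by apply: eq_bigr => i _; congr (_ *: _); apply: IH; lia.
Qed.

Lemma ext_recursive : recursive_from n ext.
Proof.
move=> d u nd ud; rewrite {1}/ext /= ltnNge nd /=; apply: eq_bigr => i _.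
by congr (_ *: _); apply: ext_fuelE; lia.
Qed.

(** Maps given in r + 1 consecutive degrees, and only linear over k, extend to
    a germ: no relation has to be respected. This yields the structure of
    End(O) as well as the projectivity of O. *)
Lemma ext_linear : (forall d, (n - r.+1 <= d < n)%N -> graded_at phi d) ->
  linear_from n ext.
Proof.
move=> h; apply: recursive_linear ext_recursive => // d /andP[nd dn].
have [h1 h2 h3] := h d ltac:(lia).
by split=> [u v ud vd|u ud|a u ud]; rewrite !ext_init; auto.
Qed.
End Extension.

(** For equality, this says that r + 1 consecutive degrees determine a germ;
    for the graph of a morphism of the quotient category, it propagates a lift
    from these degrees to all higher ones. *)
Lemma recursive_rel (M N : grmod B) (Q : M -> N -> Prop) n
    (phi : nat -> B -> M) (psi : nat -> B -> N) : (r < n)%N ->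
  Q 0 0 -> (forall (b : B) u u' v v', Q u v -> Q u' v' -> Q (b *: u + u') (b *: v + v')) ->
  recursive_from n phi -> recursive_from n psi ->
  (forall d u, (n - r.+1 <= d < n)%N -> gpart d u -> Q (phi d u) (psi d u)) ->
  forall d u, (n - r.+1 <= d)%N -> gpart d u -> Q (phi d u) (psi d u).
Proof.
move=> rn Q0 QD rphi rpsi h; elim/ltn_ind => d IH u nd ud.
have [dn|nd'] := ltnP d n; first by apply: h; rewrite ?nd.
rewrite rphi // rpsi //; elim: (index_enum _) => [|i l IHl]; first by rewrite !big_nil.
rewrite !big_cons; apply: QD IHl; apply: IH; try by have := leq_ord i; lia.
by apply: ldiv_sub_part => //; [lia|apply: leq_ord].
Qed.

End Recursion.

(** * The direct limit of matrix algebras as an algebra of germs *)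

Section Bases.
Context (k : fieldType) (B : gralg k).

Definition comb p (beta : 'rV[B]_p) (c : 'cV[k]_p) : B :=
  (beta *m map_mx (in_alg B) c) 0 0.

Lemma combE p (beta : 'rV[B]_p) c : comb beta c = \sum_j c j 0 *: beta 0 j.
Proof.
rewrite /comb mxE; apply: eq_bigr => j _.
by rewrite mxE /= -scalerAr mulr1.
Qed.

Lemma comb_is_linear p (beta : 'rV[B]_p) : linear (comb beta).
Proof.
move=> a c d; rewrite !combE scaler_sumr -big_split; apply: eq_bigr => j _ /=.
by rewrite !mxE scalerDl scalerA.
Qed.
HB.instance Definition _ p (beta : 'rV[B]_p) :=
  GRing.isLinear.Build k 'cV[k]_p B *:%R (comb beta) (comb_is_linear beta).

Definition is_basis p n (beta : 'rV[B]_p) : Prop :=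
  [/\ forall c, gpart n (comb beta c),
      forall u, gpart n u -> exists c, u = comb beta c
    & forall c, comb beta c = 0 -> c = 0].

Lemma has_dim_basis p n : has_dim (@gpart k B n) p -> exists beta : 'rV[B]_p, is_basis n beta.
Proof.
move=> [e [en espan efree]]; exists (\row_j e j); split=> [c|u /espan[c ->]|c].
- rewrite combE; apply: big_ind => [||j _]; [exact: gpart_zero|exact: gpartD|].
  by rewrite mxE; apply: gpartZ.
- exists (\col_j c j); rewrite combE; apply: eq_bigr => j _.
  by rewrite !mxE.
- rewrite combE => h; apply/colP => j; rewrite mxE.
  apply: (efree (fun j => c j 0)); rewrite -[RHS]h; apply: eq_bigr => l _.
  by rewrite mxE.
Qed.

Lemma basis_part p n (beta : 'rV[B]_p) j : is_basis n beta -> gpart n (beta 0 j).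
Proof.
move=> [hb _ _]; have := hb (delta_mx j 0).
rewrite combE (bigD1 j) //= mxE !eqxx scale1r big1 ?addr0 //.
by move=> l /negPf lj; rewrite mxE lj scale0r.
Qed.

Lemma basis_inj p n (beta : 'rV[B]_p) : is_basis n beta -> injective (comb beta).
Proof.
move=> [_ _ h] c d e; apply/eqP; rewrite -subr_eq0; apply/eqP/h.
by rewrite raddfB /= e subrr.
Qed.

Lemma basis_matrix p q n (beta : 'rV[B]_p) (gamma : 'rV[B]_q) (f : B -> B) :
  is_basis n beta -> is_basis n gamma ->
  (forall (a : k) u v, gpart n u -> gpart n v -> f (a *: u + v) = a *: f u + f v) ->
  (forall u, gpart n u -> gpart n (f u)) ->
  exists G : 'M[k]_(q, p), forall c, comb gamma (G *m c) = f (comb beta c).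
Proof.
move=> [bn _ _] [_ gspan _] flin fn.
have [col colE] := choice (fun j => gspan _ (fn _ (bn (delta_mx j 0)))).
exists (\matrix_(l, j) col j l 0) => c.
have f0 : f 0 = 0.
  have := flin (-1) 0 0 (gpart_zero _ _) (gpart_zero _ _).
  by rewrite scaler0 addr0 scaleN1r addNr.
rewrite [in RHS](_ : c = \sum_j c j 0 *: delta_mx j 0); last first.
  rewrite {1}[c]matrix_sum_delta; apply: eq_bigr => j _.
  by rewrite big_ord_recl big_ord0 addr0.
have -> : (\matrix_(l, j) col j l 0) *m c = \sum_j c j 0 *: col j.
  apply/colP => l; rewrite mxE summxE; apply: eq_bigr => j _.
  by rewrite !mxE mulrC.
have [] : f (comb beta (\sum_j c j 0 *: delta_mx j 0)) = comb gamma (\sum_j c j 0 *: col j) /\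
          gpart n (comb beta (\sum_j c j 0 *: delta_mx j 0)); last by [].
elim: (index_enum _) => [|j s [IH1 IH2]].
  by rewrite !big_nil !raddf0 f0; split=> //; apply: gpart_zero.
rewrite !big_cons !linearP /= flin // IH1 -colE; split=> //.
exact: gpart_lin.
Qed.

(** The matrices of the two changes of basis are mutually inverse. *)
Lemma basis_size p q n (beta : 'rV[B]_p) (gamma : 'rV[B]_q) :
  is_basis n beta -> is_basis n gamma -> p = q.
Proof.
move=> hb hg.
have le p' q' (b' : 'rV[B]_p') (g' : 'rV[B]_q') :
    is_basis n b' -> is_basis n g' -> (p' <= q')%N.
  move=> hb' hg'.
  have [G hG] := @basis_matrix _ _ n b' g' id hb' hg' (fun _ _ _ _ _ => erefl) (fun _ h => h).
  have [H hH] := @basis_matrix _ _ n g' b' id hg' hb' (fun _ _ _ _ _ => erefl) (fun _ h => h).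
  apply: (@mulmx1_min _ _ _ H G); apply/matrixP => i j.
  have e : H *m G *m delta_mx j 0 = delta_mx j 0 :> 'cV_p'.
    by apply: (basis_inj hb'); rewrite -mulmxA hH hG.
  have := congr1 (fun c : 'cV_p' => c i 0) e.
  by rewrite -matrix.colE !mxE eqxx andbT => ->.
by apply/eqP; rewrite eqn_leq (le _ _ _ _ hb hg) (le _ _ _ _ hg hb).
Qed.

Definition coords p (beta : 'rV[B]_p) (u : B) : 'cV[k]_p :=
  if pselect (exists c, u = comb beta c) is left e then sval (cid e) else 0.

Lemma coordsK p n (beta : 'rV[B]_p) u : is_basis n beta -> gpart n u ->
  comb beta (coords beta u) = u.
Proof.
move=> [_ h _] /h e; rewrite /coords; case: pselect => // e'.
by case: cid => c /= ->.
Qed.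

Lemma combK p n (beta : 'rV[B]_p) c : is_basis n beta -> coords beta (comb beta c) = c.
Proof.
by move=> hb; apply: (basis_inj hb); rewrite (coordsK hb) //; case: hb.
Qed.

Definition basis_map (M : grmod B) p (beta : 'rV[B]_p) (v : 'I_p -> M) (u : B) : M :=
  \sum_j (coords beta u j 0)%:A *: v j.

Lemma basis_mapE (M : grmod B) p n (beta : 'rV[B]_p) (v : 'I_p -> M) c :
  is_basis n beta -> basis_map beta v (comb beta c) = \sum_j (c j 0)%:A *: v j.
Proof. by move=> hb; rewrite /basis_map (combK _ hb). Qed.

Lemma basis_map_graded (M : grmod B) p n (beta : 'rV[B]_p) (v : 'I_p -> M) :
  is_basis n beta -> (forall j, gr n%:Z (v j)) -> graded_at (fun=> basis_map beta v) n.
Proof.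
move=> hb hv; have [_ hspan _] := hb; split=> [u w un wn|u un|a u un].
- have [[c ->] [c' ->]] := (hspan _ un, hspan _ wn).
  rewrite -raddfD /= !(basis_mapE _ _ hb) -big_split; apply: eq_bigr => j _ /=.
  by rewrite mxE !scalerDl.
- apply: big_ind => [||j _]; [exact: gr_zero|by move=> *; apply: gr_add|].
  by rewrite -[n%:Z]add0r; apply: gr_act => //; apply: gpart_alg.
- have [c ->] := hspan _ un; rewrite -linearZ /= !(basis_mapE _ _ hb).
  rewrite scaler_sumr; apply: eq_bigr => j _.
  by rewrite mxE scalerA -scalerAl mul1r scalerA.
Qed.

Definition mxact p (beta : 'rV[B]_p) (G : 'M[k]_p) (u : B) : B :=
  comb beta (G *m coords beta u).

Section Action.
Context (p n : nat) (beta : 'rV[B]_p) (hb : is_basis n beta).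

Lemma mxact_comb G c : mxact beta G (comb beta c) = comb beta (G *m c).
Proof. by rewrite /mxact (combK _ hb). Qed.

Lemma mxact_part G u : gpart n (mxact beta G u).
Proof. by have [h _ _] := hb; apply: h. Qed.

Lemma mxact_linear G a u v : gpart n u -> gpart n v ->
  mxact beta G (a *: u + v) = a *: mxact beta G u + mxact beta G v.
Proof.
have [_ h _] := hb => /h[c ->] /h[d ->].
by rewrite -linearP !mxact_comb mulmxDr -scalemxAr linearP.
Qed.

Lemma mxactD a G H u : mxact beta (a *: G + H) u = a *: mxact beta G u + mxact beta H u.
Proof. by rewrite /mxact mulmxDl -scalemxAl linearP. Qed.

Lemma mxactM G H u : mxact beta (G *m H) u = mxact beta G (mxact beta H u).
Proof. by rewrite {3}/mxact mxact_comb mulmxA. Qed.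

Lemma mxact1 u : gpart n u -> mxact beta 1%:M u = u.
Proof. by move=> un; rewrite /mxact mul1mx (coordsK hb). Qed.

Lemma mxact_inj G H : (forall u, gpart n u -> mxact beta G u = mxact beta H u) -> G = H.
Proof.
move=> e; apply/matrixP => i j.
have : G *m delta_mx j 0 = H *m delta_mx j 0 :> 'cV_p.
  by have [h _ _] := hb; apply: (basis_inj hb); rewrite -!mxact_comb e.
by rewrite -!matrix.colE => /matrixP/(_ i 0); rewrite !mxE.
Qed.

Lemma mxact_surj (f : B -> B) :
  (forall (a : k) u v, gpart n u -> gpart n v -> f (a *: u + v) = a *: f u + f v) ->
  (forall u, gpart n u -> gpart n (f u)) ->
  exists G, forall u, gpart n u -> mxact beta G u = f u.
Proof.
move=> fl fn; have [G hG] := basis_matrix hb hb fl fn; exists G => u un.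
by rewrite -{1}(coordsK hb un) mxact_comb hG (coordsK hb un).
Qed.
End Action.
End Bases.

Section Recursive.
Context (k : fieldType) (B : gralg k) (r : nat) (dv : division B r).
Local Notation x := (dx dv).
Local Notation y := (dy dv).
Local Notation D := (ldiv dv).
Context (b : nat -> nat) (b_dim : forall n, has_dim (@gpart k B n) (b n)).

(** The basis of B_n obtained from the decomposition into the y^i x B_(n-i-1);
    in this basis, y^i x w |-> y^i x g_i(w) has a block diagonal matrix. *)
Definition glue (beta : forall m, 'rV[B]_(b m)) n :
    'rV[B]_(\sum_(i < r.+1) b (n - i - 1)) :=
  \mxrow_(i < r.+1) ((y ^+ i * x)%:M *m beta (n - i - 1)%N).

Lemma glue_comb beta n (c : forall i : 'I_r.+1, 'cV[k]_(b (n - i - 1))) :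
  comb (glue beta n) (\mxcol_i c i) =
  \sum_(i < r.+1) y ^+ i * x * comb (beta (n - i - 1)%N) (c i).
Proof.
rewrite /comb /glue.
have -> : map_mx (in_alg B) (\mxcol_i c i) = \mxcol_i map_mx (in_alg B) (c i).
  by apply/mxcolP => i; rewrite mxcolK -[in RHS](mxcolK c i); apply/colP => j; rewrite !mxE.
rewrite mul_mxrow_mxcol summxE; apply: eq_bigr => i _.
by rewrite -mulmxA mul_scalar_mx mxE.
Qed.

Lemma glue_basis beta n : (r < n)%N -> (forall m, (m < n)%N -> is_basis m (beta m)) ->
  is_basis n (glue beta n).
Proof.
move=> rn hb.
have hbi (i : 'I_r.+1) : is_basis (n - i.+1) (beta (n - i - 1)%N).
  by rewrite (_ : n - i.+1 = n - i - 1)%N; [apply: hb; lia|lia].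
split=> [c|u un|c].
- rewrite -[c]submxcolK glue_comb; apply: big_ind => [||i _].
  + exact: gpart_zero.
  + exact: gpartD.
  have [h _ _] := hbi i; have := gpart_mul (yx_part dv i) (h (submxcol c i)).
  by rewrite subnKC //; have := leq_ord i; lia.
- exists (\mxcol_i coords (beta (n - i - 1)%N) (D i u)).
  rewrite glue_comb {1}(ldiv_sum dv rn un); apply: eq_bigr => i _.
  by rewrite (coordsK (hbi i)) //; apply: ldiv_sub_part => //; apply: leq_ord.
- rewrite -[c]submxcolK glue_comb => e; apply/mxcolP => j.
  rewrite !submxcol0; case: (hbi j) => _ _; apply.
  have := congr1 (D j) e; rewrite raddf0 raddf_sum (bigD1 j) //= ldivK ?leq_ord //.
  rewrite eqxx mxcolK big1 ?addr0 // => i ij; rewrite ldivK ?leq_ord //.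
  by rewrite -val_eqE /= in ij; rewrite (negPf ij).
Qed.

Lemma dim_recursion n : (r < n)%N -> (b n = \sum_(i < r.+1) b (n - i - 1))%N.
Proof.
move=> rn; pose e m := sval (cid (has_dim_basis (b_dim m))).
have he m : is_basis m (e m) := svalP (cid (has_dim_basis (b_dim m))).
exact: basis_size (he n) (glue_basis rn (fun m _ => he m)).
Qed.

Lemma conform_basis p q n (beta : 'rV[B]_p) : q = p -> is_basis n beta ->
  is_basis n (conform_mx (0 : 'rV[B]_q) beta).
Proof. by move=> qp; rewrite qp conform_mx_id. Qed.

Lemma mxact_conform p q (gamma : 'rV[B]_q) (beta : 'rV[B]_p) (G : 'M[k]_p) u : q = p ->
  gamma = conform_mx 0 beta -> mxact gamma (conform_mx 0 G) u = mxact beta G u.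
Proof. by move=> e ->; subst q; rewrite !conform_mx_id. Qed.

(** The bases are chosen by recursion on the degree. For arbitrary bases, the
    maps of the direct system would agree with the extension of linear maps to
    the next degree only up to conjugation. *)
Lemma adapted_bases : exists beta : forall n, 'rV[B]_(b n),
  (forall n, is_basis n (beta n)) /\
  forall n, (r < n)%N -> beta n = conform_mx 0 (glue beta n).
Proof.
pose e m := sval (cid (has_dim_basis (b_dim m))).
have he m : is_basis m (e m) := svalP (cid (has_dim_basis (b_dim m))).
(* The argument N bounds the recursion; the basis in degree n only involves
   lower degrees, hence does not depend on N once N > n. *)
pose bas := fix bas (N : nat) : forall n, 'rV[B]_(b n) := if N is N'.+1 then
  fun n => if (n <= r)%N then e n else conform_mx 0 (glue (bas N') n) else fun=> 0.
have basE N N' n : (n < N)%N -> (n < N')%N -> bas N n = bas N' n.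
  elim: N N' n => // N IH [|N'] // n nN nN' /=; case: leqP => // rn.
  congr conform_mx; apply: eq_mxrow => i; congr (_ *m _).
  by apply: IH; lia.
have rec n : (r < n)%N -> bas n.+1 n = conform_mx 0 (glue (fun m => bas m.+1 m) n).
  move=> rn; rewrite [LHS]/= leqNgt rn /=; congr conform_mx.
  apply: eq_mxrow => i; congr (_ *m _).
  by apply: (basE n (n - i - 1).+1 (n - i - 1)%N); lia.
exists (fun n => bas n.+1 n); split=> //.
elim/ltn_ind => n IH; have [nr|rn] := leqP n r; first by rewrite /= nr.
rewrite rec //; apply: conform_basis; first exact: dim_recursion.
exact: glue_basis.
Qed.
End Recursive.

Section Cocone.
Context (k : fieldType) (B : gralg k) (r : nat) (dv : division B r).
Local Notation D := (ldiv dv).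
Local Notation T := (endgerm dv).
Local Notation R := (regular_left B).
Context (b : nat -> nat) (b_dim : forall n, has_dim (@gpart k B n) (b n)).
Context (beta : forall n, 'rV[B]_(b n)) (beta_basis : forall n, is_basis n (beta n)).
Hypothesis beta_glue : forall n, (r < n)%N -> beta n = conform_mx 0 (glue dv beta n).
Local Notation Sn := (Sn k r b).

(** An element of S_n is a list of endomorphisms of B_(n-1), ..., B_(n-r-1).
    The sum selects the one in degree d, without transporting matrices along an
    equality of degrees. *)
Definition blockact n (g : Sn n) (d : nat) (u : B) : R :=
  \sum_(i < r.+1 | (n - i - 1 == d)%N) mxact (beta (n - i - 1)) (g i) u.

Lemma blockactE n (g : Sn n) (i : 'I_r.+1) u : (r < n)%N ->
  blockact g (n - i - 1) u = mxact (beta (n - i - 1)) (g i) u.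
Proof.
move=> rn; rewrite /blockact (bigD1 i) //= big1 ?addr0 // => j /andP[/eqP e].
by rewrite -val_eqE /=; have := leq_ord i; have := leq_ord j; lia.
Qed.

Lemma level_index n d : (r < n)%N -> (n - r.+1 <= d < n)%N ->
  exists i : 'I_r.+1, d = (n - i - 1)%N.
Proof.
move=> rn nd; have ir : (n - d - 1 < r.+1)%N by lia.
by exists (Ordinal ir) => /=; lia.
Qed.

Lemma blockact_graded n (g : Sn n) : (r < n)%N ->
  forall d, (n - r.+1 <= d < n)%N -> graded_at (blockact g) d.
Proof.
move=> rn d /(level_index rn)[i ->]; have hb := beta_basis (n - i - 1).
split=> [u v ud vd|u ud|a u ud]; rewrite !blockactE //.
- by have := mxact_linear hb (g i) 1 ud vd; rewrite !scale1r.
- exact: (mxact_part hb).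
- have := mxact_linear hb (g i) a ud (gpart_zero _ _); rewrite addr0 => ->.
  have := mxact_linear hb (g i) (-1) (gpart_zero _ _) (gpart_zero _ (n - i - 1)%N).
  rewrite scaler0 addr0 scaleN1r addNr => ->.
  by rewrite addr0 /GRing.scale /= -scalerAl mul1r.
Qed.

Definition block_ext n (g : Sn n) : nat -> B -> R := ext dv n (blockact g).

Lemma block_ext_linear n (g : Sn n) : (r < n)%N -> linear_from n (block_ext g).
Proof. by move=> rn; apply: ext_linear => //; apply: blockact_graded. Qed.

Lemma block_ext_init n (g : Sn n) (i : 'I_r.+1) u : (r < n)%N ->
  block_ext g (n - i - 1) u = mxact (beta (n - i - 1)) (g i) u.
Proof. by move=> rn; rewrite /block_ext ext_init ?blockactE //; lia. Qed.

Definition germ_fun (f : nat -> B -> R) : T := oapp (@germ_of k B R) 0 (insub f).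

Lemma germ_funE n f (h : linear_from n f) : germ_fun f = germ_of (mkpg (ex_intro _ n h)).
Proof.
rewrite /germ_fun; case: insubP => [f' _ e|/negP[]]; last exact/asboolT/ex_intro/h.
by apply/germ_of_eq/evtT => d u _ /=; rewrite -e.
Qed.

Lemma germ_fun_eq n f m g : linear_from n f -> linear_from m g ->
  germ_fun f = germ_fun g <-> evt (fun d u => f d u = g d u).
Proof. by move=> h h'; rewrite !(germ_funE h, germ_funE h') germ_of_eq. Qed.

(** The morphism from S_n to End(O): the r + 1 endomorphisms are extended to
    all higher degrees. *)
Definition cocone n (g : Sn n) : T := germ_fun (block_ext g).

Lemma block_ext_unique n (g : Sn n) (f : nat -> B -> R) : (r < n)%N -> recursive_from dv n f ->
  (forall (i : 'I_r.+1) u, gpart (n - i - 1) u ->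
     f (n - i - 1)%N u = mxact (beta (n - i - 1)) (g i) u) ->
  forall d u, (n - r.+1 <= d)%N -> gpart d u -> f d u = block_ext g d u.
Proof.
move=> rn frec fi; apply: (recursive_rel rn _ _ frec (ext_recursive dv _ rn)) => //.
  by move=> c u u' v v' -> ->.
move=> d u nd ud; have [i e] := level_index rn nd.
by subst d; rewrite fi // -(block_ext_init g i).
Qed.

Lemma block_ext_rec n (g : Sn n) : (r < n)%N -> recursive_from dv n (block_ext g).
Proof. exact: ext_recursive. Qed.

Lemma block_ext_part n (g : Sn n) d u : (r < n)%N -> (n - r.+1 <= d)%N -> gpart d u ->
  gpart d (block_ext g d u).
Proof.
move=> rn nd ud; have [dn|dn] := leqP n d.
  by have [_ h _] := block_ext_linear g rn dn; apply: h.
have [|i e] := @level_index n d rn; first by rewrite nd dn.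
by subst d; rewrite block_ext_init //; apply: (mxact_part (beta_basis _)).
Qed.

Lemma ldiv_recursive n (f : nat -> B -> R) d u (j : 'I_r.+1) : recursive_from dv n f ->
  (n <= d)%N -> gpart d u -> D j (f d u) = f (d - j.+1)%N (D j u).
Proof.
move=> frec nd ud; rewrite frec // raddf_sum (bigD1 j) //= ldivK ?leq_ord // eqxx.
rewrite big1 ?addr0 // => i ij; rewrite ldivK ?leq_ord //.
by rewrite -val_eqE /= in ij; rewrite (negPf ij).
Qed.

Lemma cocone_lin n (a : k) (g h : Sn n) : (r < n)%N ->
  cocone (fun i => a *: g i + h i) = a *: cocone g + cocone h.
Proof.
move=> rn; have [lg lh] := (block_ext_linear g rn, block_ext_linear h rn).
rewrite /cocone (germ_funE lg) (germ_funE lh) {2}/GRing.scale /= gscaleE -raddfD.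
rewrite (germ_funE (block_ext_linear _ rn)); apply/germ_of_eq.
exists n => d u nd ud /=; rewrite !fctE /=; apply/esym.
apply: (@block_ext_unique n _
  (fun d u => (a *: (block_ext g d u : B) : R) + block_ext h d u)) => //; last lia.
- move=> e v ne ev; rewrite (block_ext_rec g) // (block_ext_rec h) //.
  rewrite scaler_sumr -big_split; apply: eq_bigr => i _ /=.
  by rewrite scalerDr; congr (_ + _); rewrite scalerAr.
- by move=> i v _; rewrite !block_ext_init // mxactD.
Qed.

Lemma cocone_mul n (g h : Sn n) : (r < n)%N ->
  cocone (fun i => g i *m h i) = cocone g * cocone h.
Proof.
move=> rn; have [lg lh] := (block_ext_linear g rn, block_ext_linear h rn).
rewrite /cocone (germ_funE lg) (germ_funE lh) -[RHS]/(gact _ _) gactE.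
rewrite (germ_funE (block_ext_linear _ rn)); apply/germ_of_eq.
exists n => d u nd ud /=; apply/esym.
apply: (@block_ext_unique n _ (fun d u => block_ext g d (block_ext h d u))) => //; last lia.
- move=> e v ne ev; rewrite (block_ext_rec g) //; last by apply: block_ext_part => //; lia.
  apply: eq_bigr => i _; congr (_ *: block_ext g _ _).
  exact: ldiv_recursive (block_ext_rec h rn) ne ev.
- by move=> i v _; rewrite !block_ext_init // (mxactM (beta_basis _)).
Qed.

Lemma cocone_one n : (r < n)%N -> @cocone n (fun i => 1%:M) = 1.
Proof.
move=> rn; rewrite /cocone (germ_funE (block_ext_linear _ rn)); apply/germ_of_eq.
exists n => d u nd ud /=; apply/esym.
apply: (@block_ext_unique n _ (fun d u => u)) => //; last lia.
- move=> e v ne ev; have re : (r < e)%N by exact: leq_trans ne.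
  exact: (ldiv_sum dv re ev).
- by move=> i v vi; rewrite (mxact1 (beta_basis _)).
Qed.

(** The maps of the direct system move the window of r + 1 degrees up by one.
    In the new degree n the extension is given by the block diagonal matrix, by
    the choice of bases; the lowest degree is forgotten. *)
Lemma block_ext_phi n (g : Sn n) d u : (r < n)%N -> (n - r <= d)%N -> gpart d u ->
  block_ext g d u = block_ext (phi g) d u.
Proof.
move=> rn nd; apply: block_ext_unique => //.
- exact: ltnW.
- by move=> e v ne ve; exact: (block_ext_rec g rn (ltnW ne) ve).
- move=> i v; rewrite /phi; case: eqP => [->|/eqP i0].
    have e : (n.+1 - @ord0 r - 1 = n)%N by rewrite subn0 subn1.
    move: (_ - _ - 1)%N e => _ -> vn.
    rewrite (mxact_conform (beta := glue dv beta n)) //; first last.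
    - exact: beta_glue.
    - exact: (dim_recursion dv b_dim rn).
    rewrite (block_ext_rec g) //.
    pose c i := coords (beta (n - i - 1)%N) (D i v).
    have ev : v = comb (glue dv beta n) (\mxcol_i c i).
      rewrite glue_comb {1}(ldiv_sum dv rn vn); apply: eq_bigr => j _.
      rewrite (coordsK (beta_basis _)) // -subnDA addn1.
      by apply: ldiv_sub_part => //; apply: leq_ord.
    rewrite [in RHS]ev (mxact_comb (n := n)); last exact: glue_basis.
    rewrite mul_mxdiag_mxcol glue_comb; apply: eq_bigr => j _.
    have -> : (n - j.+1 = n - j - 1)%N by lia.
    by rewrite block_ext_init.
  have ij : (@inord r i.-1 : nat) = i.-1 by rewrite inordK //; have := ltn_ord i; lia.
  have e : (n.+1 - i - 1 = n - @inord r i.-1 - 1)%N.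
    by rewrite ij; move: i0; rewrite -val_eqE /= => i0; lia.
  move: (_ - _ - 1)%N e => _ ->.
  by rewrite conform_mx_id block_ext_init.
Qed.

Lemma cocone_phi n (g : Sn n) : (r < n)%N -> cocone (phi g) = cocone g.
Proof.
move=> rn.
apply/(germ_fun_eq (block_ext_linear (phi g) (ltnW rn : (r < n.+1)%N)) (block_ext_linear g rn)).
by exists n => d u nd ud; apply/esym/block_ext_phi => //; lia.
Qed.

(** A germ that is linear from degree m on is determined by its matrices in the
    degrees m, ..., m + r. *)
Lemma cocone_surj (p : T) : exists n (g : Sn n), (r < n)%N /\ p = cocone g.
Proof.
elim/germ_ind: p => t; have [m hm] := pgP t.
pose n := (m + r.+1)%N; have rn : (r < n)%N by rewrite /n; lia.
have tlin d (a : k) u v : (m <= d)%N -> gpart d u -> gpart d v ->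
    (t d (a *: u + v) : B) = a *: (t d u : B) + t d v.
  move=> md ud vd; have [hD _ hM] := hm d md; rewrite hD //; last exact: gpartZ.
  by rewrite (linear_fromZ _ hm) // /GRing.scale /= -scalerAl mul1r.
have md (i : 'I_r.+1) : (m <= n - i - 1)%N by rewrite /n; have := leq_ord i; lia.
have mat (i : 'I_r.+1) : exists G, forall u, gpart (n - i - 1) u ->
    mxact (beta (n - i - 1)) G u = t (n - i - 1)%N u.
  apply: (mxact_surj (beta_basis (n - i - 1)) (f := t (n - i - 1)%N))
    => [a u v|u ud]; first exact: tlin.
  by have [_ h _] := hm _ (md i); apply: h.
exists n, (fun i => sval (cid (mat i))); split=> //.
rewrite /cocone (germ_funE (block_ext_linear _ rn)); apply/germ_of_eq.
exists n => d u nd ud; apply: (@block_ext_unique n _ t) => //.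
- exact: linear_recursive.
- by move=> i v vi; rewrite (svalP (cid (mat i))).
- lia.
Qed.

(** The second clause holds for all cocones at once, so that the same element
    also represents the original one in any other limit. *)
Lemma cocone_push n (g : Sn n) N : (r < n)%N -> (n <= N)%N -> exists gN : Sn N,
  (forall d u, (N - r.+1 <= d)%N -> gpart d u -> block_ext g d u = block_ext gN d u) /\
  (forall (S : algType k) (f : forall n, Sn n -> S), is_cocone f -> f N gN = f n g).
Proof.
move=> rn /subnK <-; elim: (N - n)%N => [|m [gm [h1 h2]]]; first by exists g.
exists (phi gm); split=> [d u nd ud|S f hf].
  by rewrite h1 //; [apply: block_ext_phi => //|]; lia.
have [_ ->] := hf (m + n)%N ltac:(lia).
exact: h2.
Qed.

(** If the two germs agree from degree m on, then at a level whose window lies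
    above m they have the same matrices. *)
Lemma cocone_inj n (g : Sn n) n' (g' : Sn n') (S : algType k) (f : forall n, Sn n -> S) :
  is_cocone f -> (r < n)%N -> (r < n')%N -> cocone g = cocone g' -> f n g = f n' g'.
Proof.
move=> hf rn rn' /(germ_fun_eq (block_ext_linear g rn) (block_ext_linear g' rn'))[m hm].
pose N := (n + n' + m + r.+1)%N.
have [gN [h1 h2]] := @cocone_push n g N rn ltac:(lia).
have [gN' [h1' h2']] := @cocone_push n' g' N rn' ltac:(lia).
rewrite -(h2 S f hf) -(h2' S f hf); congr (f N _).
apply: functional_extensionality_dep => i; apply: (mxact_inj (beta_basis _)) => u ui.
have rN : (r < N)%N by lia.
rewrite -!block_ext_init //.
have iN := leq_ord i; rewrite -h1 // -?h1' //; try lia.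
by apply: hm ui; lia.
Qed.
Lemma cocone_is_cocone : is_cocone cocone.
Proof.
move=> n rn; split; last by move=> g; apply: cocone_phi.
split=> [a g h|g h|]; [exact: cocone_lin|exact: cocone_mul|exact: cocone_one].
Qed.

Section Limit.
Context (S : algType k) (iota : forall n, Sn n -> S).

(** That iota is a cocone is an argument, so that multiplicativity can be
    attached to the map. *)
Definition limit_inv of is_cocone iota := fun p : T =>
  let: exist n w := cid (cocone_surj p) in iota (sval (cid w)).

Hypothesis iota_cocone : is_cocone iota.
Local Notation inv := (limit_inv iota_cocone).

Lemma limit_invE n (g : Sn n) : (r < n)%N -> inv (cocone g) = iota g.
Proof.
move=> rn; rewrite /limit_inv; case: cid => m w; case: cid => g' /= [rm e].
exact/esym/cocone_inj.
Qed.

Lemma common_level (p q : T) : exists n (g h : Sn n),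
  [/\ (r < n)%N, p = cocone g & q = cocone h].
Proof.
have [n [g [rn ->]]] := cocone_surj p; have [m [h [rm ->]]] := cocone_surj q.
have [g' [_ hg]] := @cocone_push n g (n + m) rn (leq_addr _ _).
have [h' [_ hh]] := @cocone_push m h (n + m) rm (leq_addl _ _).
exists (n + m)%N, g', h'; split; first exact: ltn_addr.
- by rewrite (hg _ _ cocone_is_cocone).
- by rewrite (hh _ _ cocone_is_cocone).
Qed.

Lemma limit_inv_linear : linear inv.
Proof.
move=> a p q; have [n [g [h [rn -> ->]]]] := common_level p q.
have [[iD _ _] _] := iota_cocone rn.
apply: etrans (congr1 inv (esym (cocone_lin a g h rn))) _.
apply: etrans (limit_invE _ rn) (etrans (iD a g h) _).
exact: (esym (congr2 (fun s t => a *: s + t) (limit_invE g rn) (limit_invE h rn))).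
Qed.
HB.instance Definition _ := GRing.isLinear.Build k T S *:%R inv limit_inv_linear.

Lemma limit_inv_monoid : monoid_morphism inv.
Proof.
split=> [|p q].
  have [[_ _ i1] _] := iota_cocone (ltnSn r).
  by rewrite -(@cocone_one r.+1) // limit_invE.
have [n [g [h [rn -> ->]]]] := common_level p q.
have [[_ iM _] _] := iota_cocone rn.
apply: etrans (congr1 inv (esym (cocone_mul g h rn))) _.
apply: etrans (limit_invE _ rn) (etrans (iM g h) _).
exact: (esym (congr2 *%R (limit_invE g rn) (limit_invE h rn))).
Qed.
HB.instance Definition _ :=
  GRing.isMonoidMorphism.Build T S inv limit_inv_monoid.
End Limit.

(** The morphism from S exists by universality, and its candidate inverse sends
    a germ to iota of any of its representatives. One composite is the identity
    by the uniqueness in the universal property, the other because the germs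
    all come from some S_n. *)
Lemma limit_iso (S : algType k) (iota : forall n, Sn n -> S) :
  is_direct_limit iota ->
  exists (h : {lrmorphism S -> T}) (h' : {lrmorphism T -> S}), cancel h h' /\ cancel h' h.
Proof.
move=> [hi univ]; have [h [hE _]] := univ T cocone cocone_is_cocone.
exists h, (limit_inv hi : {lrmorphism T -> S}); split=> [s|p].
  have [e [_ eU]] := univ S iota hi.
  pose h'h : {lrmorphism S -> S} := limit_inv hi \o h.
  rewrite -[RHS]/((idfun : {lrmorphism S -> S}) s) (eU idfun) // -(eU h'h) //.
  by move=> n rn g; rewrite /h'h /= hE // limit_invE.
have [n [g [rn ->]]] := cocone_surj p.
by apply: etrans (congr1 h (limit_invE hi g rn)) _; apply: hE.
Qed.
End Cocone.

(** * Lifting germs along morphisms of the quotient category *)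

Section Lifting.
Context (k : fieldType) (B : gralg k) (r : nat) (dv : division B r).
Context (b : nat -> nat) (b_dim : forall n, has_dim (@gpart k B n) (b n)).

(** In a large degree N the space B_N is spanned by finitely many elements, so
    that one exponent m serves for all of them; the degrees above m + N follow
    from B_d = B_(d-N) B_N. *)
Lemma evt_torsion (M : grmod B) (phi : pregerm M) (A : M -> Prop) : is_grsub A ->
  evt (fun d u => exists m, forall e c, (m <= e)%N -> gpart e c -> A (c *: phi d u)) ->
  evt (fun d u => A (phi d u)).
Proof.
move=> hA [n hn]; have [n' hn'] := pgP phi; pose N := maxn n n'.
have [_ _ hM] := hn' N (leq_maxr _ _).
have [s [sN sspan]] := @gpart_fin _ B N.
have [m hm] : exists m, forall w, w \in s -> forall e c, (m <= e)%N -> gpart e c ->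
    A (c *: phi N w).
  apply: (torsion_unif (F := phi N)) => w ws; apply: hn; first exact: leq_maxl.
  exact: sN.
exists (m + N)%N => d u md; rewrite -(subnK (leq_trans (leq_addl m N) md)) => ud.
have [t [tP ->]] := gpart_gen ud.
have lin := linear_fromW (leq_maxr n n') hn'.
have -> : \sum_(p <- t) p.1 * p.2 = \sum_(i < size t) (t`_i).1 * (t`_i).2.
  by rewrite (big_nth 0) big_mkord.
have tP' (i : 'I_(size t)) := tP _ (mem_nth 0 (ltn_ord i)).
rewrite (linear_from_sum _ lin); first last.
- by move=> i; have [p1 p2] := tP' i; apply: gpart_mul.
- exact: leq_addl.
apply: (grsub_sum hA) => i _; have [p1 p2] := tP' i; rewrite hM //.
have [c ->] := sspan _ p2; have sd (j : 'I_(size s)) : gpart N s`_j by apply/sN/mem_nth.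
rewrite (linear_from_sum _ lin) // ?scaler_sumr; last by move=> j; apply: gpartZ.
apply: (grsub_sum hA) => j _; rewrite (linear_fromZ _ lin) // scalerA.
rewrite -scalerAr mulr1; apply: (hm s`_j _ (d - N)%N).
- exact: mem_nth.
- by rewrite leq_subRL ?(leq_trans _ md) ?leq_addl // addnC.
- exact: gpartZ.
Qed.

Section Morphism.
Context (M N : grmod B) (f : qhom M N).

(** The germ of psi is then the composite of f with the germ of phi, where f is
    only given as a correspondence. *)
Definition lift_rel (phi : nat -> B -> M) (psi : nat -> B -> N) : Prop :=
  evt (fun d u => qrel f (phi d u) (psi d u)).

Lemma evt_qdom (phi : pregerm M) : evt (fun d u => qdom f (phi d u)).
Proof.
apply: (evt_torsion (qdom_sub f)); apply: evtT => d u _.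
exact: (@qdom_torsion _ _ _ _ f (phi d u) I).
Qed.

(** In large degrees the values of phi lie in the domain of f. Related values
    are chosen on bases of r + 1 consecutive degrees and extended by the
    recursion; as the extension exists for arbitrary choices, no obstruction
    arises. *)
Lemma lift_exists (phi : pregerm M) : exists psi : pregerm N, lift_rel phi psi.
Proof.
have [beta beta_basis] : exists beta : forall n, 'rV[B]_(b n), forall n, is_basis n (beta n).
  by have [beta [? _]] := adapted_bases dv b_dim; exists beta.
have [m hm] := evt_qdom phi; have [m' hm'] := pgP phi.
pose n := (maxn m m' + r.+1)%N.
have val d (j : 'I_(b d)) : exists v, (maxn m m' <= d)%N ->
    gr d%:Z v /\ qrel f (phi d (beta d 0 j)) v.
  have [nd|nd] := leqP (maxn m m') d; last by exists 0.
  have bd := basis_part j (beta_basis d).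
  have [v fv] : qdom f (phi d (beta d 0 j)).
    by apply: hm => //; apply: leq_trans nd; rewrite leq_maxl.
  exists (gcomp d%:Z v) => _; split; first exact: gcomp_gr.
  have := qrel_comp d%:Z fv; rewrite (gcomp_hom _ (j := d%:Z)) ?eqxx //.
  by have [_ h _] := hm' d ltac:(lia); apply: h.
pose v d j := sval (cid (val d j)).
pose psi0 d := basis_map (beta d) (v d).
have psi0_graded d : (n - r.+1 <= d < n)%N -> graded_at psi0 d.
  move=> nd; apply: (basis_map_graded (beta_basis d)) => j.
  by have [] := svalP (cid (val d j)) ltac:(rewrite /n in nd; lia).
have rn : (r < n)%N by rewrite /n; lia.
exists (mkpg (ex_intro _ n (ext_linear dv rn psi0_graded))).
exists (n - r.+1)%N; apply: (recursive_rel (dv := dv) (n := n) rn (qrel0 f)) => //.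
- by move=> *; apply: qrel_lin.
- apply: linear_recursive; apply: linear_fromW hm'; exact: leq_maxr.
- exact: ext_recursive.
move=> d u nd ud; have [_ hspan _] := beta_basis d.
have nd' : (maxn m m' <= d)%N by rewrite /n in nd; lia.
rewrite /= ext_init; last by case/andP: nd.
have [c ->] := hspan _ ud; rewrite /psi0 (basis_mapE _ _ (beta_basis d)) combE.
have lin : linear_from d phi by apply: linear_fromW hm'; lia.
have bd j := basis_part j (beta_basis d).
rewrite (linear_from_sum _ lin) //; last by move=> j; apply: gpartZ.
elim: (index_enum _) => [|j l IH]; first by rewrite !big_nil; apply: qrel0.
rewrite !big_cons (linear_fromZ _ lin) //; apply: qrel_lin IH.
by have [] := svalP (cid (val d j)) nd'.
Qed.
End Morphism.

(** Two lifts differ by a germ with torsion values, which vanishes because B is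
    generated by finitely many elements in each large degree. *)
Lemma lift_unique (M N : grmod B) (f g : qhom M N) (phi phi' : nat -> B -> M)
    (psi psi' : pregerm N) : qeq f g -> evt (fun d u => phi d u = phi' d u) ->
  lift_rel f phi psi -> lift_rel g phi' psi' -> germ_of psi = germ_of psi'.
Proof.
move=> /qeqP fg e h h'; apply/eqP; rewrite -subr_eq0 -raddfB /= -(raddf0 (@germ_of k B N)).
apply/eqP/germ_of_eq; apply: (evt_torsion (@grsub_zero _ _ N)).
apply: evt2 h' (evt2 _ e h); last by move=> d u _ E; rewrite E; apply: id.
by move=> d u _ gv fv; apply: fg fv gv.
Qed.
End Lifting.

(** * The section functor *)

Section Sections.
Context (k : fieldType) (B : gralg k) (r : nat) (dv : division B r).
Context (b : nat -> nat) (b_dim : forall n, has_dim (@gpart k B n) (b n)).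
Local Notation T := (endgerm dv).
Local Notation R := (regular_left B).
Context (S : algType k) (h : {lrmorphism S -> T}).

(** Hom(O, M) as a right module over S, by means of the identification h of S
    with End(O). *)
Definition gsec of {lrmorphism S -> T} := fun M : grmod B => germ M.
Local Notation F M := (gsec h M).

HB.instance Definition _ M := GRing.Zmodule.on (F M).

Definition secact M (s : S^c) (p : F M) : F M := gact p (h s).

Lemma secactA M (s t : S^c) (p : F M) : secact s (secact t p) = secact (s * t) p.
Proof. by rewrite /secact -gactA; congr gact; rewrite -[RHS]/(h ((t : S) * s)) rmorphM. Qed.

Lemma secact1 M : left_id 1 (@secact M).
Proof. by move=> p; rewrite /secact rmorph1; apply: gact1. Qed.

Lemma secactDr M : right_distributive (@secact M) +%R.
Proof. by move=> s p q; apply: gactDl. Qed.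

Lemma secactDl M (p : F M) : {morph (@secact M)^~ p : s t / s + t}.
Proof. by move=> s t; rewrite /secact rmorphD; apply: gactDr. Qed.

HB.instance Definition _ M := GRing.Zmodule_isLmodule.Build S^c (F M)
  (@secactA M) (@secact1 M) (@secactDr M) (@secactDl M).

Section Map.
Context (M N : grmod B) (f : qhom M N).

Definition secmap (p : F M) : F N :=
  germ_of (sval (cid (lift_exists dv b_dim f (rep p)))).

Lemma secmapE (phi : pregerm M) (psi : pregerm N) : lift_rel f phi psi ->
  secmap (germ_of phi) = germ_of psi.
Proof.
apply: (lift_unique (qeq_refl f) (rep_germ_of phi)).
exact: svalP (cid (lift_exists dv b_dim f (rep (germ_of phi)))).
Qed.

Lemma secmap_lift (phi : pregerm M) :
  exists2 psi : pregerm N, lift_rel f phi psi & secmap (germ_of phi) = germ_of psi.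
Proof.
by have [psi hpsi] := lift_exists dv b_dim f phi; exists psi; rewrite ?(secmapE hpsi).
Qed.

Lemma secmap_is_linear : linear secmap.
Proof.
move=> s p q; rewrite -[p]repK -[q]repK.
have [psi hp ->] := secmap_lift (rep p); have [psi' hq ->] := secmap_lift (rep q).
have hE (M' : grmod B) (w : pregerm M') :
    s *: (germ_of w : F M') = germ_of (pgcomp w (rep (h s))).
  by rewrite -gactE repK.
rewrite !hE -!raddfD; apply: secmapE.
apply: evt2 (evt_pg (rep (h s)) hp) hq => d u _ /= e e'; rewrite !fctE.
by have := qrel_lin 1 e e'; rewrite !scale1r.
Qed.
HB.instance Definition _ := GRing.isLinear.Build S^c (F M) (F N) *:%R secmap secmap_is_linear.

End Map.

Definition sections : functor (QGr B) (ModR S).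
Proof.
apply: (@Functor (QGr B) (ModR S) (fun M => F M : lmodType S^c)
  (fun M N f => secmap f : {linear _ -> _})).
- move=> M N f g fg p /=; rewrite -[p]repK.
  have [psi hf ->] := secmap_lift f (rep p); have [psi' hg ->] := secmap_lift g (rep p).
  by apply: (lift_unique fg _ hf hg); apply: evtT.
- by move=> M p /=; rewrite -[p]repK; apply/secmapE/evtT.
- move=> M N P g f p /=; rewrite -[p]repK.
  have [psi hf ->] := secmap_lift f (rep p); have [psi' hg ->] := secmap_lift g psi.
  by apply: secmapE; apply: evt2 hf hg => d u _ e e'; exists (psi d u).
Defined.

Lemma sections_OO (h' : T -> S) : cancel h h' -> cancel h' h ->
  isomorphic (sections (OO B)) (regular_right S).
Proof.
move=> hK h'K.
pose to (p : F R) : (S^c)^o := h' p.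
pose from (s : (S^c)^o) : F R := h s.
have from_lin : linear from.
  by move=> s p q; rewrite /from -[s *: p]/((p : S) * s) rmorphD rmorphM.
have to_lin : linear to.
  move=> s p q; apply: (can_inj hK); apply: etrans (h'K _) _.
  have := from_lin s (h' p) (h' q); rewrite /from (h'K p) (h'K q).
  exact: esym.
pose toL : {linear F R -> (S^c)^o} := HB.pack to (GRing.isLinear.Build _ _ _ _ to to_lin).
pose fromL : {linear (S^c)^o -> F R} :=
  HB.pack from (GRing.isLinear.Build _ _ _ _ from from_lin).
exists toL, fromL; split=> [p|s] /=; first exact: h'K.
exact: hK.
Qed.
End Sections.

(** * Germs attached to homogeneous elements *)

Section Points.
Context (k : fieldType) (B : gralg k) (r : nat) (dv : division B r).
Local Notation T := (endgerm dv).
Local Notation R := (regular_left B).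
Local Notation x := (dx dv).
Local Notation rd := (rdiv dv).

Lemma iter_rdiv0 n : iter n rd 0 = 0.
Proof. by elim: n => //= n ->; rewrite raddf0. Qed.

Lemma iter_rdivD n u v : iter n rd (u + v) = iter n rd u + iter n rd v.
Proof. by elim: n => //= n ->; rewrite raddfD. Qed.

Lemma iter_rdivZ n (a : k) u : iter n rd (a *: u) = a *: iter n rd u.
Proof. by elim: n => //= n ->; rewrite linearZ. Qed.

Lemma iter_rdiv_sum n (I : Type) (l : seq I) (F : I -> B) :
  iter n rd (\sum_(i <- l) F i) = \sum_(i <- l) iter n rd (F i).
Proof.
by elim: l => [|i l IH]; rewrite ?big_nil ?iter_rdiv0 // !big_cons iter_rdivD IH.
Qed.

Lemma iter_rdiv_part n d u : gpart (n + d) u -> gpart d (iter n rd u).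
Proof.
elim: n d => // n IH d; rewrite addSnnS => /IH; exact: rdiv_part.
Qed.

Lemma iter_rdivM n d c u : (n <= d)%N -> gpart d u ->
  iter n rd (c * u) = c * iter n rd u.
Proof.
elim: n => // n IH nd ud; rewrite !iterS IH ?(ltnW nd) //.
apply: (@rdivM _ _ _ _ (d - n.+1)%N).
by apply: iter_rdiv_part; rewrite (_ : n + _ = d)%N //; lia.
Qed.

Section Point.
Context (M : grmod B).

Lemma point_linear n (m : M) :
  linear_from n (fun d u => iter n rd u *: gcomp n%:Z m).
Proof.
move=> d nd; split=> [u v ud vd|u ud|j c u cj ud].
- by rewrite iter_rdivD scalerDl.
- have -> : d%:Z = (d - n)%N%:Z + n%:Z by lia.
  apply: gr_act (gcomp_gr _ _); apply: iter_rdiv_part.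
  by rewrite subnKC.
- by rewrite (iter_rdivM _ nd ud) scalerA.
Qed.
Definition pointpg n m : pregerm M := mkpg (ex_intro _ n (@point_linear n m)).
(** B x^n is a direct summand of B_(>=n), isomorphic to B(-n), and the n-th
    power of the right division is the projection onto it. The germ is this
    projection followed by the morphism B(-n) -> M that sends the generator to
    the component of m in degree n. *)
Definition point n m : germ M := germ_of (pointpg n m).

Lemma point_is_zmod_morphism n : zmod_morphism (point n).
Proof.
move=> m m'; rewrite /point -raddfB; apply/germ_of_eq/evtT => d u _ /=.
by rewrite raddfB scalerBr.
Qed.
HB.instance Definition _ n :=
  GRing.isZmodMorphism.Build M (germ M) (point n) (point_is_zmod_morphism n).

Lemma point_eq n m m' : gcomp n%:Z m = gcomp n%:Z m' -> point n m = point n m'.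
Proof. by move=> e; apply/germ_of_eq/evtT => d u _ /=; rewrite e. Qed.

End Point.

Lemma regular_part_gr n (c : B) : gpart n c -> @gr _ _ R n%:Z c. Proof. by []. Qed.

Lemma regular_scale (a : B) (c : R) : a *: c = (a * (c : B) : B). Proof. by []. Qed.

Definition shift n (c : B) : germ R := point (M := R) n c.

(** Dividing by x^n on the right undoes the right factor x^n. *)
Lemma point_shift (M : grmod B) n j (m : M) (c : B) : gpart j c ->
  gact (point n m) (shift (n + j) (c * x ^+ n)) = point (n + j) (c *: m).
Proof.
move=> cj; rewrite /point /shift /point gactE; apply/germ_of_eq.
have cx : gpart (n + j) (c * x ^+ n) by rewrite addnC; apply: gpart_mul (dxX_part _ _).
exists (n + j)%N => d u nd ud /=.
rewrite (gcomp_id (regular_part_gr cx)) regular_scale mulrA rdivX.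
have -> : (n + j)%N%:Z = j%:Z + n%:Z by rewrite addnC PoszD.
by rewrite (gcomp_act _ _ cj) scalerA.
Qed.

(** As phi is linear in degree n, the left factor of c can be taken out of it.
    *)
Lemma shift_germ (M : grmod B) n0 (phi : pregerm M) n (c : B) : linear_from n0 phi ->
  (n0 <= n)%N -> gpart n c ->
  gact (germ_of phi) (shift n c) = point n (phi n c).
Proof.
move=> lin nn cn; rewrite /shift /point gactE; apply/germ_of_eq.
exists n => d u nd ud /=; rewrite (gcomp_id (regular_part_gr cn)).
have [_ hgr hM] := lin n nn; rewrite (gcomp_id (hgr _ cn)).
have ed : d = (d - n + n)%N by lia.
have un : gpart (d - n) (iter n rd u) by apply: iter_rdiv_part; rewrite subnKC.
by rewrite {1}ed -(hM _ _ _ un cn).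
Qed.

Lemma point_shift_div (M : grmod B) d e (m : M) (c : B) : (d <= e)%N -> gpart e c ->
  gact (point d m) (shift e c) = point e (iter d rd c *: gcomp d%:Z m).
Proof. exact: (shift_germ (phi := pointpg d m) (@point_linear M d m)). Qed.

(** The division sends c x^n to c, so that c m = 0 for all c of large degree.
    *)
Lemma point_eq0 (M : grmod B) n (m : M) : point n m = 0 -> tors_elt (gcomp n%:Z m).
Proof.
rewrite -(raddf0 (@germ_of k B M)) => /germ_of_eq[n0 hn0].
exists n0 => d c nd cd.
have := hn0 (d + n)%N (c * x ^+ n) (leq_trans nd (leq_addr _ _)).
by rewrite /= rdivX; apply; apply: gpart_mul (dxX_part _ _).
Qed.

(** The idempotent of End(O) whose image is O(-n). *)
Definition vertex n : germ R := shift n (x ^+ n).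

Lemma point_vertex (M : grmod B) n (m : M) : gact (point n m) (vertex n) = point n m.
Proof.
have := point_shift n m (gpart_one B).
by rewrite addn0 mul1r scale1r.
Qed.

Lemma vertex0 : vertex 0 = 1 :> T.
Proof.
rewrite /vertex /shift /point; apply/germ_of_eq/evtT => d u _ /=.
by rewrite (gcomp_id (regular_part_gr (gpart_one B))) regular_scale mulr1.
Qed.
End Points.

(** * The graded module of a right module *)

Section Gamma.
Context (k : fieldType) (B : gralg k) (r : nat) (dv : division B r).
Local Notation T := (endgerm dv).
Local Notation R := (regular_left B).
Local Notation x := (dx dv).
Context (S : algType k) (h' : {lrmorphism T -> S}) (N : lmodType S^c).
Local Notation vertex := (vertex dv).
Local Notation shift := (shift dv).

Definition ract (v : N) (t : T) : N := (h' t : S^c) *: v.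

Lemma ractA v s t : ract (ract v s) t = ract v (s * t).
Proof. by rewrite /ract scalerA; congr (_ *: _); rewrite rmorphM. Qed.
Lemma ractDl u v t : ract (u + v) t = ract u t + ract v t.
Proof. exact: scalerDr. Qed.
Lemma ractDr v s t : ract v (s + t) = ract v s + ract v t.
Proof. by rewrite /ract rmorphD; apply: scalerDl. Qed.
Lemma ract1 v : ract v 1 = v.
Proof. by rewrite /ract rmorph1 scale1r. Qed.
Lemma ract0l t : ract 0 t = 0. Proof. exact: scaler0. Qed.
Lemma ract0r v : ract v 0 = 0. Proof. by rewrite /ract raddf0 scale0r. Qed.
Lemma ractBl u v t : ract (u - v) t = ract u t - ract v t.
Proof. exact: scalerBr. Qed.
Lemma ract_suml I (s : seq I) (F : I -> N) t :
  ract (\sum_(i <- s) F i) t = \sum_(i <- s) ract (F i) t.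
Proof. exact: scaler_sumr. Qed.

(** The direct sum over n of the N e_n, where e_n is the idempotent of End(O)
    with image O(-n); if N is Hom(O, M), then N e_n is Hom(O(-n), M). *)
Definition tseq : {pred nat -> N} := fun v =>
  `[< (exists K, forall n, (K <= n)%N -> v n = 0) /\ forall n, ract (v n) (vertex n) = v n >].

Lemma tseq_zmod_closed : zmod_closed tseq.
Proof.
split; first by apply/asboolP; split=> [|n]; [exists 0%N|rewrite ract0l].
move=> u v /asboolP[[K hK] hu] /asboolP[[L hL] hv]; apply/asboolP; split.
  exists (maxn K L) => n; rewrite geq_max => /andP[Kn Ln].
  by rewrite /= !fctE hK // hL // subr0.
by move=> n; rewrite /= !fctE ractBl hu hv.
Qed.
HB.instance Definition _ := GRing.isZmodClosed.Build (nat -> N) tseq tseq_zmod_closed.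

Record gamma := Gamma { gam :> nat -> N; _ : gam \in tseq }.
HB.instance Definition _ := [isSub for gam].
HB.instance Definition _ := [Choice of gamma by <:].
HB.instance Definition _ := [SubChoice_isSubZmodule of gamma by <:].

Lemma gamP (v : gamma) : (exists K, forall n, (K <= n)%N -> v n = 0) /\
  forall n, ract (v n) (vertex n) = v n.
Proof. by case: v => v /= /asboolP. Qed.

Definition mkgam v h : gamma := @Gamma v (asboolT h).

Lemma gamma_ext (u v : gamma) : (forall n, u n = v n) -> u = v.
Proof. by move=> e; apply/val_inj/funext. Qed.

Definition hpart (j : nat) (b : B) : B := gcomp j%:Z (b : R).

Lemma hpartD j b c : hpart j (b + c) = hpart j b + hpart j c.
Proof. exact: (raddfD (gcomp j%:Z : {additive R -> R})). Qed.

Lemma hpart_hom i j b : gpart j b -> hpart i b = if i == j then b else 0.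
Proof. by move=> bj; rewrite /hpart (gcomp_hom _ (regular_part_gr bj)) eqz_nat. Qed.

(** The part of b in degree n - m gives by right multiplication a morphism
    O(-n) -> O(-m), hence an element of End(O) that maps N e_m to N e_n. *)
Definition bact (b : B) (v : nat -> N) (n : nat) : N :=
  \sum_(m < n.+1) ract (v m) (shift n (hpart (n - m) b * x ^+ m)).

Lemma shiftD n b c : shift n (b + c) = shift n b + shift n c.
Proof. by rewrite /shift raddfD. Qed.
Lemma shift0 n : shift n 0 = 0.
Proof. by rewrite /shift raddf0. Qed.

Lemma bactDl b c v n : bact (b + c) v n = bact b v n + bact c v n.
Proof.
rewrite /bact -big_split; apply: eq_bigr => m _ /=.
by rewrite hpartD mulrDl shiftD ractDr.
Qed.

Lemma bactDr b u v n : bact b (fun m => u m + v m) n = bact b u n + bact b v n.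
Proof. by rewrite /bact -big_split; apply: eq_bigr => m _ /=; rewrite ractDl. Qed.

Lemma bact_hom j b v n : gpart j b ->
  bact b v n = if (j <= n)%N then ract (v (n - j)%N) (shift n (b * x ^+ (n - j))) else 0.
Proof.
move=> bj; rewrite /bact; case: ifP => jn.
  have mn : (n - j < n.+1)%N by lia.
  rewrite (bigD1 (Ordinal mn)) //= (hpart_hom _ bj) subKn // eqxx big1 ?addr0 // => m.
  rewrite -val_eqE /= (hpart_hom _ bj) => mj; case: eqP => [e|_].
    by have := ltn_ord m; lia.
  by rewrite mul0r shift0 ract0r.
rewrite big1 // => m _; rewrite (hpart_hom _ bj); case: eqP => [e|_].
  by have := ltn_ord m; lia.
by rewrite mul0r shift0 ract0r.
Qed.

Lemma bact0l v n : bact 0 v n = 0.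
Proof. by have := bactDl 0 0 v n; rewrite addr0 => /eqP; rewrite -subr_eq subrr => /eqP. Qed.

Lemma bact_tseq b (v : gamma) : (exists K, forall n, (K <= n)%N -> bact b v n = 0) /\
  forall n, ract (bact b v n) (vertex n) = bact b v n.
Proof.
have [[K hK] hv] := gamP v; split.
  elim/homogeneous_ind: b => [|b c [L hL] [L' hL']|j b bj].
  - by exists 0%N => n _; rewrite bact0l.
  - exists (maxn L L') => n; rewrite geq_max => /andP[Ln Ln'].
    by rewrite bactDl hL // hL' // addr0.
  - exists (K + j)%N => n Kn; rewrite (bact_hom _ _ bj) ifT; last lia.
    by rewrite hK ?ract0l //; lia.
move=> n; rewrite /bact ract_suml; apply: eq_bigr => m _.
by rewrite ractA; congr ract; apply: point_vertex.
Qed.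

Definition gamma_scale (b : B) (v : gamma) : gamma := mkgam (bact_tseq b v).

Lemma bact_id v n : ract (v n) (vertex n) = v n -> bact 1 v n = v n.
Proof.
by move=> e; rewrite (bact_hom _ _ (gpart_one B)) leq0n subn0 mul1r.
Qed.

(** Additivity reduces this to homogeneous b and c, where it is the composition
    rule for points. *)
Lemma bactA b c (v : gamma) n : bact b (bact c v) n = bact (b * c) v n.
Proof.
elim/homogeneous_ind: b => [|b b' e e'|i b bi].
- by rewrite mul0r !bact0l.
- by rewrite mulrDl !bactDl e e'.
elim/homogeneous_ind: c => [|c c' e e'|j c cj].
- rewrite mulr0 bact0l (_ : bact 0 v = fun=> 0); last by apply/funext => m; rewrite bact0l.
  by rewrite /bact big1 // => m _; rewrite ract0l.
- rewrite mulrDr bactDl -e -e' -bactDr; congr (bact b _ n).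
  by apply/funext => m; rewrite bactDl.
rewrite (bact_hom _ _ (gpart_mul bi cj)) (bact_hom _ _ bi).
case: ltnP => [ni|ni]; last rewrite (bact_hom _ _ cj).
  by rewrite ifF //; apply/negbTE; rewrite -ltnNge; lia.
have -> : (j <= n - i)%N = (i + j <= n)%N by lia.
case: ifP => ijn; last by rewrite ract0l.
have -> : (n - i - j)%N = (n - (i + j))%N by lia.
rewrite ractA; congr ract.
have := point_shift dv (M := R) (n - i)%N (c * x ^+ (n - (i + j))) bi.
by rewrite subnK // regular_scale mulrA.
Qed.

Lemma gamma_scaleA b c v : gamma_scale b (gamma_scale c v) = gamma_scale (b * c) v.
Proof. by apply: gamma_ext => n; apply: bactA. Qed.

Lemma gamma_scale1 : left_id 1 gamma_scale.
Proof. by move=> v; apply: gamma_ext => n; apply: bact_id; have [] := gamP v. Qed.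

Lemma gamma_scaleDr : right_distributive gamma_scale +%R.
Proof. by move=> b u v; apply: gamma_ext => n; apply: bactDr. Qed.

Lemma gamma_scaleDl v : {morph gamma_scale^~ v : b c / b + c}.
Proof. by move=> b c; apply: gamma_ext => n; apply: bactDl. Qed.

HB.instance Definition _ := GRing.Zmodule_isLmodule.Build B gamma
  gamma_scaleA gamma_scale1 gamma_scaleDr gamma_scaleDl.

Lemma gamD (u v : gamma) n : (u + v) n = u n + v n. Proof. by []. Qed.
Lemma gamB (u v : gamma) n : (u - v) n = u n - v n. Proof. by []. Qed.
Lemma gam0 n : (0 : gamma) n = 0. Proof. by []. Qed.
Lemma gamZ b (v : gamma) n : (b *: v) n = bact b v n. Proof. by []. Qed.
Lemma gam_sum I (s : seq I) (F : I -> gamma) n :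
  (\sum_(i <- s) F i) n = \sum_(i <- s) F i n.
Proof. by elim: s => [|i s IH]; rewrite ?big_nil // !big_cons gamD IH. Qed.

Definition gamgr (i : int) (v : gamma) : Prop := forall n, n%:Z != i -> v n = 0.

Lemma gamgr0 i : gamgr i 0. Proof. by []. Qed.
Lemma gamgrB i u v : gamgr i u -> gamgr i v -> gamgr i (u - v).
Proof. by move=> hu hv n ni; rewrite gamB hu // hv // subr0. Qed.

Lemma gamgr_act j i b v : gpart j b -> gamgr i v -> gamgr (j%:Z + i) (b *: v).
Proof.
move=> bj vi n ni; rewrite gamZ (bact_hom _ _ bj); case: ifP => // jn.
rewrite vi ?ract0l //; apply: contra ni => /eqP <-.
by rewrite -PoszD subnKC.
Qed.

Definition gamcomp_fun (i : int) (v : gamma) n : N := if n%:Z == i then v n else 0.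
Lemma gamcomp_subproof i v : (exists K, forall n, (K <= n)%N -> gamcomp_fun i v n = 0) /\
  forall n, ract (gamcomp_fun i v n) (vertex n) = gamcomp_fun i v n.
Proof.
have [[K hK] hv] := gamP v; split=> [|n]; rewrite /gamcomp_fun.
  by exists K => n Kn; rewrite hK // if_same.
by case: ifP => _; rewrite ?ract0l.
Qed.
Definition gamcomp i v : gamma := mkgam (gamcomp_subproof i v).

Lemma gamcompE i v n : gamcomp i v n = if n%:Z == i then v n else 0.
Proof. by []. Qed.

Lemma gamcomp_gr i v : gamgr i (gamcomp i v).
Proof. by move=> n /negPf ni; rewrite gamcompE ni. Qed.

Lemma gam_decomp (v : gamma) K : (forall n, (K <= n)%N -> v n = 0) ->
  v = \sum_(i <- [seq Posz n | n <- iota 0 K]) gamcomp i v.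
Proof.
move=> hK; apply: gamma_ext => n; rewrite gam_sum big_map; have [Kn|nK] := leqP K n.
  by rewrite hK // big1_seq // => m _; rewrite gamcompE hK // if_same.
rewrite (bigD1_seq n) ?mem_iota ?iota_uniq ?add0n // gamcompE eqxx big1 => [|m].
  exact/esym/addr0.
by rewrite gamcompE eqz_nat eq_sym => /negPf ->.
Qed.

Lemma iota_uniqZ K : uniq [seq Posz n | n <- iota 0 K].
Proof. by rewrite map_inj_uniq ?iota_uniq // => i j []. Qed.

Lemma gamgr_sum v : exists (s : seq int) (c : int -> gamma),
  [/\ uniq s, forall i, gamgr i (c i) & v = \sum_(i <- s) c i].
Proof.
have [[K /gam_decomp vK] _] := gamP v.
exists [seq Posz n | n <- iota 0 K], (fun i => gamcomp i v); split=> //.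
- exact: iota_uniqZ.
- by move=> i; apply: gamcomp_gr.
Qed.

Lemma gamgr_direct (s : seq int) (c : int -> gamma) :
  uniq s -> (forall i, gamgr i (c i)) -> \sum_(i <- s) c i = 0 ->
  forall i, i \in s -> c i = 0.
Proof.
move=> us hpart s0 i is_; apply: gamma_ext => n; rewrite gam0.
have [e|ni] := eqVneq n%:Z i; last by rewrite hpart.
have := congr1 (fun v : gamma => v n) s0; rewrite gam_sum gam0 (bigD1_seq i) //=.
by rewrite big1 ?addr0 // => j ji; apply: hpart; rewrite e eq_sym.
Qed.

Definition gamma_mod : grmod B := GrMod gamgr0 gamgrB gamgr_act gamgr_sum gamgr_direct.

Lemma gcomp_gamma i (v : gamma_mod) : gcomp i v = gamcomp i v :> gamma.
Proof.
apply: (gcompE (M := gamma_mod) (c := fun i => gamcomp i v)); split.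
  by move=> j; apply: gamcomp_gr.
have [[K hK] _] := gamP v.
exists [seq Posz n | n <- iota 0 K]; split; first exact: iota_uniqZ.
  move=> j jK; apply: gamma_ext => n; rewrite gamcompE; case: eqP => // e.
  rewrite hK //; rewrite leqNgt; apply: contra jK => nK.
  by apply/mapP; exists n; rewrite ?mem_iota.
exact: gam_decomp.
Qed.

Lemma gcomp_gammaE i (v : gamma_mod) n :
  (gcomp i v : gamma) n = if n%:Z == i then (v : gamma) n else 0.
Proof. by rewrite gcomp_gamma. Qed.
End Gamma.

(** * Recovering a graded module from its sections *)

Section Correspondence.
Context (k : fieldType) (B : gralg k) (M N : grmod B) (Q : M -> N -> Prop).
Hypothesis Q0 : Q 0 0.
Hypothesis Qlin : forall (b : B) u u' v v', Q u v -> Q u' v' -> Q (b *: u + u') (b *: v + v').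
Hypothesis Qcomp : forall i u v, Q u v -> Q (gcomp i u) (gcomp i v).
Hypothesis Qdom : torsion (fun _ => True) (fun u => exists v, Q u v).
Hypothesis Qcodom : torsion (fun _ => True) (fun v => exists u, Q u v).
Hypothesis Qker : forall u, Q u 0 -> tors_elt u.
Hypothesis Qind : forall v, Q 0 v -> tors_elt v.

Lemma Qdom_sub : is_grsub (fun u => exists v, Q u v).
Proof.
split; first by exists 0.
- by move=> b u u' [v h] [v' h']; exists (b *: v + v'); apply: Qlin.
- by move=> i u [v h]; exists (gcomp i v); apply: Qcomp.
Qed.

Lemma Qcodom_sub : is_grsub (fun v => exists u, Q u v).
Proof.
split; first by exists 0.
- by move=> b v v' [u h] [u' h']; exists (b *: u + u'); apply: Qlin.
- by move=> i v [u h]; exists (gcomp i u); apply: Qcomp.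
Qed.

Lemma Qind_sub : is_grsub (Q 0).
Proof.
split=> // [b v v' h h'|i v h]; first by have := Qlin b h h'; rewrite scaler0 addr0.
by have := Qcomp i h; rewrite raddf0.
Qed.

Lemma Qker_sub : is_grsub (Q^~ 0).
Proof.
split=> // [b v v' h h'|i v h]; first by have := Qlin b h h'; rewrite scaler0 addr0.
by have := Qcomp i h; rewrite raddf0.
Qed.

Lemma corr_dom : in_Fdim (fun _ => True) (fun u => exists v, Q u v).
Proof. by apply: torsion_in_Fdim => //; exact: Qdom_sub. Qed.
Lemma corr_codom : in_Fdim (fun _ => True) (fun v => exists u, Q u v).
Proof. by apply: torsion_in_Fdim => //; exact: Qcodom_sub. Qed.
Lemma corr_ind : in_Fdim (Q 0) (fun v => v = 0).
Proof.
by apply: torsion_in_Fdim; [exact: grsub_zero|exact: Qind_sub|move=> v ->|].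
Qed.
Lemma corr_ker : in_Fdim (Q^~ 0) (fun v => v = 0).
Proof.
by apply: torsion_in_Fdim; [exact: grsub_zero|exact: Qker_sub|move=> v ->|].
Qed.

(** A graded correspondence that, up to torsion, is everywhere defined, onto,
    injective and single-valued is an isomorphism of the quotient category,
    with its transpose as inverse. *)
Definition corr : qhom M N := QHom Q0 Qlin Qcomp corr_dom corr_ind.

Definition corr_inv : qhom N M :=
  @QHom _ _ N M (fun v u => Q u v) Q0 (fun b v v' u u' => @Qlin b u u' v v')
    (fun i v u => @Qcomp i u v) corr_codom corr_ker.

Lemma QB u u' v v' : Q u v -> Q u' v' -> Q (u - u') (v - v').
Proof. exact: (qrelB (f := corr)). Qed.

Lemma corrK : qeq (qcomp corr_inv corr) (qid M).
Proof.
apply/qeqP => u u1 u2 [v uv u1v] <-; apply: Qker.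
by rewrite -(subrr v); apply: QB.
Qed.

Lemma corr_invK : qeq (qcomp corr corr_inv) (qid N).
Proof.
apply/qeqP => v v1 v2 [u uv uv1] <-; apply: Qind.
by rewrite -(subrr u); apply: QB.
Qed.
End Correspondence.

Section GammaFunctor.
Context (k : fieldType) (B : gralg k) (r : nat) (dv : division B r).
Local Notation T := (endgerm dv).
Context (S : algType k) (h' : {lrmorphism T -> S}).
Local Notation G N := (gamma_mod h' N).

Section Map.
Context (N N' : lmodType S^c) (g : {linear N -> N'}).

Lemma ract_lin v t : g (ract h' v t) = ract h' (g v) t.
Proof. exact: linearZ. Qed.

Lemma gmap_subproof (v : G N) :
  (exists K, forall n, (K <= n)%N -> g (v n) = 0) /\
  forall n, ract h' (g (v n)) (vertex dv n) = g (v n).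
Proof.
have [[K hK] hv] := gamP v; split=> [|n]; last by rewrite -ract_lin hv.
by exists K => n Kn; rewrite hK // raddf0.
Qed.
Definition gmap_fun (v : G N) : G N' := mkgam (gmap_subproof v).

Lemma gmap_is_linear : linear gmap_fun.
Proof.
move=> b u v; apply: gamma_ext => n; rewrite [RHS]gamD gamZ.
apply: etrans (raddfD g (bact h' b u n) (v n)) _; congr (_ + _).
by rewrite /bact raddf_sum; apply: eq_bigr => m _; apply: ract_lin.
Qed.
HB.instance Definition _ := GRing.isLinear.Build B (G N) (G N') *:%R gmap_fun gmap_is_linear.

Lemma gmap_gr i u : gr i u -> gr i (gmap_fun u).
Proof. by move=> iu n ni; rewrite /= iu // raddf0. Qed.

Definition gmap : ghom (G N) (G N') := GHom gmap_gr.
End Map.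

Definition gammas : functor (ModR S) (QGr B).
Proof.
apply: (@Functor (ModR S) (QGr B) (fun N : lmodType S^c => G N : grmod B)
  (fun N N' g => graph (gmap g))).
- move=> N N' f g fg; apply: graph_congr => u.
  by apply: gamma_ext => n; apply: fg.
- move=> N; apply: qrel_qeq => u v /=; split=> [<-|<-]; apply: gamma_ext => n //.
- move=> N N' P g f; apply: qeq_trans (graph_cmp _ _); apply: graph_congr => u.
  exact: gamma_ext.
Defined.
End GammaFunctor.

Section Reconstruction.
Context (k : fieldType) (B : gralg k) (r : nat) (dv : division B r).
Local Notation T := (endgerm dv).
Local Notation x := (dx dv).
Context (b : nat -> nat) (b_dim : forall n, has_dim (@gpart k B n) (b n)).
Context (S : algType k) (h : {lrmorphism S -> T}) (h' : {lrmorphism T -> S}).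
Hypothesis h'K : cancel h' h.
Local Notation G N := (gamma_mod h' N).
Local Notation F M := (gsec h M : lmodType S^c).

Lemma ractE (M : grmod B) (p : F M) t : ract h' p t = gact p t.
Proof. by rewrite -[LHS]/(gact p (h (h' t))) h'K. Qed.

Section Unit.
Context (M : grmod B).

(** An element m of M_n, for n >= 0, gives the morphism O(-n) -> M that sends
    the generator to m. Negative degrees are left out, which changes M by a
    torsion quotient only. *)
Definition murel (v : G (F M)) (m : M) : Prop :=
  (forall n, (v : gamma h' (F M)) n = point dv n m) /\ forall i : int, i < 0 -> gcomp i m = 0.

Lemma murel0 : murel 0 0.
Proof. by split=> [n|i _]; rewrite raddf0. Qed.

Lemma murel_lin c v v' m m' : murel v m -> murel v' m' -> murel (c *: v + v') (c *: m + m').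
Proof.
move=> [h1 h2] [h1' h2'].
suff [H1 H2] : murel (c *: v) (c *: m).
  split=> [n|i i0]; first by rewrite gamD H1 h1' raddfD.
  by rewrite raddfD /= H2 // h2' // addr0.
elim/homogeneous_ind: c => [|c c' [e1 e2] [e1' e2']|j c cj].
- by rewrite !scale0r; apply: murel0.
- rewrite !scalerDl; split=> [n|i i0]; first by rewrite gamD e1 e1' raddfD.
  by rewrite raddfD /= e2 // e2' // addr0.
have hg i : gcomp i (c *: m) = c *: gcomp (i - j%:Z) m.
  by rewrite -(gcomp_act _ _ cj) addrC subrK.
split=> [n|i i0]; last by rewrite hg h2 ?scaler0 //; lia.
rewrite gamZ (bact_hom _ _ _ cj); case: leqP => jn.
  by rewrite ractE h1; have := point_shift dv (n - j) m cj; rewrite subnK.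
rewrite -(raddf0 (point dv (M := M) n)); apply: point_eq.
by rewrite raddf0 hg h2 ?scaler0 //; lia.
Qed.

Lemma murel_comp i v m : murel v m -> murel (gcomp i v) (gcomp i m).
Proof.
move=> [h1 h2]; split=> [n|j j0]; last first.
  by rewrite gcomp_comp; case: eqP => // e; rewrite -e h2.
rewrite gcomp_gammaE h1 eq_sym; case: eqVneq => [->|ni].
  by apply: point_eq; rewrite gcomp_comp eqxx.
rewrite -(raddf0 (point dv (M := M) n)); apply: point_eq.
by rewrite raddf0 gcomp_comp eq_sym (negPf ni).
Qed.

Lemma murel_ind m : murel 0 m -> tors_elt m.
Proof.
move=> [h1 h2]; have [s ->] := gcomp_sum m.
apply: (grsub_sum (@tors_elt_sub _ _ M)) => -[n|n] _.
  exact: point_eq0 (esym (h1 n)).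
by rewrite h2 //; apply: (grsub0 (@tors_elt_sub _ _ M)).
Qed.

Lemma murel_ker v : murel v 0 -> tors_elt v.
Proof.
move=> [h1 _]; have -> : v = 0 by apply: gamma_ext => n; rewrite h1 raddf0.
exact: (grsub0 (@tors_elt_sub _ _ _)).
Qed.

Lemma murel_codom : torsion (fun _ => True) (fun m => exists v, murel v m).
Proof.
move=> m _; have [d0 hd0] := gcomp_lower m; exists d0 => d c dd cd.
have [K hK] := gcomp_bound (c *: m).
have hv : (exists K, forall n, (K <= n)%N -> point dv n (c *: m) = 0 :> F M) /\
    forall n, ract h' (point dv n (c *: m) : F M) (vertex dv n) = point dv n (c *: m).
  split=> [|n]; last by rewrite ractE point_vertex.
  exists (absz K).+1 => n Kn; rewrite -(raddf0 (point dv (M := M) n)); apply: point_eq.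
  by rewrite raddf0 hK //; lia.
exists (mkgam hv); split=> // i i0.
rewrite -[i](subrK d%:Z) addrC (gcomp_act _ _ cd) hd0 ?scaler0 //; lia.
Qed.

(** If phi in Hom(O(-n), M) is represented by a family that is linear from
    degree d on, then b phi comes from the element phi(b x^n) of M as soon as b
    has degree at least d. *)
Lemma murel_dom : torsion (fun _ => True) (fun v => exists m, murel v m).
Proof.
have sub := Qdom_sub murel0 murel_lin murel_comp.
move=> v _; have [[K hK] _] := gamP v.
have [n0 hn0] : exists n0, forall i, i \in iota 0 K -> forall d c, (n0 <= d)%N -> gpart d c ->
    exists m, murel (c *: (gamcomp i%:Z v : G (F M))) m.
  apply: (torsion_unif (F := fun i : nat => gamcomp i%:Z v : G (F M))
    (A := fun v => exists m, murel v m)) => i _.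
  have [n0 lin] := pgP (rep ((v : gamma h' (F M)) i)).
  exists n0 => d c nd cd.
  have cx : gpart (i + d) (c * x ^+ i) by rewrite addnC; apply: gpart_mul cd (dxX_part _ _).
  have nid : (n0 <= i + d)%N by lia.
  have [_ hgr _] := lin _ nid; have mgr := hgr _ cx.
  exists (rep ((v : gamma h' (F M)) i) (i + d)%N (c * x ^+ i)).
  split=> [n|j j0]; last by rewrite (gcomp_hom _ mgr) ifF //; apply/negbTE; lia.
  rewrite gamZ (bact_hom _ _ _ cd).
  have [-> | ni] := eqVneq n (i + d)%N.
    rewrite leq_addl addnK /gamcomp /= /gamcomp_fun eqxx ractE -{1}[(v : gamma _ _) i]repK.
    exact: (shift_germ dv lin).
  transitivity (0 : F M).
    case: ifP => // dn; rewrite /= /gamcomp_fun ifF ?ract0l //.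
    by apply/negbTE; move: ni; lia.
  rewrite -(raddf0 (point dv (M := M) n)); apply: point_eq.
  by rewrite raddf0 (gcomp_hom _ mgr) ifF //; apply/negbTE; move: ni; lia.
exists n0 => d c nd cd; rewrite [v](gam_decomp hK) big_map scaler_sumr big_seq.
by apply: (grsub_sum sub) => i iK; apply: hn0 cd.
Qed.

Definition mu : qhom (G (F M)) M :=
  corr murel0 murel_lin murel_comp murel_dom murel_ind.
Definition mu_inv : qhom M (G (F M)) :=
  corr_inv murel0 murel_lin murel_comp murel_codom murel_ker.
End Unit.

Lemma gammas_sections :
  nat_iso (compF (gammas h') (sections b_dim h)) (idF (QGr B)).
Proof.
exists mu, mu_inv; split=> [M N f|M|M].
- apply/qeqP => v w w' [v' <- [h1 h2]] [m [g1 g2] fm].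
  have e n : point dv n w = point dv n w'.
    rewrite -h1 /= g1; apply: secmapE; apply: evtT => d u _ /=.
    exact/qrelZ/qrel_comp.
  have [s ->] := gcomp_sum (w - w').
  apply: (grsub_sum (@tors_elt_sub _ _ N)) => -[n|n] _.
    by apply: (@point_eq0 _ _ _ dv); rewrite raddfB /= e subrr.
  rewrite raddfB /= h2 // sub0r; apply: (grsubN (@tors_elt_sub _ _ N)).
  by apply: (@qind_tors _ _ _ _ f); rewrite /qind -(g2 (Negz n)) //; apply: qrel_comp.
- exact: corrK.
- exact: corr_invK.
Qed.
End Reconstruction.

(** * Recovering a right module from its graded module *)

Section Covering.
Context (k : fieldType) (B : gralg k) (r : nat) (dv : division B r).
Local Notation R := (regular_left B).
Local Notation x := (dx dv).
Local Notation y := (dy dv).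
Local Notation D := (ldiv dv).
Local Notation rd := (rdiv dv).
Context (b : nat -> nat).
Context (beta : forall n, 'rV[B]_(b n)) (beta_basis : forall n, is_basis n (beta n)).

Lemma cover_degree d e u : gpart (e + d) u -> exists q : 'I_(b d) -> B,
  (forall j, gpart e (q j)) /\ u = \sum_j q j * beta d 0 j.
Proof.
move=> /gpart_gen[s [sP ->]]; have [_ hspan _] := beta_basis d.
elim: s sP => [|p s IH] sP.
  exists (fun=> 0); split=> [j|]; first exact: gpart_zero.
  by rewrite big_nil big1 // => j _; rewrite mul0r.
have [q [qe qs]] := IH (fun q qs => sP q (mem_behead (s := p :: s) qs)).
have [p1 p2] := sP p (mem_head _ _); have [c cE] := hspan _ p2.
exists (fun j => c j 0 *: p.1 + q j); split=> [j|]; first exact/gpart_lin/qe.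
rewrite big_cons qs cE combE mulr_sumr -big_split; apply: eq_bigr => j _ /=.
by rewrite mulrDl -scalerAr -scalerAl.
Qed.

(** Since B_d generates B_(>=d), an element u of degree at least d is a sum of
    products rho_w(u) w over a basis of B_d. The coefficients are chosen
    linearly in r + 1 consecutive degrees and extended, hence are left linear
    for large degrees; the germ p_w is rho_w(u) x^d, which has the degree of u.
    In other words, O is a direct summand of a finite sum of copies of O(-d).
    *)
Lemma partition_of_unity d : exists p : 'I_(b d) -> pregerm R,
  (forall j, linear_from (d + r.+1) (p j)) /\
  forall e u, (d <= e)%N -> gpart e u ->
    u = \sum_j iter d rd (p j e u) * beta d 0 j.
Proof.
have cov e l : exists q : 'I_(b d) -> B, (d <= e)%N ->
    (forall j, gpart (e - d) (q j)) /\ beta e 0 l = \sum_j q j * beta d 0 j.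
  have [de|] := leqP d e; last by exists (fun=> 0).
  have [|q hq] := @cover_degree d (e - d) (beta e 0 l); last by exists q.
  by rewrite subnK //; apply: basis_part.
pose q e l := sval (cid (cov e l)).
have qP e l : (d <= e)%N -> (forall j, gpart (e - d) (q e l j)) /\
  beta e 0 l = \sum_j q e l j * beta d 0 j by apply: svalP (cid (cov e l)).
pose p0 j e : B -> R := basis_map (beta e) (fun l => q e l j * x ^+ d : R).
pose n := (d + r.+1)%N; have rn : (r < n)%N by rewrite /n; lia.
have p0_graded j e : (n - r.+1 <= e < n)%N -> graded_at (p0 j) e.
  move=> ne; have de : (d <= e)%N by rewrite /n in ne; lia.
  apply: (basis_map_graded (beta_basis e)) => l; have [hq _] := qP e l de.
  by have := gpart_mul (hq j) (dxX_part dv d); rewrite subnK.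
have p_part j e u : (d <= e)%N -> gpart e u -> gpart e (ext dv n (p0 j) e u : B).
  move=> de ue; have [ne|ne] := leqP n e.
    by have [_ h _] := ext_linear dv rn (p0_graded j) ne; apply: h.
  rewrite ext_init //; have [|_ h _] := p0_graded j e; last exact: h.
  by rewrite ne /n; lia.
exists (fun j => mkpg (ex_intro _ n (ext_linear dv rn (p0_graded j)))).
split=> [j|]; first exact: ext_linear (p0_graded j).
suff H e u : (n - r.+1 <= e)%N -> gpart e u -> (u : R) =
    \sum_j iter d rd (ext dv n (p0 j) e u) * beta d 0 j :> B.
  by move=> e u de ue; apply: (H e) => //; rewrite /n; lia.
move: e u; apply: (@recursive_rel _ _ _ dv R R eq n (fun e u => u)
  (fun e u => \sum_j iter d rd (ext dv n (p0 j) e u) * beta d 0 j) rn) => //.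
- by move=> c u u' v v' -> ->.
- move=> e u ne ue; have re : (r < e)%N by apply: leq_trans ne.
  exact: (ldiv_sum dv re ue).
- move=> e u ne ue.
  transitivity (\sum_j \sum_(i < r.+1) y ^+ i * x *
      iter d rd (ext dv n (p0 j) (e - i.+1) (D i u)) * beta d 0 j).
    apply: eq_bigr => j _; rewrite -mulr_suml; congr (_ * _).
    rewrite (ext_recursive dv (p0 j) rn ne ue).
    rewrite iter_rdiv_sum; apply: eq_bigr => i _; rewrite regular_scale.
    have de : (d <= e - i.+1)%N by have := leq_ord i; rewrite /n in ne; lia.
    apply: (iter_rdivM dv _ de); apply: p_part => //.
    by apply: ldiv_sub_part ue; [lia|apply: leq_ord].
  rewrite exchange_big; apply: eq_bigr => i _.
  rewrite regular_scale mulr_sumr; apply: eq_bigr => j _.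
  by rewrite mulrA.
- move=> e u ne ue; have de : (d <= e)%N by rewrite /n in ne; lia.
  have [hb hspan _] := beta_basis e; have [c ->] := hspan _ ue.
  transitivity (\sum_j \sum_l (c l 0 *: q e l j) * beta d 0 j).
    rewrite combE exchange_big; apply: eq_bigr => l _ /=.
    have [_ {1}->] := qP e l de; rewrite scaler_sumr; apply: eq_bigr => j _.
    by rewrite scalerAl.
  apply: eq_bigr => j _; rewrite -mulr_suml; congr (_ * _).
  rewrite ext_init; last by case/andP: ne.
  rewrite /p0 (basis_mapE _ _ (beta_basis e)) iter_rdiv_sum; apply: eq_bigr => l _.
  by rewrite regular_scale -scalerAl mul1r iter_rdivZ rdivX.
Qed.
End Covering.

Section Counit.
Context (k : fieldType) (B : gralg k) (r : nat) (dv : division B r).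
Local Notation T := (endgerm dv).
Local Notation R := (regular_left B).
Local Notation rd := (rdiv dv).
Context (b : nat -> nat) (b_dim : forall n, has_dim (@gpart k B n) (b n)).
Context (S : algType k) (h : {lrmorphism S -> T}) (h' : {lrmorphism T -> S}).
Hypothesis hK : cancel h h'.
Hypothesis h'K : cancel h' h.
Local Notation G N := (gamma_mod h' N).
Local Notation F M := (gsec h M : lmodType S^c).
Local Notation shift := (shift dv).

Section Object.
Context (N : lmodType S^c).

Lemma start_subproof (v : N) :
  (exists K, forall n, (K <= n)%N -> (if n == 0%N then v else 0) = 0) /\
  forall n, ract h' (if n == 0%N then v else 0) (vertex dv n) = if n == 0%N then v else 0.
Proof.
split=> [|[|n]]; first by exists 1%N => -[].
  by rewrite eqxx vertex0 ract1.
exact: ract0l.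
Qed.
Definition start (v : N) : G N := mkgam (start_subproof v).

Lemma gcomp_start v : gcomp 0 (start v) = start v.
Proof.
apply: gamma_ext => n; rewrite gcomp_gammaE eqz_nat.
by rewrite [RHS]/= ; case: eqP => [->|].
Qed.

Lemma start_act v d c n : gpart d c ->
  (c *: start v : gamma h' N) n = if n == d then ract h' v (shift d c) else 0.
Proof.
move=> cd; rewrite gamZ (bact_hom _ _ _ cd) /= subn_eq0.
case: (ltngtP n d) => [nd|nd|->].
- by [].
- by rewrite ract0l.
- by rewrite subnn mulr1.
Qed.

(** The component of degree 0 of the graded module is N, as e_0 = 1, and v is
    sent to the morphism u |-> u v from B. *)
Definition eps (v : N) : F (G N) := point dv 0 (start v).

Lemma point_start v d c : pointpg dv 0 (start v) d c = c *: start v.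
Proof. by rewrite -[in RHS]gcomp_start. Qed.

Lemma eps_is_linear : linear eps.
Proof.
move=> s v w; rewrite /eps.
have -> : s *: (point dv 0 (start v) : F (G N)) = gact (point dv 0 (start v)) (h s) by [].
rewrite -[h s]repK /point gactE -raddfD; apply/germ_of_eq.
have [n hn] := pgP (rep (h s)); exists n => d u nd ud /=; rewrite !fctE !gcomp_start.
have [_ hgr _] := hn d nd; have tu := hgr u ud.
apply: gamma_ext => m; rewrite gamD !(start_act _ _ ud) (start_act _ _ tu).
case: eqP => _; last by rewrite addr0.
have -> : s *: v = ract h' v (h s) by rewrite /ract hK.
rewrite ractDl ractA; congr (ract h' v _ + _); rewrite -{1}[h s]repK.
exact: (shift_germ dv hn).
Qed.
HB.instance Definition _ := GRing.isLinear.Build S^c N (F (G N)) *:%R eps eps_is_linear.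

(** The identity of O is a sum of composites s_w p_w through O(-d), over a
    basis w of B_d. If u v = 0 for all u in B_d, then v s_w = 0 for all w,
    hence v = 0. *)
Lemma eps_eq0 v : eps v = 0 -> v = 0.
Proof.
rewrite /eps /point -(raddf0 (@germ_of k B (G N))) => /germ_of_eq[d hd].
have [beta [beta_basis _]] := adapted_bases dv b_dim.
have [p [p_lin p_unit]] := partition_of_unity dv beta_basis d.
have one : \sum_j (shift d (beta d 0 j) : T) * germ_of (p j) = 1 :> T.
  have -> : \sum_j (shift d (beta d 0 j) : T) * germ_of (p j) =
      germ_of (\sum_j pgcomp (pointpg dv (M := R) d (beta d 0 j)) (p j)) :> T.
    rewrite raddf_sum; apply: eq_bigr => j _; exact: gactE.
  apply/germ_of_eq; exists d => e u de ue.
  rewrite pg_sum /= [RHS](p_unit e u de ue); apply: eq_bigr => j _.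
  by rewrite (gcomp_id (regular_part_gr (basis_part j (beta_basis d)))).
rewrite -[v](ract1 h') -one.
have -> : forall (s : seq _),
    ract h' v (\sum_(j <- s) (shift d (beta d 0 j) : T) * germ_of (p j)) =
    \sum_(j <- s) ract h' v ((shift d (beta d 0 j) : T) * germ_of (p j)).
  elim=> [|j s IH]; first by rewrite !big_nil ract0r.
  by rewrite !big_cons ractDr IH.
rewrite big1 // => j _; have bj := basis_part j (beta_basis d).
have := hd d _ (leqnn d) bj; rewrite point_start => /(congr1 (fun w : gamma h' N => w d)).
rewrite (start_act _ _ bj) eqxx -ractA => ->.
exact: ract0l.
Qed.

(** If phi is linear from degree d on, it is determined by its values on B_d,
    and its preimage is the sum of the phi(w) p_w over a basis w of B_d. *)
Lemma eps_surj p : exists v, eps v = p.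
Proof.
elim/germ_ind: p => phi; have [d hd] := pgP phi.
have [beta [beta_basis _]] := adapted_bases dv b_dim.
have [p [p_lin p_unit]] := partition_of_unity dv beta_basis d.
pose w j : N := (phi d (beta d 0 j) : gamma h' N) d.
exists (\sum_j ract h' (w j) (germ_of (p j))).
apply/germ_of_eq; exists (d + r.+1)%N => e c de ce.
rewrite point_start; apply: gamma_ext => n; rewrite (start_act _ _ ce).
have nd : (d <= e)%N by lia.
have [_ hgr _] := hd e nd; have := hgr c ce n.
rewrite eqz_nat; case: eqVneq => [-> _|_ -> //].
rewrite ract_suml [in RHS](p_unit e c nd ce).
have pe j : gpart e (p j e c) by have [_ hp _] := p_lin j e de; apply: hp.
have pe' j : gpart (e - d) (iter d rd (p j e c)) by apply: iter_rdiv_part; rewrite subnKC.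
have bj j := basis_part j (beta_basis d).
rewrite (linear_from_sum _ hd nd) => [|j]; last first.
  by have := gpart_mul (pe' j) (bj j); rewrite subnK.
rewrite gam_sum; apply: eq_bigr => j _.
have [_ _ hM] := hd d (leqnn d).
have := hM _ _ _ (pe' j) (bj j); rewrite subnK // => ->.
rewrite gamZ (bact_hom _ _ _ (pe' j)) leq_subr subKn // -/(w j) ractA.
have [_ hw] := gamP (phi d (beta d 0 j) : gamma h' N).
have -> : (germ_of (p j) : T) * shift e c = shift e (p j e c).
  exact: (shift_germ dv (p_lin j)).
have hwj : ract h' (w j) (vertex dv d) = w j := hw d.
rewrite -{1}hwj ractA; congr (ract h' _ _ _).
apply: etrans (point_shift_div dv (M := R) _ nd (pe j)) _.
by rewrite (gcomp_id (regular_part_gr (dxX_part dv d))).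
Qed.
End Object.
Definition eps_inv (N : lmodType S^c) (p : F (G N)) : N := sval (cid (eps_surj p)).

Lemma eps_invK (N : lmodType S^c) (p : F (G N)) : eps (eps_inv p) = p.
Proof. exact: svalP (cid (eps_surj p)). Qed.

Lemma eps_inj (N : lmodType S^c) : injective (@eps N).
Proof.
move=> v w e; apply/eqP; rewrite -subr_eq0; apply/eqP/eps_eq0.
by rewrite raddfB /= e subrr.
Qed.

Lemma eps_inv_is_linear (N : lmodType S^c) : linear (@eps_inv N).
Proof. by move=> s p q; apply: eps_inj; rewrite eps_invK linearP /= !eps_invK. Qed.
HB.instance Definition _ N :=
  GRing.isLinear.Build S^c (F (G N)) N *:%R (@eps_inv N) (@eps_inv_is_linear N).

Lemma eps_natural (N N' : lmodType S^c) (g : {linear N -> N'}) v :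
  secmap b_dim (h := h) (graph (gmap h' g)) (eps v) = eps (g v).
Proof.
apply: secmapE; apply: evtT => d u _; rewrite !point_start /=.
have -> : start (g v) = gmap_fun g (start v).
  by apply: gamma_ext => n /=; case: eqP => // _; rewrite raddf0.
exact: linearZ.
Qed.

Lemma sections_gammas :
  nat_iso (compF (sections b_dim h) (gammas h')) (idF (ModR S)).
Proof.
exists (fun N : lmodType S^c => @eps_inv N : {linear _ -> _}).
exists (fun N : lmodType S^c => @eps N : {linear _ -> _}).
split=> [N N' g p|N p|N v] /=.
- rewrite -[p](@eps_invK N); apply: eps_inj; rewrite eps_invK.
  by rewrite [LHS]eps_natural (eps_inj (eps_invK _)).
- exact: eps_invK.
- exact: (eps_inj (eps_invK _)).
Qed.

Lemma sections_equivalence : is_equivalence (sections b_dim h).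
Proof.
exists (gammas h'); split; [exact: gammas_sections|exact: sections_gammas].
Qed.
End Counit.

(** * The equivalence *)

Theorem theorem4p5 (k : fieldType) (r : nat) (hr : (1 <= r)%N)
    (b : nat -> nat)
    (hb : forall n : nat, has_dim (@gpart k (Btrunc k r) n) (b n))
    (S : algType k) (iota : forall n : nat, Sn k r b n -> S)
    (hS : is_direct_limit iota) :
  exists F : functor (QGr (Btrunc k r)) (ModR S),
    is_equivalence F /\ isomorphic (F (OO (Btrunc k r))) (regular_right S).
Proof.
pose dv := Btrunc_division k r.
have [beta [beta_basis beta_glue]] := adapted_bases dv hb.
have [h [h' [hK h'K]]] := limit_iso hb beta_basis beta_glue hS.
exists (sections hb h); split; first exact: (sections_equivalence hb hK h'K).
exact: sections_OO hK h'K.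
Qed.
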